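(* Let $(X,\mu,T)$ be an ergodic measure-preserving system and $k\in\mathbb{N}$. Then the distal factor $\mathcal{D}_{k-1}$ of order $k-1$ of $(X,\mu,T)$ is characteristic for $k$-term multiple ergodic averages: denoting by $P$ the orthogonal projection of $L^2(X,\mu)$ onto the subspace $D_{k-1}$ induced by $\mathcal{D}_{k-1}$, for all $f_1,\dots,f_k\in L^\infty(X,\mu)$ the averages $$\frac1N\sum_{n=1}^N T^nf_1\cdot T^{2n}f_2\cdots T^{kn}f_k$$ converge in $L^2(X,\mu)$ as $N\to\infty$ if and only if the averages $$\frac1N\sum_{n=1}^N T^n(Pf_1)\cdot T^{2n}(Pf_2)\cdots T^{kn}(Pf_k)$$ converge in $L^2(X,\mu)$, and in this case the two limits coincide.
   Context: Systems. A measure-preserving system is a triple $(X,\mu,\varphi)$ where $(X,\mu)$ is a probability space and $\varphi:X\to X$ is measurable, invertible with measurable inverse, and $\mu$-preserving. Its Koopman operator is $Tf:=f\circ\varphi$, and one writes $(X,\mu,T)$. The $\sigma$-algebra need not be countably generated. The system is ergodic if every measurable $A$ with $\varphi^{-1}A\subset A$ up to a null set has measure $0$ or $1$. Write $L^p(X)$ for $L^p(X,\mu)$. Factors. A system $(Y,\nu,S)$ is a (Markov) factor of $(X,\mu,T)$ if there is a positive linear operator $J:L^1(Y)\to L^1(X)$ with $J\mathbf 1=\mathbf 1$, $\int_X Jf\,d\mu=\int_Y f\,d\nu$ for all $f\in L^1(Y)$, $J$ multiplicative on $L^\infty(Y)$, and $JS=TJ$. The conditional expectation operator $E_Y:L^1(X)\to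 L^1(Y)$ is the extension of the adjoint of $J$. Functions $c\in L^\infty(Y)$ are identified with $Jc$, so that $cf$ makes sense for $f\in L^1(X)$. A subspace $\mathcal A\subset L^2(X)$ is induced by the factor $(Y,\nu,S)$ if $\mathcal A=JL^2(Y)$; equivalently, $\mathcal A=L^2(X,\Sigma',\mu)$ for the corresponding $\varphi$- and $\varphi^{-1}$-invariant sub-$\sigma$-algebra $\Sigma'$. The orthogonal projection onto $JL^2(Y)$ is $JE_Y$, which maps $L^\infty(X)$ into $L^\infty(X)$. Conditional almost periodicity. For a factor $(Y,\nu,S)$ and $f\in L^2(X)$ put $\|f\|_{L^2(X|Y)}:=(E_Y(|f|^2))^{1/2}$, and let $L^2(X|Y):=\{f\in L^2(X):\|f\|_{L^2(X|Y)}\in L^\infty(Y)\}$. A function $f\in L^2(X|Y)$ is conditionally almost periodic if for every $\varepsilon>0$ there are $m\in\mathbb{N}$ and $f_1,\dots,f_m\in L^2(X|Y)$ such that for every $n\in\mathbb{Z}$ there is $g\in\{c_1f_1+\dots+c_mf_m:\ c_i\in L^\infty(Y),\ \|c_i\|_{L^\infty(Y)}\le 1\}$ with $\big\|\|T^nf-g\|_{L^2(X|Y)}\big\|_{L^\infty(Y)}<\varepsilon$. $A(X|Y)$ denotes the space of all such $f$, and $\overline{A(X|Y)}$ its closure in $L^2(X)$. When $(Y,\nu,S)$ is ergodic, $\overline{A(X|Y)}$ is induced by a factor of $(X,\mu,T)$. Distal factors. For an ergodic system $(X,\mu,T)$ let $D_0:=\mathbb{C}\mathbf 1$ with $\mathcal{D}_0$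 the one-point factor, and inductively, for $k\in\mathbb{N}$, let $D_k:=\overline{A(X|\mathcal{D}_{k-1})}$ and let $\mathcal{D}_k$ be the factor inducing $D_k$, called the distal factor of order $k$. *)

(* Defs.v *)
From HB Require Import structures.
From mathcomp Require Import all_boot all_order all_algebra.
From mathcomp Require Import complex.
From mathcomp Require Import all_classical all_reals all_analysis.

Set Implicit Arguments.
Unset Strict Implicit.
Unset Printing Implicit Defensive.

Import Order.TTheory GRing.Theory Num.Theory.
Import numFieldNormedType.Exports.

Local Open Scope classical_set_scope.
Local Open Scope ring_scope.

(* The elements of L^p(X, mu) are represented by genuine functions
   [X -> R[i]]; identities between them are stated almost everywhere. *)

Section ComplexLp.
Context (d : measure_display) (X : measurableType d) (R : realType).
Implicit Types (mu : {measure set X -> \bar R}) (f g : X -> R[i]).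

Definition cmeasurable f : Prop :=
  measurable_fun setT (fun x => complex.Re (f x)) /\
  measurable_fun setT (fun x => complex.Im (f x)).

(* [`|z|] lives in [R[i]]; its real part is the modulus as an element of [R]. *)
Definition cmod (z : R[i]) : R := complex.Re `|z|.

(* [p] is extended real: [1%E], [2%:E] and [+oo%E] are used below. *)
Definition cLnorm mu (p : \bar R) f : \bar R :=
  'N[mu]_p[EFin \o (cmod \o f)]%E.

Definition inLp mu (p : \bar R) f : Prop :=
  cmeasurable f /\ (cLnorm mu p f < +oo)%E.

Definition cintegral mu f : R[i] :=
  Complex (Rintegral mu setT (fun x => complex.Re (f x)))
          (Rintegral mu setT (fun x => complex.Im (f x))).

Definition L2_cvg mu (u : nat -> X -> R[i]) g : Prop :=
  inLp mu 2%:E g /\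
  (fun N => cLnorm mu 2%:E (fun x => u N x - g x)) @ \oo --> 0%E.

Definition L2_converges mu (u : nat -> X -> R[i]) : Prop :=
  exists g, L2_cvg mu u g.

Definition L2_closure mu (A : set (X -> R[i])) : set (X -> R[i]) :=
  [set f | inLp mu 2%:E f /\
    forall e : R, 0 < e ->
      exists2 g, A g & (cLnorm mu 2%:E (fun x => f x - g x)%R < e%:E)%E].

(* [P] sends a representative of an [L^2]-class to a representative of its
   orthogonal projection onto the subspace [D]. *)
Definition is_orth_proj mu (D : set (X -> R[i]))
    (P : (X -> R[i]) -> (X -> R[i])) : Prop :=
  forall f, inLp mu 2%:E f ->
    D (P f) /\
    forall h, D h -> cintegral mu (fun x => (f x - P f x) * conjc (h x)) = 0.

End ComplexLp.

Record mpsystem (R : realType) := MPSystem {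
  mps_display : measure_display;
  mps_space :> measurableType mps_display;
  mps_prob : probability mps_space R;
  mps_map : mps_space -> mps_space;
  mps_inv : mps_space -> mps_space;
  mps_mapK : cancel mps_map mps_inv;
  mps_invK : cancel mps_inv mps_map;
  mps_map_measurable : measurable_fun setT mps_map;
  mps_inv_measurable : measurable_fun setT mps_inv;
  mps_preserving : forall A : set mps_space,
    measurable A -> mps_prob (mps_map @^-1` A) = mps_prob A
}.
Arguments mps_prob {R} m.
Arguments mps_map {R} m _.
Arguments mps_inv {R} m _.

Definition ergodic (R : realType) (X : mpsystem R) : Prop :=
  forall A : set X, measurable A ->
    (mps_prob X).-negligible ((mps_map X @^-1` A) `\` A) ->
    mps_prob X A = 0%E \/ mps_prob X A = 1%E.

Definition mps_iter (R : realType) (X : mpsystem R) (n : int) : X -> X :=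
  match n with
  | Posz m => iter m (mps_map X)
  | Negz m => iter m.+1 (mps_inv X)
  end.

Definition koopman (R : realType) (X : mpsystem R) (n : int)
  (f : X -> R[i]) : X -> R[i] := fun x => f (mps_iter n x).

(* The Markov embedding J = [mf_op] acts on representatives; only its values on [L^1] matter.
   In [mf_pos], [0 <= z] for [z : R[i]] says that [z] is a nonnegative real. *)
Record mfactor (R : realType) (X : mpsystem R) := MFactor {
  mf_sys :> mpsystem R;
  mf_op : (mf_sys -> R[i]) -> (X -> R[i]);
  mf_L1 : forall f, inLp (mps_prob mf_sys) 1%E f ->
    inLp (mps_prob X) 1%E (mf_op f);
  mf_ae : forall f g, inLp (mps_prob mf_sys) 1%E f ->
    inLp (mps_prob mf_sys) 1%E g ->
    {ae mps_prob mf_sys, forall y, f y = g y} ->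
    {ae mps_prob X, forall x, mf_op f x = mf_op g x};
  mf_linear : forall (a : R[i]) f g, inLp (mps_prob mf_sys) 1%E f ->
    inLp (mps_prob mf_sys) 1%E g ->
    {ae mps_prob X, forall x,
      mf_op (fun y => a * f y + g y) x = a * mf_op f x + mf_op g x};
  mf_pos : forall f, inLp (mps_prob mf_sys) 1%E f ->
    {ae mps_prob mf_sys, forall y, 0 <= f y} ->
    {ae mps_prob X, forall x, 0 <= mf_op f x};
  mf_one : {ae mps_prob X, forall x, mf_op (fun=> 1) x = 1};
  mf_integral : forall f, inLp (mps_prob mf_sys) 1%E f ->
    cintegral (mps_prob X) (mf_op f) = cintegral (mps_prob mf_sys) f;
  mf_mul : forall f g, inLp (mps_prob mf_sys) +oo%E f ->
    inLp (mps_prob mf_sys) +oo%E g ->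
    {ae mps_prob X, forall x,
      mf_op (fun y => f y * g y) x = mf_op f x * mf_op g x};
  mf_koopman : forall f, inLp (mps_prob mf_sys) 1%E f ->
    {ae mps_prob X, forall x,
      mf_op (koopman 1 f) x = koopman 1 (mf_op f) x}
}.
Arguments mf_op {R X} m _ _.

Section Factor.
Context (R : realType) (X : mpsystem R) (Y : mfactor X).
Let mu := mps_prob X.
Let nu := mps_prob Y.

(* J L^2(Y), as a set of representatives. *)
Definition factor_space : set (X -> R[i]) :=
  [set f | inLp mu 2%:E f /\
    exists2 g, inLp nu 2%:E g & {ae mu, forall x, f x = mf_op Y g x}].

Definition induces (D : set (X -> R[i])) : Prop := D = factor_space.

(* The duality pairing that makes E_Y the adjoint of J, for [f] in L^1(X) and
   test functions [g] in L^∞(Y); it determines [h] almost everywhere. *)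
Definition is_cond_exp (f : X -> R[i]) (h : Y -> R[i]) : Prop :=
  inLp nu 1%E h /\
  forall g, inLp nu +oo%E g ->
    cintegral nu (fun y => h y * g y) =
    cintegral mu (fun x => f x * mf_op Y g x).

Definition cond_exp (f : X -> R[i]) : Y -> R[i] :=
  xget (fun=> 0) [set h | is_cond_exp f h].

(* ||f||_{L^2(X|Y)}, a function on Y. *)
Definition cond_norm (f : X -> R[i]) : Y -> R :=
  fun y => Num.sqrt (complex.Re (cond_exp (fun x => `|f x| ^+ 2) y)).

Definition cond_norm_sup (f : X -> R[i]) : \bar R :=
  'N[nu]_+oo[EFin \o cond_norm f]%E.

Definition L2cond : set (X -> R[i]) :=
  [set f | inLp mu 2%:E f /\ (cond_norm_sup f < +oo)%E].

(* A(X|Y). *)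
Definition cond_almost_periodic : set (X -> R[i]) :=
  [set f | L2cond f /\
    forall e : R, 0 < e ->
      exists (m : nat) (fs : 'I_m -> X -> R[i]),
        (forall i, L2cond (fs i)) /\
        forall n : int, exists c : 'I_m -> Y -> R[i],
          (forall i, inLp nu +oo%E (c i) /\ (cLnorm nu +oo%E (c i) <= 1)%E) /\
          (cond_norm_sup (fun x => koopman n f x -
             \sum_(i < m) mf_op Y (c i) x * fs i x)%R < e%:E)%E].

End Factor.

(* [D] represents the distal factor of order [k].  A factor is determined up
   to isomorphism by the subspace it induces, and D_0 = C.1 is the subspace
   induced by the one-point factor. *)
Fixpoint distal_factor (R : realType) (X : mpsystem R) (k : nat)
    (D : mfactor X) : Prop :=
  match k with
  | 0 => induces D
      [set f | cmeasurable f /\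
        exists a : R[i], {ae mps_prob X, forall x, f x = a}]
  | k'.+1 => exists D' : mfactor X,
      distal_factor k' D' /\
      induces D (L2_closure (mps_prob X) (cond_almost_periodic D'))
  end.

(* The function [f i], [i : 'I_k], is f_{i+1}. *)
Definition multiple_average (R : realType) (X : mpsystem R) (k : nat)
    (f : 'I_k -> X -> R[i]) (N : nat) : X -> R[i] := fun x =>
  N%:R^-1 *
  \sum_(1 <= n < N.+1) \prod_(i < k) koopman (Posz (i.+1 * n)) (f i) x.

(* Main.v *)
From HB Require Import structures.
Require Import Defs.
From mathcomp Require Import all_boot all_order all_algebra.
From mathcomp Require Import complex ring lra zify.
From mathcomp Require Import all_classical all_reals all_analysis.
From mathcomp Require Import measurable_realfun ess_sup_inf.

(* Proof by induction on k, for bounded real functions: if some f_j is orthogonal to D_(k-1), then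
   the averages of f_1, ..., f_k tend to 0 in L^2.  Van der Corput's inequality and the induction
   hypothesis for D_(k-2) =: L^2(Y) bound the limit by Cesaro means of the correlations
   c(a, b) = int E_Y(T^a f_j T^b f_j)^2.  The mean ergodic theorem for the kernels of the operators
   g |-> T^a f_j E_Y(T^a f_j g) yields a limit phi of the averaged operators applied to f_j, and the
   Cesaro means of c tend to 0 as soon as phi is orthogonal to f_j.  Now phi is conditionally almost
   periodic over Y: the averaged operators have fibrewise finite rank, commute with T in the limit
   and converge uniformly over a set B of positive measure in Y; by ergodicity the translates of B
   cover Y.  Hence phi is orthogonal to f_j.  The case k = 1 is the mean ergodic theorem, and the
   general statement follows by telescoping and splitting into real and imaginary parts. *)

Set Implicit Arguments.
Unset Strict Implicit.
Unset Printing Implicit Defensive.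

Import Order.TTheory GRing.Theory Num.Theory.
Import numFieldNormedType.Exports.

Local Open Scope classical_set_scope.
Local Open Scope ring_scope.

(** * Bounded functions *)

(** No fibre measures are available, as the sigma-algebras need not be countably generated.
    Fibrewise statements therefore appear as integrals against [J \1_A] for measurable sets A of Y,
    and the fibrewise Cauchy-Schwarz inequality as positivity of a conditional Gram matrix. Nor is a
    Hilbert space of kernels constructed: polynomials stand for finite combinations of kernels, and
    only the numbers c(a, b) enter. T conjugates the operator of index a into that of index a + 1,
    which is why T^n phi is close to K_N(T^n f), K_N being the averaged operator, with one N for all
    integers n. Now K_N g is a combination of the N functions T^a f with coefficients E_Y(T^a f g) /
    N in L^oo(Y), so that only the coefficients depend on n. The obstacle is that closeness in
    L^2(X) gives no essentially uniform bound of the conditional norm on Y; hence the set B. If phi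
    is orthogonal to f, the inner products of K_N T^b f with T^b f are small uniformly in b, and
    their mean over b <= N is the mean of c(a, b) over a, b <= N. *)

Section NullSequences.
Variable R : realType.
Implicit Types a b : nat -> R.

Definition tends0 a : Prop :=
  forall e : R, 0 < e -> exists N0, forall N, (N0 <= N)%N -> `|a N| <= e.

Lemma tends0_le a b : tends0 b -> (forall N, `|a N| <= b N) -> tends0 a.
Proof.
move=> b0 ab e e0; have [N0 H] := b0 _ e0; exists N0 => N /H; apply: le_trans.
exact: le_trans (ab N) (ler_norm _).
Qed.

Lemma tends0_eq a b : tends0 b -> a =1 b -> tends0 a.
Proof. by move=> b0 ab e e0; have [N H] := b0 e e0; exists N => m; rewrite ab; exact: H. Qed.

Lemma tends0D a b : tends0 a -> tends0 b -> tends0 (fun N => a N + b N).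
Proof.
move=> a0 b0 e e0; have e2 : 0 < e / 2 by rewrite divr_gt0.
have [N1 H1] := a0 _ e2; have [N2 H2] := b0 _ e2.
exists (maxn N1 N2) => N; rewrite geq_max => /andP[/H1 h1 /H2 h2].
by apply: le_trans (ler_normD _ _) _; lra.
Qed.

Lemma tends0Z a (c : R) : tends0 a -> tends0 (fun N => c * a N).
Proof.
move=> a0 e e0; have c0 : 0 < `|c| + 1 by rewrite ltr_pwDr.
have e2 : 0 < e / (`|c| + 1) by rewrite divr_gt0.
have [N H] := a0 _ e2; exists N => n /H h; rewrite normrM.
apply: le_trans (ler_wpM2l (normr_ge0 _) h) _.
by rewrite mulrCA ler_piMr ?(ltW e0)// ler_pdivrMr// mul1r lerDl.
Qed.

Lemma tends00 : tends0 (fun=> 0).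
Proof. by move=> e e0; exists 0%N => N _; rewrite normr0 ltW. Qed.

Lemma tends0_sum (I : Type) (s : seq I) (a : I -> nat -> R) :
  (forall i, tends0 (a i)) -> tends0 (fun N => \sum_(i <- s) a i N).
Proof.
move=> H; elim: s => [|i s IH].
  by apply: (tends0_eq tends00) => N; rewrite big_nil.
by apply: (tends0_eq (tends0D (H i) IH)) => N; rewrite big_cons.
Qed.

Lemma tends0_invn : tends0 (fun N => N%:R^-1).
Proof.
move=> e e0; exists (Num.truncn e^-1).+1 => N h.
have h' : e^-1 <= N%:R.
  by apply/ltW/(lt_le_trans (truncnS_gt _)); rewrite ler_nat.
have N0 : 0 < N%:R :> R by apply: lt_le_trans h'; rewrite invr_gt0.
by rewrite ger0_norm ?invr_ge0 ?(ltW N0)// -[e]invrK lef_pV2 ?posrE ?invr_gt0.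
Qed.

Lemma tends0_approx a : (forall e : R, 0 < e -> exists b, tends0 b /\
   exists N1, forall N, (N1 <= N)%N -> `|a N| <= e + b N) -> tends0 a.
Proof.
move=> H e e0; have e2 : 0 < e / 2 by rewrite divr_gt0.
have [b [b0 [N1 H1]]] := H _ e2; have [N2 H2] := b0 _ e2.
exists (maxn N1 N2) => N; rewrite geq_max => /andP[/H1 h1 /H2 h2].
by apply: le_trans h1 _; have := ler_norm (b N); lra.
Qed.

Lemma tends0_cst_le0 (c : R) a : tends0 a -> (forall N, c <= a N) -> c <= 0.
Proof.
move=> a0 H; rewrite leNgt; apply/negP => c0.
have c2 : 0 < c / 2 by rewrite divr_gt0.
have [N h] := a0 _ c2; have := h N (leqnn N); have := H N; have := ler_norm (a N).
lra.
Qed.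

Lemma cvg_tends0 a : a @ \oo --> (0 : R) <-> tends0 a.
Proof.
split=> [/cvgrPdist_le H e e0|H].
  have [N _ h] := H _ e0; exists N => n Nn.
  by have := h n Nn; rewrite sub0r normrN.
apply/cvgrPdist_le => e /H[N h]; exists N => // n /= /h.
by rewrite sub0r normrN.
Qed.

End NullSequences.

(** One induction for the three classes of functions used later: [bm], [Mfun] and [cmeasurable]. *)
Lemma closed_big (T S I : Type) (C : (T -> S) -> Prop) (op : S -> S -> S) (idx : S)
    (s : seq I) (Q : pred I) (f : I -> T -> S) :
  C (fun=> idx) -> (forall g h, C g -> C h -> C (fun x => op (g x) (h x))) ->
  (forall i, C (f i)) -> C (fun x => \big[op/idx]_(i <- s | Q i) f i x).
Proof.
move=> C0 Cop Cf; elim: s => [|i s IH].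
  by apply: (eq_ind _ C C0); apply/funext => x; rewrite big_nil.
case Qi : (Q i); last first.
  by apply: (eq_ind _ C IH); apply/funext => x; rewrite big_cons Qi.
by apply: (eq_ind _ C (Cop _ _ (Cf i) IH)); apply/funext => x; rewrite big_cons Qi.
Qed.

Section BoundedFunctions.
Context (d : measure_display) (T : measurableType d) (R : realType).
Variable P : probability T R.
Implicit Types f g h : T -> R.

(** Measurability holds everywhere but the bound only almost everywhere: [J] and the conditional
    expectations are representatives that no pointwise bound controls. *)
Definition bm f : Prop :=
  measurable_fun setT f /\ exists C : R, {ae P, forall x, `|f x| <= C}.

Definition EI f : R := Rintegral P setT f.

Lemma bm_ext f g : bm f -> f =1 g -> bm g.
Proof. by move=> ? /funext <-. Qed.

Lemma bm_cst (c : R) : bm (fun=> c).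
Proof. by split => //; exists `|c|; apply: aeW. Qed.

Lemma bmD f g : bm f -> bm g -> bm (fun x => f x + g x).
Proof.
move=> [mf [C fC]] [mg [C' gC]]; split; first exact: measurable_funD.
exists (C + C'); apply: filterS2 fC gC => x h1 h2.
exact: le_trans (ler_normD _ _) (lerD h1 h2).
Qed.

Lemma bmM f g : bm f -> bm g -> bm (fun x => f x * g x).
Proof.
move=> [mf [C fC]] [mg [C' gC]]; split; first exact: measurable_funM.
exists (C * C'); apply: filterS2 fC gC => x h1 h2.
by rewrite normrM ler_pM.
Qed.

Lemma bmZ (c : R) f : bm f -> bm (fun x => c * f x).
Proof. by move=> bf; apply: bmM bf; exact: bm_cst. Qed.

Lemma bmN f : bm f -> bm (fun x => - f x).
Proof. by move=> bf; apply: (bm_ext (bmZ (-1) bf)) => x; rewrite mulN1r. Qed.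

Lemma bmB f g : bm f -> bm g -> bm (fun x => f x - g x).
Proof. by move=> bf bg; apply: bmD bf (bmN bg). Qed.

Lemma bmX f n : bm f -> bm (fun x => f x ^+ n).
Proof.
move=> bf; elim: n => [|n IH]; first exact: bm_cst.
by apply: (bm_ext (bmM bf IH)) => x; rewrite exprS.
Qed.

Lemma bm_norm f : bm f -> bm (fun x => `|f x|).
Proof.
move=> [mf [C fC]]; split; first exact: measurableT_comp.
by exists C; apply: filterS fC => x; rewrite normr_id.
Qed.

Lemma bm_sum (I : Type) (s : seq I) (Q : pred I) (f : I -> T -> R) :
  (forall i, bm (f i)) -> bm (fun x => \sum_(i <- s | Q i) f i x).
Proof. by apply: closed_big; [exact: bm_cst|exact: bmD]. Qed.

Lemma bm_prod (I : Type) (s : seq I) (Q : pred I) (f : I -> T -> R) :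
  (forall i, bm (f i)) -> bm (fun x => \prod_(i <- s | Q i) f i x).
Proof. by apply: closed_big; [exact: bm_cst|exact: bmM]. Qed.

Lemma bm_indic (A : set T) : measurable A -> bm (\1_A : T -> R).
Proof.
move=> mA; split; first exact: measurable_indic.
by exists 1; apply: aeW => x; rewrite indicE; case: (x \in A); rewrite ?normr1 ?normr0.
Qed.

Lemma bm_integrable f : bm f -> P.-integrable setT (EFin \o f).
Proof.
move=> [mf [C fC]].
have mf' : measurable_fun setT (EFin \o f) by exact/measurable_EFinP.
apply/integrableP; split => //.
apply: (@le_lt_trans _ _ (\int[P]_x (`|C|)%:E)%E).
  apply: ae_ge0_le_integral => //.
  - exact: measurableT_comp.
  - by apply: filterS fC => x h _; rewrite lee_fin (le_trans h)// ler_norm.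
by rewrite integral_cst//= probability_setT mule1 ltry.
Qed.

Lemma EI_cst (c : R) : EI (fun=> c) = c.
Proof. by rewrite /EI Rintegral_cst//= probability_setT mulr1. Qed.

Lemma EID f g : bm f -> bm g -> EI (fun x => f x + g x) = EI f + EI g.
Proof. by move=> bf bg; rewrite /EI RintegralD//; exact: bm_integrable. Qed.

Lemma EIB f g : bm f -> bm g -> EI (fun x => f x - g x) = EI f - EI g.
Proof. by move=> bf bg; rewrite /EI RintegralB//; exact: bm_integrable. Qed.

Lemma EIZ (c : R) f : bm f -> EI (fun x => c * f x) = c * EI f.
Proof. by move=> bf; rewrite /EI RintegralZl//; exact: bm_integrable. Qed.

Lemma EI_sum (I : Type) (s : seq I) (Q : pred I) (f : I -> T -> R) :
  (forall i, bm (f i)) ->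
  EI (fun x => \sum_(i <- s | Q i) f i x) = \sum_(i <- s | Q i) EI (f i).
Proof.
move=> H; elim: s => [|i s IH].
  rewrite big_nil -[RHS](EI_cst 0); congr EI; apply/funext => x; exact: big_nil.
rewrite big_cons; case Qi : (Q i).
  rewrite -IH -EID//; last exact: bm_sum.
  by congr EI; apply/funext => x; rewrite big_cons Qi.
by rewrite -IH; congr EI; apply/funext => x; rewrite big_cons Qi.
Qed.

Lemma ae_EI f g : bm f -> bm g -> {ae P, forall x, f x = g x} -> EI f = EI g.
Proof.
move=> [mf _] [mg _] fg; rewrite /EI /Rintegral; congr fine.
apply: ae_eq_integral => //; [exact/measurable_EFinP|exact/measurable_EFinP|].
by apply: filterS fg => x /= -> _.
Qed.

Lemma EI_ge0 f : bm f -> {ae P, forall x, 0 <= f x} -> 0 <= EI f.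
Proof.
move=> bf f0; have -> : EI f = EI (fun x => `|f x|).
  apply: ae_EI => //; first exact: bm_norm.
  by apply: filterS f0 => x h; rewrite ger0_norm.
by apply: Rintegral_ge0 => x _.
Qed.

Lemma EI_sqr_ge0 f : bm f -> 0 <= EI (fun x => f x ^+ 2).
Proof. by move=> bf; apply: EI_ge0; [exact: bmX|apply: aeW => x; exact: sqr_ge0]. Qed.

Lemma EI_le f g : bm f -> bm g -> {ae P, forall x, f x <= g x} -> EI f <= EI g.
Proof.
move=> bf bg fg; rewrite -subr_ge0 -EIB//; apply: EI_ge0; first exact: bmB.
by apply: filterS fg => x; rewrite subr_ge0.
Qed.

Lemma EI_le_norm f : bm f -> `|EI f| <= EI (fun x => `|f x|).
Proof. by move=> bf; apply: le_normr_Rintegral => //; exact: bm_integrable. Qed.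

(** The variance of f is nonnegative. *)
Lemma EI_sq_le f : bm f -> EI f ^+ 2 <= EI (fun x => f x ^+ 2).
Proof.
move=> bf; set c := EI f.
have : 0 <= EI (fun x => (f x - c) ^+ 2).
  by apply: EI_sqr_ge0; apply: bmB => //; exact: bm_cst.
have -> : EI (fun x => (f x - c) ^+ 2) = EI (fun x => f x ^+ 2) - (2 * c * c) + c ^+ 2.
  have -> : (fun x => (f x - c) ^+ 2) =
    (fun x => (f x ^+ 2 - (2 * c) * f x) + c ^+ 2) by apply/funext => x; ring.
  rewrite EID ?EIB ?EIZ ?EI_cst//; try exact: bm_cst; try exact: bmX; try exact: bmZ.
  by apply: bmB; [exact: bmX|exact: bmZ].
rewrite expr2; lra.
Qed.

Lemma EI_indic (A : set T) : measurable A -> EI (\1_A : T -> R) = fine (P A).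
Proof. by move=> mA; rewrite /EI /Rintegral integral_indic// setIT. Qed.

Definition l2null (u : nat -> T -> R) : Prop :=
  tends0 (fun N => EI (fun x => u N x ^+ 2)).

Lemma l2null_ae (u v : nat -> T -> R) : (forall N, bm (u N)) ->
  (forall N, bm (v N)) -> (forall N, {ae P, forall x, u N x = v N x}) ->
  l2null u -> l2null v.
Proof.
move=> bu bv uv H; apply: (tends0_eq H) => N; apply: ae_EI; try exact: bmX.
by apply: filterS (uv N) => x ->.
Qed.

Lemma l2nullD u v : (forall N, bm (u N)) -> (forall N, bm (v N)) ->
  l2null u -> l2null v -> l2null (fun N x => u N x + v N x).
Proof.
move=> bu bv u0 v0.
apply: (@tends0_le _ _ (fun N => 2 * EI (fun x => u N x ^+ 2) + 2 * EI (fun x => v N x ^+ 2))).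
  by apply: tends0D; apply: tends0Z.
move=> N; have b1 := bmX 2 (bu N); have b2 := bmX 2 (bv N).
have b3 : bm (fun x => (u N x + v N x) ^+ 2) by apply: bmX; exact: bmD.
rewrite ger0_norm; last by apply: EI_ge0 => //; apply: aeW => x; exact: sqr_ge0.
rewrite -!EIZ// -EID; try exact: bmZ.
apply: EI_le => //; first by apply: bmD; exact: bmZ.
apply: aeW => x; have := sqr_ge0 (u N x - v N x); rewrite !expr2; lra.
Qed.

Lemma l2nullM u (v : nat -> T -> R) (C : R) : (forall N, bm (u N)) ->
  (forall N, bm (v N)) -> (forall N, {ae P, forall x, `|v N x| <= C}) ->
  l2null u -> l2null (fun N x => v N x * u N x).
Proof.
move=> bu bv vC u0.
apply: (@tends0_le _ _ (fun N => C ^+ 2 * EI (fun x => u N x ^+ 2))).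
  exact: tends0Z.
move=> N; have b1 := bmX 2 (bu N).
have b3 : bm (fun x => (v N x * u N x) ^+ 2) by apply: bmX; exact: bmM.
rewrite ger0_norm; last by apply: EI_ge0 => //; apply: aeW => x; exact: sqr_ge0.
rewrite -!EIZ//; apply: EI_le => //; first exact: bmZ.
apply: filterS (vC N) => x h; rewrite exprMn ler_wpM2r ?sqr_ge0//.
by rewrite -real_normK ?num_real// lerXn2r// nnegrE (le_trans _ h).
Qed.

Lemma l2nullZ (c : R) u : (forall N, bm (u N)) -> l2null u ->
  l2null (fun N x => c * u N x).
Proof.
move=> bu; apply: (l2nullM bu (C := `|c|)) => N; first exact: bm_cst.
exact: aeW.
Qed.

Lemma l2null_sum (I : Type) (s : seq I) (u : I -> nat -> T -> R) :
  (forall i N, bm (u i N)) -> (forall i, l2null (u i)) ->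
  l2null (fun N x => \sum_(i <- s) u i N x).
Proof.
move=> bu H; elim: s => [|i s IH].
  apply: (tends0_eq (@tends00 _)) => N; rewrite -[RHS](EI_cst 0); congr EI.
  by apply/funext => x; rewrite big_nil expr0n.
apply: (tends0_eq (l2nullD (bu i) _ (H i) IH)) => N; first exact: bm_sum.
by congr EI; apply/funext => x; rewrite big_cons.
Qed.

Lemma l2null_unif (u : nat -> T -> R) (a : nat -> R) : (forall N, bm (u N)) ->
  (forall N, {ae P, forall x, `|u N x| <= a N}) -> tends0 a -> l2null u.
Proof.
move=> bu ua a0 e e0.
(* With a bound at most [Num.min 1 e], the square of [u N] is at most |u N|, hence at most e. *)
have e1 : 0 < Num.min 1 e by rewrite lt_min ltr01.
have [N0 H] := a0 _ e1; exists N0 => N /H h.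
rewrite ger0_norm; last exact: EI_sqr_ge0.
rewrite -(EI_cst e); apply: EI_le; [exact: bmX|exact: bm_cst|].
apply: filterS (ua N) => x hx; rewrite -real_normK ?num_real//.
have h1 : `|u N x| <= Num.min 1 e by rewrite (le_trans hx)// (le_trans (ler_norm _)).
have [h2 h3] : `|u N x| <= 1 /\ `|u N x| <= e by split; rewrite (le_trans h1)// ge_min lexx ?orbT.
by rewrite expr2 (le_trans _ h3)// ler_piMl.
Qed.

End BoundedFunctions.

(** * Completeness of L^2 for uniformly bounded sequences *)

Section L2Completeness.
Context (d : measure_display) (T : measurableType d) (R : realType).
Variable P : probability T R.

Local Notation bm := (bm P).
Local Notation EI := (EI P).

(** By monotone convergence the full sum has integral at most [S], so it is finite almost
    everywhere, and it dominates its partial sums. *)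
Lemma ae_bounded_partial_sums (g : nat -> T -> R) (S : R) :
  (forall k, bm (g k)) -> (forall k x, 0 <= g k x) ->
  (forall n, \sum_(0 <= k < n) EI (g k) <= S) ->
  {ae P, forall x, exists M : R, forall n, \sum_(0 <= k < n) g k x <= M}.
Proof.
move=> bg g0 gS.
have mg k : measurable_fun setT (EFin \o g k) by apply/measurable_EFinP; case: (bg k).
pose G (x : T) : \bar R := (\sum_(0 <= k <oo) (g k x)%:E)%E.
have mG : measurable_fun setT G.
  apply: ge0_emeasurable_sum; first by move=> k x xT k0; rewrite lee_fin.
  by move=> k k0; exact: mg.
have IG : (\int[P]_x G x <= S%:E)%E.
  rewrite integral_nneseries//; last by move=> *; rewrite lee_fin.
  apply: lime_le.
    by apply: is_cvg_nneseries => k _ _; apply: integral_ge0 => x _; rewrite lee_fin.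
  apply: nearW => n; apply: le_trans (_ : (\sum_(0 <= k < n) EI (g k))%:E <= _)%E; last first.
    by rewrite lee_fin.
  rewrite -sumEFin; apply: lee_sum => k _.
  by rewrite /EI /Rintegral fineK//; exact: integrable_fin_num (bm_integrable (bg k)).
have G0 x : (0 <= G x)%E by apply: nneseries_ge0 => k _ _; rewrite lee_fin.
have iG : P.-integrable setT G.
  apply/integrableP; split => //; apply: le_lt_trans (ltry S).
  by under eq_integral do rewrite gee0_abs//.
have := integrable_ae measurableT iG; apply: filterS => x /(_ Logic.I) fx.
exists (fine (G x)) => n; rewrite -lee_fin fineK// -sumEFin.
by apply: nneseries_lim_ge => k _; rewrite lee_fin.
Qed.

Lemma sum_half (n : nat) : \sum_(0 <= k < n) 2^-1 ^+ k <= 2 :> R.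
Proof.
have : \sum_(0 <= k < n) 2^-1 ^+ k = 2 - 2 * 2^-1 ^+ n :> R.
  elim: n => [|n IH]; first by rewrite big_nil expr0 mulr1 subrr.
  by rewrite big_nat_recr//= IH exprS; lra.
by move=> ->; rewrite gerBl mulr_ge0// exprn_ge0.
Qed.

(** Riesz-Fischer: a rapidly converging subsequence converges almost everywhere. The common bound
    [C] passes to the limit and permits dominated convergence. *)
Lemma l2_complete (u : nat -> T -> R) (C : R) :
  (forall n, measurable_fun setT (u n)) ->
  (forall n, {ae P, forall x, `|u n x| <= C}) ->
  (forall e : R, 0 < e -> exists N0, forall N M, (N0 <= N)%N -> (N0 <= M)%N ->
     EI (fun x => (u N x - u M x) ^+ 2) <= e) ->
  exists phi : T -> R, [/\ measurable_fun setT phi,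
    {ae P, forall x, `|phi x| <= C} &
    l2null P (fun N x => u N x - phi x)].
Proof.
move=> mu uC cu.
have bu n : bm (u n) by split => //; exists C; exact: uC.
have /choice[Nf NfP] : forall k, exists N0, forall N M, (N0 <= N)%N -> (N0 <= M)%N ->
     EI (fun x => (u N x - u M x) ^+ 2) <= 4^-1 ^+ k.
  by move=> k; apply: cu; rewrite exprn_gt0// invr_gt0.
(* A nondecreasing majorant of [Nf] that also satisfies [k <= s k]. *)
pose s k := (\sum_(i < k.+1) (Nf i).+1)%N.
have sN k : (Nf k <= s k)%N by rewrite /s big_ord_recr /=; lia.
have sk k : (k <= s k)%N.
  by elim: k => [//|k]; rewrite /s [in X in _ -> X]big_ord_recr /=; lia.
have sS k : (s k <= s k.+1)%N by rewrite /s [leqRHS]big_ord_recr /= leq_addr.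
pose v k := u (s k).
have bv k : bm (v k) by exact: bu.
pose g k (x : T) : R := `|v k x - v k.+1 x|.
have bg k : bm (g k) by apply: bm_norm; exact: bmB.
(* For y >= 0, [y <= 2^-k + 2^k y^2] turns the bound 4^-k on the integral of the square into an L^1
   bound that is summable in k. *)
have Ig k : EI (g k) <= 2 * 2^-1 ^+ k.
  have p2 : 0 < 2^-1 ^+ k :> R by rewrite exprn_gt0// invr_gt0.
  pose w x := (v k x - v k.+1 x) ^+ 2.
  have bw : bm w by apply: bmX; exact: bmB.
  apply: (@le_trans _ _ (EI (fun x => 2^-1 ^+ k + 2 ^+ k * w x))).
    apply: EI_le => //; first by apply: bmD; [exact: bm_cst|exact: bmZ].
    apply: aeW => x; rewrite /g /w -real_normK ?num_real//; set y := `|_|.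
    have y0 : 0 <= y by exact: normr_ge0.
    have /orP[h|h] := le_total y (2^-1 ^+ k).
      by apply: (le_trans h); rewrite lerDl mulr_ge0// ?sqr_ge0// exprn_ge0.
    rewrite ler_wpDl ?(ltW p2)// expr2 mulrA ler_peMl//.
    have e1 : 2 ^+ k * 2^-1 ^+ k = 1 :> R by rewrite -exprMn divff// expr1n.
    by rewrite -[X in X <= _]e1 ler_wpM2l// exprn_ge0.
  rewrite EID; [|exact: bm_cst|exact: bmZ].
  rewrite EI_cst EIZ//.
  have h : EI w <= 4^-1 ^+ k.
    by apply: NfP; [exact: sN|exact: leq_trans (sN k) (sS k)].
  have -> : 2 * 2^-1 ^+ k = 2^-1 ^+ k + 2 ^+ k * 4^-1 ^+ k :> R.
    have -> : 4^-1 ^+ k = 2^-1 ^+ k * 2^-1 ^+ k :> R.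
      by rewrite -exprMn; congr (_ ^+ k); lra.
    by rewrite mulrA -exprMn divff// expr1n mul1r; lra.
  by rewrite lerD2l ler_wpM2l// exprn_ge0.
have [N [mN PN0 NP]] : {ae P, forall x, exists M : R, forall n, \sum_(0 <= k < n) g k x <= M}.
  apply: (@ae_bounded_partial_sums g 4) => // n; first by move=> x; exact: normr_ge0.
  apply: (le_trans (ler_sum _ (fun k _ => Ig k))).
  by rewrite -mulr_sumr; have := sum_half n; lra.
(* Cancelling the sequence on the null set [N] makes it converge everywhere, so that its limit is
   measurable. *)
pose w k x := v k x * \1_(~` N) x.
have wcvg x : cvgn (fun k => w k x).
  rewrite /w indicE; case: (boolP (x \in ~` N)) => xN; last first.
    by rewrite (_ : (fun k => _) = (fun=> 0)); [exact: is_cvg_cst|apply/funext=> k; rewrite mulr0].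
  have [M HM] : exists M : R, forall n, \sum_(0 <= k < n) g k x <= M.
    by apply: contrapT => h; move: xN; rewrite inE; apply; exact: NP.
  have cs : cvgn (series (fun k => v k.+1 x - v k x)).
    apply: normed_cvg; rewrite (_ : [normed series _] = (fun n => \sum_(0 <= k < n) g k x)).
      apply: nondecreasing_is_cvgn; last by exists M => _ [n _ <-].
      by apply: nondecreasing_series => k _ _; exact: normr_ge0.
    by apply/funext => n; apply: eq_bigr => k _; rewrite /g distrC.
  have -> : (fun k => v k x * (true : nat)%:R) =
     (fun k => v 0%N x + series (fun k => v k.+1 x - v k x) k).
    by apply/funext => k; rewrite mulr1 /series/= telescope_sumr// addrC subrK.
  by apply: is_cvgD => //; exact: is_cvg_cst.
pose phi x := limn (fun k => w k x).
have wphi x : w ^~ x @ \oo --> phi x by exact: wcvg.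
have mw k : measurable_fun setT (w k).
  by apply: measurable_funM; [exact: mu|apply: measurable_indic; exact: measurableC].
have mphi : measurable_fun setT phi.
  by apply: (@measurable_fun_cvg _ _ _ _ w).
have Nae : {ae P, forall x, ~ N x} by exists N; split => // x /= /contrapT.
have vphi : {ae P, forall x, v ^~ x @ \oo --> phi x}.
  apply: filterS Nae => x Nx; have := wphi x.
  rewrite (_ : w ^~ x = v ^~ x)//; apply/funext => k.
  by rewrite /w indicE mem_set// mulr1.
have vC : {ae P, forall x, forall n, `|u n x| <= C} by exact/ae_foralln.
have phiC : {ae P, forall x, `|phi x| <= C}.
  apply: filterS2 vphi vC => x /cvg_norm h1 h2.
  rewrite -(cvg_lim _ h1)//; apply: limr_le; first by apply/cvg_ex; exists `|phi x|.
  by apply: nearW => n; exact: h2.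
exists phi; split => // e e0.
have bphi : bm phi by split => //; exists C.
have e2 : 0 < e / 2 by rewrite divr_gt0.
have [N0 HN] := cu _ e0; exists N0 => n Nn.
rewrite ger0_norm; last first.
  by apply: EI_sqr_ge0; exact: bmB.
(* For fixed n let k grow: the integrals of [(u n - v k)^2], eventually at most e, converge to that
   of [(u n - phi)^2]. *)
have := @dominated_convergence _ _ _ P setT measurableT
  (fun k x => ((u n x - v k x) ^+ 2)%:E) (fun x => ((u n x - phi x) ^+ 2)%:E)
  (fun=> (4 * C ^+ 2)%:E).
case.
- move=> k; apply/measurable_EFinP; apply: measurable_funX; apply: measurable_funB => //; exact: mu.
- apply/measurable_EFinP; apply: measurable_funX; exact: measurable_funB.
- apply: filterS vphi => x h _; apply: cvg_EFin; first exact: nearW.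
  rewrite /=; apply: cvgM; apply: cvgB => //; exact: cvg_cst.
- exact: finite_measure_integrable_cst.
- apply: filterS vC => x h k _; rewrite lee_fin ger0_norm ?sqr_ge0//.
  rewrite -real_normK ?num_real//.
  have : `|u n x - v k x| <= 2 * C.
    by apply: (le_trans (ler_normB _ _)); rewrite mulr_natl mulr2n lerD//; exact: h.
  have := normr_ge0 (u n x - v k x); move: `|_| => y y0 hy.
  by rewrite (_ : 4 * C ^+ 2 = (2 * C) ^+ 2); [rewrite lerXn2r// nnegrE (le_trans y0)|ring].
move=> ig _ cI.
have fin k : (\int[P]_x ((u n x - v k x) ^+ 2)%:E)%E = (EI (fun x => (u n x - v k x) ^+ 2))%:E.
  rewrite /EI /Rintegral fineK//; apply: integrable_fin_num => //.
  by apply: bm_integrable; apply: bmX; exact: bmB.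
rewrite -lee_fin /EI /Rintegral fineK; last exact: integrable_fin_num.
rewrite -(cvg_lim _ cI)//; apply: lime_le; first by apply/cvg_ex; eexists; exact: cI.
exists N0 => // k /= Nk; rewrite fin lee_fin; apply: HN => //.
exact: leq_trans Nk (sk k).
Qed.

End L2Completeness.

(** * Averages for a shift-invariant form *)

Section CesaroForm.
Variable R : realType.
Variable c : nat -> nat -> R.
Implicit Types p q r : {poly R}.
Hypothesis c_sym : forall i j, c i j = c j i.
Hypothesis c_shift : forall i j, c i.+1 j.+1 = c i j.

(** If [c i j] is the inner product of vectors v_i and v_j, this is the inner product of the sums of
    the p_i v_i and of the q_j v_j. Multiplication by ['X] then acts as the shift of v_i to
    v_(i+1). *)
Definition pform (p q : {poly R}) : R :=
  \sum_(i < size p) \sum_(j < size q) p`_i * q`_j * c i j.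

Hypothesis c_psd : forall p, 0 <= pform p p.

Definition cavg (N : nat) : {poly R} := N%:R^-1 *: \sum_(1 <= n < N.+1) 'X^n.

Lemma pformE p q n m : (size p <= n)%N -> (size q <= m)%N ->
  pform p q = \sum_(i < n) \sum_(j < m) p`_i * q`_j * c i j.
Proof.
move=> pn qm; rewrite /pform.
rewrite (big_ord_widen _ (fun i => \sum_(j < size q) p`_i * q`_j * c i j) pn).
rewrite big_mkcond; apply: eq_bigr => i _; case: ltnP => h; last first.
  by rewrite big1// => j _; rewrite nth_default// !mul0r.
rewrite (big_ord_widen _ (fun j => p`_i * q`_j * c i j) qm).
rewrite big_mkcond; apply: eq_bigr => j _; case: ltnP => // h'.
by rewrite (nth_default 0 h') mulr0 mul0r.
Qed.

Lemma pform_sym p q : pform p q = pform q p.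
Proof.
rewrite /pform exchange_big; apply: eq_bigr => i _; apply: eq_bigr => j _.
by rewrite c_sym; ring.
Qed.

Lemma pformDl p p' q : pform (p + p') q = pform p q + pform p' q.
Proof.
pose n := maxn (size (p + p')%R) (maxn (size p) (size p')).
rewrite !(@pformE _ q n (size q))//; try by rewrite /n !leq_max leqnn ?orbT.
rewrite -big_split; apply: eq_bigr => i _; rewrite -big_split; apply: eq_bigr => j _ /=.
by rewrite coefD; ring.
Qed.

Lemma pformZl a p q : pform (a *: p) q = a * pform p q.
Proof.
pose n := maxn (size (a *: p)%R) (size p).
rewrite !(@pformE _ q n (size q))//; try by rewrite /n !leq_max leqnn ?orbT.
rewrite mulr_sumr; apply: eq_bigr => i _; rewrite mulr_sumr; apply: eq_bigr => j _ /=.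
by rewrite coefZ; ring.
Qed.

Lemma pformDr p q q' : pform p (q + q') = pform p q + pform p q'.
Proof. by rewrite pform_sym pformDl !(pform_sym p). Qed.

Lemma pformZr a p q : pform p (a *: q) = a * pform p q.
Proof. by rewrite pform_sym pformZl (pform_sym p). Qed.

Lemma pform_sum_l I (s : seq I) (p : I -> {poly R}) q :
  pform (\sum_(i <- s) p i) q = \sum_(i <- s) pform (p i) q.
Proof.
elim: s => [|i s IH]; last by rewrite !big_cons pformDl IH.
by rewrite !big_nil -(scale0r 0) pformZl mul0r.
Qed.

Lemma pform_sum_r I (s : seq I) (p : I -> {poly R}) q :
  pform q (\sum_(i <- s) p i) = \sum_(i <- s) pform q (p i).
Proof. by rewrite pform_sym pform_sum_l; apply: eq_bigr => i _; rewrite pform_sym. Qed.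

Lemma pform_mulX p q : pform ('X * p) ('X * q) = pform p q.
Proof.
have sz (r : {poly R}) : (size ('X * r)%R <= (size r).+1)%N.
  by rewrite (leq_trans (size_polyMleq _ _))// size_polyX.
rewrite (pformE (sz p) (sz q)) big_ord_recl big1 ?add0r; last first.
  by move=> j _; rewrite coefXM mul0r mul0r.
rewrite /pform; apply: eq_bigr => i _; rewrite big_ord_recl !coefXM /= mulr0 mul0r add0r.
apply: eq_bigr => j _; rewrite !coefXM /= c_shift.
by congr (_ * _).
Qed.

Lemma pform_mulXn n p q : pform ('X^n * p) ('X^n * q) = pform p q.
Proof.
by elim: n => [|n IH]; rewrite ?expr0 ?mul1r// exprS -!mulrA pform_mulX.
Qed.

(** Positivity of the form at [t *: p - q]. This weighted Cauchy-Schwarz inequality takes the place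
    of square roots. *)
Lemma pform_cross p q (t : R) : 0 < t ->
  2 * pform p q <= t * pform p p + t^-1 * pform q q.
Proof.
move=> t0; have := c_psd (t *: p - q).
have -> : t *: p - q = t *: p + (-1) *: q by rewrite scaleN1r.
rewrite pformDl !pformDr !pformZl !pformZr (pform_sym q p) => h.
rewrite -(ler_pM2l t0) mulrDr [X in _ <= _ + X]mulrA divff ?gt_eqF// mul1r.
by move: h; rewrite !mulrA; lra.
Qed.

(** Multiplication by [cavg N] averages isometries, hence is a contraction; [cavg 0] is 0. *)
Lemma pform_cavg_le N p : pform (cavg N * p) (cavg N * p) <= pform p p.
Proof.
case: N => [|N]; first by rewrite /cavg invr0 scale0r mul0r -(scale0r 0) pformZl mul0r c_psd.
have N0 : N.+1%:R != 0 :> R by rewrite pnatr_eq0.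
rewrite /cavg -scalerAl mulr_suml pformZl pformZr pform_sum_l.
under eq_bigr do rewrite pform_sum_r.
have h i j : pform ('X^i * p) ('X^j * p) <= pform p p.
  have := pform_cross ('X^i * p) ('X^j * p) ltr01.
  by rewrite !pform_mulXn invr1; lra.
have : \sum_(1 <= i < N.+2) \sum_(1 <= j < N.+2) pform ('X^i * p) ('X^j * p)
     <= \sum_(1 <= i < N.+2) \sum_(1 <= j < N.+2) pform p p.
  by apply: ler_sum => i _; apply: ler_sum => j _.
rewrite !sumr_const_nat subn1 /= => H.
rewrite mulrA -invfM ler_pdivrMl ?mulr_gt0 ?ltr0n//.
by rewrite -[X in _ <= X]mulrA !mulr_natl; exact: H.
Qed.

Lemma horner_cavg N : (cavg N.+1).[1] = 1.
Proof.
rewrite /cavg hornerZ horner_sum (eq_bigr (fun=> 1)); last first.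
  by move=> i _; rewrite hornerXn expr1n.
by rewrite sumr_const_nat subn1 /= mulVf// pnatr_eq0.
Qed.

Lemma cavg_mulX N : cavg N * ('X - 1) = N%:R^-1 *: ('X^(N.+1) - 'X).
Proof.
rewrite /cavg -scalerAl; congr (_ *: _).
rewrite mulrBr mulr1 mulr_suml.
under eq_bigr do rewrite -exprSr.
elim: N => [|N IH]; first by rewrite !big_geq// subrr expr1 subrr.
rewrite big_nat_recr//= [X in _ - X]big_nat_recr//=.
move: IH; set a := \sum_(_ <= _ < _) _; set b := \sum_(_ <= _ < _) _ => IH.
have -> : a = b + ('X^(N.+1) - 'X) by rewrite -IH addrC subrK.
ring.
Qed.

(* Mean ergodic theorem for the isometry p |-> 'X * p of the form [pform]: the averages
   [cavg N] minimize the norm on the convex set of the [p] with [p.[1] = 1], so that they are Cauchy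
   by the parallelogram law. *)
Lemma cavg_near_inf p : p.[1] = 1 -> forall e : R, 0 < e ->
  exists N0, forall N, (N0 <= N)%N -> pform (cavg N) (cavg N) <= pform p p + e.
Proof.
move=> p1 e e0.
(* [cavg n * p] and [cavg n] differ by a multiple of [cavg n * ('X - 1)], which telescopes. Their
   distance therefore tends to 0, whereas the norm of [cavg n * p] is at most that of p. *)
have [r pr] : exists r, p - 1 = r * ('X - 1).
  have : root (p - 1) 1 by rewrite /root hornerD hornerN hornerC p1 subrr.
  by move/factor_theorem => [r ->]; exists r; rewrite polyC1.
pose K := pform p p; pose Q := pform r r.
have K0 : 0 <= K by exact: c_psd.
have Q0 : 0 <= Q by exact: c_psd.
(* [t] makes the part t K of the cross term at most e / 2. Then [N0] makes the remaining terms, at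
   most (1 + t^-1) 4 Q / n, at most e / 2. The summands 1 keep the denominators positive. *)
pose t := e / 2 / (K + 1).
have t0 : 0 < t by rewrite !divr_gt0// ltr_wpDl.
have e4 : 0 < e / 2 / ((1 + t^-1) * (4 * Q) + 1).
  by rewrite !divr_gt0// ltr_wpDl// mulr_ge0 ?addr_ge0 ?invr_ge0 ?(ltW t0)// mulr_ge0.
have [N0 HN] := tends0_invn e4.
exists N0.+1 => -[//|N] NN; set n := N.+1.
pose a := cavg n * p; pose d := cavg n - a.
have dE : d = (- n%:R^-1) *: (r * ('X^(n.+1) - 'X)).
  rewrite /d /a -[X in X - _]mulr1 -mulrBr -opprB pr mulrN mulrCA cavg_mulX.
  by rewrite -scalerAr scaleNr.
have dQ : pform d d <= n%:R^-1 * (4 * Q).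
  rewrite dE pformZl pformZr mulrA mulrNN.
  have -> : r * ('X^(n.+1) - 'X) = 'X^(n.+1) * r + (-1) *: ('X * r).
    by rewrite scaleN1r; ring.
  have h1 : pform ('X * r) ('X * r) = Q by exact: pform_mulX.
  have h2 : pform ('X^(n.+1) * r) ('X^(n.+1) * r) = Q by exact: pform_mulXn.
  have := pform_cross ((-1) *: ('X^(n.+1) * r)) ('X * r) ltr01.
  have := c_psd ('X^(n.+1) * r + (-1) *: ('X * r)).
  rewrite !(pformDl, pformDr, pformZl, pformZr) (pform_sym ('X * r) ('X^(n.+1) * r)) h1 h2.
  rewrite invr1 -[X in _ -> _ -> X <= _]mulrA; set z := pform _ _ => g1 g2.
  have n1 : n%:R^-1 <= 1 :> R by rewrite invf_le1 ?ler1n ?ltr0n.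
  have n0 : 0 <= n%:R^-1 :> R by rewrite invr_ge0.
  rewrite ler_wpM2l//; apply: le_trans (_ : 1 * (4 * Q) <= _); last by rewrite mul1r.
  by apply: ler_pM => //; move: g1 g2; lra.
have aK : pform a a <= K by exact: pform_cavg_le.
have -> : cavg n = a + d by rewrite /d addrC subrK.
rewrite (pformDl a d) (pformDr a a d) (pformDr d a d) (pform_sym d a).
have h1 := pform_cross a d t0.
have h2 : t * pform a a <= e / 2.
  apply: (@le_trans _ _ (t * (K + 1))); last by rewrite /t divfK// gt_eqF// ltr_wpDl.
  by rewrite ler_wpM2l ?(ltW t0)// (le_trans aK)// lerDl.
have h3 : (1 + t^-1) * pform d d <= e / 2.
  have tt : 0 <= 1 + t^-1 by rewrite addr_ge0// invr_ge0 ltW.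
  apply: (le_trans (ler_wpM2l tt dQ)).
  rewrite mulrCA; have := HN n (ltnW NN); rewrite ger0_norm ?invr_ge0// => h.
  have pp : 0 < (1 + t^-1) * (4 * Q) + 1 by rewrite ltr_wpDl// mulr_ge0// mulr_ge0.
  move: h; rewrite ler_pdivlMr// => h.
  by apply: le_trans h; rewrite ler_wpM2l ?invr_ge0// lerDl.
rewrite -/K; move: h1 h2 h3 aK; rewrite mulrDl mul1r; lra.
Qed.

Lemma cavg_cauchy : forall e : R, 0 < e -> exists N0, forall N M,
  (N0 <= N)%N -> (N0 <= M)%N -> pform (cavg N - cavg M) (cavg N - cavg M) <= e.
Proof.
move=> e e0; pose S := [set pform p p | p in [set p : {poly R} | p.[1] = 1]].
have hS : has_inf S.
  split; first by exists (pform 1 1), 1 => //=; rewrite hornerC.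
  by exists 0 => _ [p _ <-]; exact: c_psd.
(* Both squared norms exceed [inf S] by at most e / 8 + e / 8, and the parallelogram law multiplies
   this excess by 4. *)
have e8 : 0 < e / 8 by rewrite divr_gt0.
have [_ [p p1 <-] pL] := inf_adherent e8 hS.
have [N0 HN] := cavg_near_inf p1 e8.
(* The 1 excludes [cavg 0], whose value at 1 is 0. *)
exists (maxn N0 1) => -[|N] [|M]; rewrite ?geq_max ?andbF// !andbT => hN hM.
pose m := 2^-1 *: (cavg N.+1 + cavg M.+1).
have mL : inf S <= pform m m.
  apply: ge_inf; first by case: hS.
  by exists m => //=; rewrite /m hornerZ hornerD !horner_cavg; lra.
have := HN _ hN; have := HN _ hM.
move: mL pL; rewrite /m -scaleN1r.
move: (cavg N.+1) (cavg M.+1) => u v.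
rewrite !(pformDl, pformDr, pformZl, pformZr) (pform_sym v u).
lra.
Qed.

End CesaroForm.

(** * Koopman operators and complex functions *)

Section Koopman.
Variables (R : realType) (X : mpsystem R).
Local Notation P := (mps_prob X).
Local Notation it := (@mps_iter R X).
Implicit Types (n m : int) (f g : X -> R).

Lemma mps_iterS n x : it (n + 1) x = mps_map X (it n x).
Proof.
case: n => n; first by rewrite -PoszD addn1.
case: n => [|n]; first by rewrite NegzE addNr /= mps_invK.
have -> : Negz n.+1 + 1 = Negz n by rewrite !NegzE; lia.
by rewrite /= mps_invK.
Qed.

Lemma mps_iterP n x : it (n - 1) x = mps_inv X (it n x).
Proof. by apply: (can_inj (@mps_mapK _ X)); rewrite mps_invK -mps_iterS subrK. Qed.

Lemma mps_iterD n m x : it (n + m) x = it n (it m x).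
Proof.
elim/int_rec: n => [|n IH|n IH]; first by rewrite add0r.
  by rewrite -addn1 PoszD addrAC !mps_iterS IH.
have -> : - (n.+1)%:Z = - n%:Z - 1 by rewrite -addn1 PoszD opprD.
by rewrite addrAC !mps_iterP IH.
Qed.

Lemma mps_iter0 x : it 0 x = x. Proof. by []. Qed.

Lemma mps_iterNK n : cancel (it n) (it (- n)).
Proof. by move=> x; rewrite -mps_iterD addNr. Qed.

Lemma measurable_mps_iter n : measurable_fun setT (it n).
Proof.
elim/int_rec: n => [|n IH|n IH].
- exact: measurable_id.
- have -> : it n.+1 = mps_map X \o it n by apply/funext => x; rewrite -addn1 PoszD mps_iterS.
  exact: measurableT_comp (@mps_map_measurable _ X) IH.
- have -> : it (- (n.+1)%:Z) = mps_inv X \o it (- n%:Z).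
    by apply/funext => x; rewrite -addn1 PoszD opprD mps_iterP.
  exact: measurableT_comp (@mps_inv_measurable _ X) IH.
Qed.

Lemma measurable_preimage_iter n (A : set X) : measurable A -> measurable (it n @^-1` A).
Proof. by move=> mA; rewrite -[X in measurable X]setTI; exact: measurable_mps_iter. Qed.

Lemma prob_preimage_iter n (A : set X) : measurable A -> P (it n @^-1` A) = P A.
Proof.
have h1 (B : set X) : measurable B -> P (mps_map X @^-1` B) = P B.
  exact: mps_preserving.
have h2 (B : set X) : measurable B -> P (mps_inv X @^-1` B) = P B.
  move=> mB; rewrite -h1; last by rewrite -[X in measurable X]setTI; exact: mps_inv_measurable.
  by congr (P _); apply/seteqP; split => x /=; rewrite mps_mapK.
move=> mA; elim/int_rec: n => [|n IH|n IH]; first by [].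
- rewrite -IH -[RHS]h1; last exact: measurable_preimage_iter.
  by congr (P _); apply/funext => x; rewrite /preimage /= -iterSr.
- rewrite -IH -[RHS]h2; last exact: measurable_preimage_iter.
  congr (P _); apply/funext => x; rewrite /preimage.
  by transitivity (A (it (- n%:Z - 1) x)); [rewrite -addn1 PoszD opprD|rewrite mps_iterD].
Qed.

Definition U n f : X -> R := fun x => f (it n x).

Lemma UD n m f : U n (U m f) = U (n + m) f.
Proof. by apply/funext => x; rewrite /U addrC mps_iterD. Qed.

Lemma ae_U n (Q : X -> Prop) : {ae P, forall x, Q x} -> {ae P, forall x, Q (it n x)}.
Proof.
move=> [N [mN N0 QN]]; exists (it n @^-1` N); split.
- exact: measurable_preimage_iter.
- by rewrite prob_preimage_iter.
- by move=> x /= Qx; apply: QN.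
Qed.

Lemma bmU n f : bm P f -> bm P (U n f).
Proof.
move=> [mf [C fC]]; split.
  exact: measurableT_comp mf (measurable_mps_iter n).
by exists C; exact: (ae_U n fC).
Qed.

Lemma EIU n f : bm P f -> EI P (U n f) = EI P f.
Proof.
move=> bf; rewrite /EI /Rintegral; congr fine.
have mf : measurable_fun setT (EFin \o f) by apply/measurable_EFinP; case: bf.
have -> : (\int[P]_x (U n f x)%:E = \int[P]_(x in it n @^-1` setT) ((EFin \o f) \o it n) x)%E.
  by rewrite preimage_setT.
rewrite -integral_pushforward//; last 2 first.
- exact: measurable_mps_iter.
- exact: bm_integrable (bmU n bf).
apply: eq_measure_integral; first exact: measurable_mps_iter.
move=> mphi A mA _.
by rewrite -[RHS](prob_preimage_iter n mA).
Qed.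

End Koopman.

(** * Complex-valued functions, their real and imaginary parts *)

Section ComplexBounded.
Context (d : measure_display) (T : measurableType d) (R : realType).
Variable P : probability T R.
Implicit Types (z : R[i]) (f : T -> R[i]) (c : T -> R).

Local Notation RC := (fun x : R => x%:C%C).

Lemma cmodE z : cmod z = Num.sqrt (complex.Re z ^+ 2 + complex.Im z ^+ 2).
Proof. by rewrite /cmod normc_def. Qed.

Lemma cmod_ge0 z : 0 <= cmod z.
Proof. by rewrite cmodE sqrtr_ge0. Qed.

Lemma cmod_sq z : cmod z ^+ 2 = complex.Re z ^+ 2 + complex.Im z ^+ 2.
Proof. by rewrite cmodE sqr_sqrtr// addr_ge0// sqr_ge0. Qed.

Lemma cmod_real (x : R) : cmod (RC x) = `|x|.
Proof. by rewrite cmodE /= expr0n addr0 sqrtr_sqr. Qed.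

Lemma cmod_Re z : `|complex.Re z| <= cmod z.
Proof. by rewrite cmodE -sqrtr_sqr ler_wsqrtr// lerDl sqr_ge0. Qed.

Lemma cmod_Im z : `|complex.Im z| <= cmod z.
Proof. by rewrite cmodE -sqrtr_sqr ler_wsqrtr// lerDr sqr_ge0. Qed.

Lemma cmod_le z : cmod z <= `|complex.Re z| + `|complex.Im z|.
Proof.
rewrite cmodE -[leRHS]ger0_norm ?addr_ge0// -sqrtr_sqr ler_wsqrtr//.
have h : 0 <= `|complex.Re z| * `|complex.Im z| by rewrite mulr_ge0.
by rewrite -(real_normK (num_real (complex.Re z))) -(real_normK (num_real (complex.Im z))); nra.
Qed.

Lemma cmeasurable_cmod f : cmeasurable f -> measurable_fun setT (@cmod R \o f).
Proof.
move=> [mr mi]; have -> : @cmod R \o f = @Num.sqrt R \o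
   (fun x => complex.Re (f x) ^+ 2 + complex.Im (f x) ^+ 2).
  by apply/funext => x /=; rewrite cmodE.
apply: measurableT_comp.
  by apply: continuous_measurable_fun; exact: sqrt_continuous.
by apply: measurable_funD; exact: measurable_funX.
Qed.

Lemma inLp_ooP f : inLp P +oo%E f <->
  cmeasurable f /\ exists C : R, {ae P, forall x, cmod (f x) <= C}.
Proof.
have P0 : (0 < P setT)%E by rewrite probability_setT lte_fin.
have e : cLnorm P +oo f = ess_sup P (abse \o (EFin \o (@cmod R \o f))).
  by rewrite /cLnorm unlock P0.
split=> -[mf h]; split => //.
  rewrite e in h.
  have [y hy] : exists y : R, (ess_sup P (abse \o (EFin \o (@cmod R \o f))) <= y%:E)%E.
    move: h; set s := ess_sup _ _; case: s => [r _|//|_]; first by exists r.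
    by exists 0; rewrite leNye.
  exists y; move/ess_supP : hy; apply: filterS => x /=.
  by rewrite lee_fin; apply: le_trans; exact: ler_norm.
rewrite e; case: h => C hC; apply: le_lt_trans (ltry C); apply/ess_supP.
by apply: filterS hC => x /=; rewrite lee_fin ger0_norm// cmod_ge0.
Qed.

Lemma inLp_le (p q : \bar R) f : (1 <= p)%E -> (1 <= q)%E -> (p <= q)%E -> inLp P q f -> inLp P p f.
Proof.
move=> p1 q1 pq [mf h]; split => //.
have : (@cmod R \o f) \in Lfun P q.
  rewrite inE; apply/andP; split; rewrite inE //=.
  exact: cmeasurable_cmod.
move/(Lfun_subset p1 q1 _ pq) => H.
have Pf : P [set: T] \is a fin_num by rewrite fin_num_measure.
by move: (H Pf); rewrite inE => /andP[_]; rewrite inE.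
Qed.

Lemma bm_cmeasurable c : bm P c -> cmeasurable (RC \o c).
Proof. by move=> [mc _]; split => //=; exact: measurable_cst. Qed.

Lemma bm_inLoo c : bm P c -> inLp P +oo%E (RC \o c).
Proof.
move=> bc; apply/inLp_ooP; split; first exact: bm_cmeasurable.
case: bc => _ [C hC]; exists C; apply: filterS hC => x /=.
by rewrite cmod_real.
Qed.

Lemma bm_inL1 c : bm P c -> inLp P 1%E (RC \o c).
Proof. by move=> /bm_inLoo; apply: inLp_le => //; rewrite leey. Qed.

Lemma bm_inL2 c : bm P c -> inLp P 2%:E (RC \o c).
Proof. by move=> /bm_inLoo; apply: inLp_le; rewrite ?leey// lee_fin ler1n. Qed.

Lemma inLoo_Re f : inLp P +oo%E f -> bm P (@complex.Re R \o f).
Proof.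
move=> /inLp_ooP[[mf _] [C hC]]; split => //; exists C; apply: filterS hC => x.
exact: le_trans (cmod_Re _).
Qed.

Lemma inLoo_Im f : inLp P +oo%E f -> bm P (@complex.Im R \o f).
Proof.
move=> /inLp_ooP[[_ mf] [C hC]]; split => //; exists C; apply: filterS hC => x.
exact: le_trans (cmod_Im _).
Qed.

End ComplexBounded.

Section IntegrableFunctions.
Context (d : measure_display) (T : measurableType d) (R : realType).
Variable Q : probability T R.
Local Notation RC := (fun x : R => x%:C%C).

Definition rL1 (u : T -> R) := Q.-integrable setT (EFin \o u).

Lemma rL1_measurable (u : T -> R) : rL1 u -> measurable_fun setT u.
Proof. by move=> /measurable_int/measurable_EFinP. Qed.

Lemma rL1_inLp (u : T -> R) : rL1 u -> inLp Q 1%E (RC \o u).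
Proof.
move=> h; have mu := rL1_measurable h; split.
  by split => //=; exact: measurable_cst.
rewrite /cLnorm Lnorm1; move/integrableP: h => [_]; apply: le_lt_trans.
rewrite le_eqVlt; apply/orP; left; apply/eqP; apply: eq_integral => x _ /=.
by rewrite cmod_real normr_id.
Qed.

Lemma inL1_cmod (f : T -> R[i]) : inLp Q 1%E f -> rL1 (@cmod R \o f).
Proof.
move=> [mf h]; apply/integrableP; split.
  by apply/measurable_EFinP; exact: cmeasurable_cmod.
by move: h; rewrite /cLnorm Lnorm1.
Qed.

Lemma inL1_Re (f : T -> R[i]) : inLp Q 1%E f -> rL1 (@complex.Re R \o f).
Proof.
move=> h; have := inL1_cmod h; apply: le_integrable => //.
  by apply/measurable_EFinP; case: h => -[].
by move=> x _ /=; rewrite lee_fin (ger0_norm (cmod_ge0 _)); exact: cmod_Re.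
Qed.

Lemma inL1_Im (f : T -> R[i]) : inLp Q 1%E f -> rL1 (@complex.Im R \o f).
Proof.
move=> h; have := inL1_cmod h; apply: le_integrable => //.
  by apply/measurable_EFinP; case: h => -[].
by move=> x _ /=; rewrite lee_fin (ger0_norm (cmod_ge0 _)); exact: cmod_Im.
Qed.

Lemma bm_rL1 (u : T -> R) : bm Q u -> rL1 u.
Proof. exact: bm_integrable. Qed.

Lemma rL1D (u v : T -> R) : rL1 u -> rL1 v -> rL1 (fun x => u x + v x).
Proof. by move=> hu hv; have := integrableD measurableT hu hv. Qed.

Lemma rL1Z (a : R) (u : T -> R) : rL1 u -> rL1 (fun x => a * u x).
Proof. by move=> hu; have := integrableZl measurableT a hu. Qed.

Lemma rL1B (u v : T -> R) : rL1 u -> rL1 v -> rL1 (fun x => u x - v x).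
Proof. by move=> hu hv; have := integrableB measurableT hu hv. Qed.

Lemma rL1_norm (u : T -> R) : rL1 u -> rL1 (fun x => `|u x|).
Proof. by move=> hu; exact: integrable_norm hu. Qed.

Lemma rL1_bmM (F u : T -> R) : bm Q F -> rL1 u -> rL1 (fun x => F x * u x).
Proof.
move=> [mF [C FC]] hu; have mu := rL1_measurable hu; apply/integrableP; split.
  by apply/measurable_EFinP; exact: measurable_funM.
have : (\int[Q]_x (`|C| * `|u x|)%:E < +oo)%E.
  by have := rL1Z `|C| (rL1_norm hu) => /integrableP[_]; under eq_integral => x _ do
    rewrite /= ger0_norm ?mulr_ge0//.
apply: le_lt_trans; apply: ae_ge0_le_integral => //.
- by apply: measurableT_comp => //; apply/measurable_EFinP; exact: measurable_funM.
- by apply/measurable_EFinP; apply: measurable_funM; [exact: measurable_cst|exact: measurableT_comp].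
- apply: filterS FC => x h _; rewrite /= lee_fin normrM ler_wpM2r//.
  by rewrite (le_trans h)// ler_norm.
Qed.

Lemma rEIB (u v : T -> R) : rL1 u -> rL1 v -> EI Q (fun x => u x - v x) = EI Q u - EI Q v.
Proof. by move=> hu hv; rewrite /EI RintegralB. Qed.

Lemma rEID (u v : T -> R) : rL1 u -> rL1 v -> EI Q (fun x => u x + v x) = EI Q u + EI Q v.
Proof. by move=> hu hv; rewrite /EI RintegralD. Qed.

Lemma rEIZ (a : R) (u : T -> R) : rL1 u -> EI Q (fun x => a * u x) = a * EI Q u.
Proof. by move=> hu; rewrite /EI RintegralZl. Qed.

Lemma rEI_ae (u v : T -> R) : rL1 u -> rL1 v -> {ae Q, forall x, u x = v x} -> EI Q u = EI Q v.
Proof.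
move=> hu hv uv; rewrite /EI /Rintegral; congr fine; apply: ae_eq_integral => //.
- exact: measurable_int hu.
- exact: measurable_int hv.
- by apply: filterS uv => x e _ /=; rewrite e.
Qed.

Lemma rEI_le (u v : T -> R) : rL1 u -> rL1 v -> {ae Q, forall x, u x <= v x} -> EI Q u <= EI Q v.
Proof.
move=> hu hv uv; rewrite -subr_ge0 -rEIB//.
have hd := rL1B hv hu; have hn := rL1_norm hd.
rewrite (rEI_ae hd hn); first by apply: Rintegral_ge0.
by apply: filterS uv => x h; rewrite ger0_norm// subr_ge0.
Qed.

Lemma rEI_eq0 (u : T -> R) : rL1 u -> {ae Q, forall x, 0 <= u x} -> EI Q u = 0 ->
  {ae Q, forall x, u x = 0}.
Proof.
move=> hu u0 I0.
have /(ae_eq_integral_abs Q measurableT (measurable_int _ hu)) : (\int[Q]_x `|(EFin \o u) x| = 0)%E.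
  rewrite -(fineK (integrable_fin_num measurableT (rL1_norm hu))); congr (_%:E).
  rewrite -[RHS]I0; apply: (rEI_ae (rL1_norm hu) hu).
  by apply: filterS u0 => x h; rewrite ger0_norm.
by apply: filterS => x /(_ Logic.I) [].
Qed.

Lemma EI_eq0 (f : T -> R) : bm Q f -> {ae Q, forall x, 0 <= f x} -> EI Q f = 0 ->
  {ae Q, forall x, f x = 0}.
Proof. by move=> /bm_rL1; exact: rEI_eq0. Qed.

End IntegrableFunctions.

(** * The Markov embedding and conditional expectations *)

Lemma ae_and (d : measure_display) (T : measurableType d) (R : realType)
    (mu : {measure set T -> \bar R}) (Q1 Q2 : T -> Prop) :
  {ae mu, forall x, Q1 x} -> {ae mu, forall x, Q2 x} ->
  {ae mu, forall x, Q1 x /\ Q2 x}.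
Proof. by move=> h1 h2; apply: filterS2 h1 h2. Qed.

Section RealMarkov.
Variables (R : realType) (X : mpsystem R) (Y : mfactor X).
Local Notation P := (mps_prob X).
Local Notation nu := (mps_prob Y).
Local Notation RC := (fun x : R => x%:C%C).
Implicit Types (c : Y -> R) (f g : X -> R).

(** On real functions J is real almost everywhere, by [op_realL1]; taking real parts loses nothing
    and lets the main argument run over the reals. *)
Definition markov_re c : X -> R := fun x => complex.Re (mf_op Y (RC \o c) x).
Local Notation J := markov_re.

Lemma op_linearL1 (a : R) (u v : Y -> R) : rL1 nu u -> rL1 nu v -> {ae P, forall x,
  mf_op Y (RC \o (fun y => a * u y + v y)) x =
  RC a * mf_op Y (RC \o u) x + mf_op Y (RC \o v) x}.
Proof.
move=> hu hv; have := mf_linear (RC a) (rL1_inLp hu) (rL1_inLp hv).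
by rewrite (_ : (fun y => _) = RC \o (fun y => a * u y + v y))//;
  apply/funext => y /=; rewrite rmorphD rmorphM.
Qed.

(** Both |u| and u + |u| are nonnegative, so J sends them to nonnegative, hence real, functions, and
    u is their difference. *)
Lemma op_realL1 (u : Y -> R) : rL1 nu u -> {ae P, forall x, mf_op Y (RC \o u) x = RC (J u x)}.
Proof.
move=> hu; have hn := rL1_norm hu.
have pos1 : {ae P, forall x, 0 <= mf_op Y (RC \o (fun y => `|u y|)) x}.
  by apply: mf_pos; [exact: rL1_inLp|apply: aeW => y /=; rewrite ler0c].
have pos2 : {ae P, forall x, 0 <= mf_op Y (RC \o (fun y => 1 * u y + `|u y|)) x}.
  apply: mf_pos; first by apply: rL1_inLp; apply: rL1D => //; exact: rL1Z.
  by apply: aeW => y /=; rewrite ler0c mul1r -lerBlDl sub0r -normrN ler_norm.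
apply: filterS3 pos1 pos2 (op_linearL1 1 hu hn) => x p1 + e; rewrite e.
move=> /ger0_Im; rewrite rmorph1 mul1r raddfD /= (ger0_Im p1) addr0 => h.
by rewrite [LHS]complexE h mulr0 addr0.
Qed.

Lemma J_linL1 (a : R) (u v : Y -> R) : rL1 nu u -> rL1 nu v ->
  {ae P, forall x, J (fun y => a * u y + v y) x = a * J u x + J v x}.
Proof.
move=> hu hv; apply: filterS3 (op_linearL1 a hu hv) (op_realL1 hu) (op_realL1 hv) => x.
by rewrite /markov_re => -> -> -> /=; rewrite !(mul0r, subr0).
Qed.

Lemma op_real c : bm nu c -> {ae P, forall x, mf_op Y (RC \o c) x = RC (J c x)}.
Proof. by move=> /bm_rL1; exact: op_realL1. Qed.

Lemma J_lin (a : R) c c' : bm nu c -> bm nu c' ->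
  {ae P, forall x, J (fun y => a * c y + c' y) x = a * J c x + J c' x}.
Proof. by move=> /bm_rL1 h /bm_rL1; exact: J_linL1. Qed.

Lemma J_ae c c' : bm nu c -> bm nu c' -> {ae nu, forall y, c y = c' y} ->
  {ae P, forall x, J c x = J c' x}.
Proof.
move=> bc bc' cc'; have := mf_ae (bm_inL1 bc) (bm_inL1 bc').
move=> /(_ _)/wrap[]; last by apply: filterS => x; rewrite /markov_re => ->.
by apply: filterS cc' => y /= ->.
Qed.

Lemma J_ge0L1 (u : Y -> R) : rL1 nu u -> {ae nu, forall y, 0 <= u y} -> {ae P, forall x, 0 <= J u x}.
Proof.
move=> hu u0; have := mf_pos (rL1_inLp hu).
move=> /(_ _)/wrap[]; first by apply: filterS u0 => y /=; rewrite ler0c.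
by move=> h; apply: filterS2 h (op_realL1 hu) => x + e; rewrite e ler0c.
Qed.

Lemma J_ge0 c : bm nu c -> {ae nu, forall y, 0 <= c y} -> {ae P, forall x, 0 <= J c x}.
Proof. by move=> /bm_rL1; exact: J_ge0L1. Qed.

Lemma J_indic_ge0 (A : set Y) : measurable A -> {ae P, forall x, 0 <= J \1_A x}.
Proof.
by move=> mA; apply: J_ge0; [exact: bm_indic|apply: aeW => y; rewrite indicE ler0n].
Qed.

Lemma J1 : {ae P, forall x, J (fun=> 1) x = 1}.
Proof. by apply: filterS (mf_one Y) => x; rewrite /markov_re => ->. Qed.

Lemma measurable_J c : bm nu c -> measurable_fun setT (J c).
Proof. by move=> /bm_inL1/(mf_L1)[[]]. Qed.

Lemma J_cst (a : R) : {ae P, forall x, J (fun=> a) x = a}.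
Proof.
have z : {ae P, forall x, J (fun=> 0) x = 0}.
  have := J_lin (-1) (bm_cst nu 0) (bm_cst nu 0).
  apply: filterS => x; rewrite (_ : (fun=> _) = fun=> 0); last by apply/funext => y; ring.
  by lra.
have := J_lin a (bm_cst nu 1) (bm_cst nu 0).
rewrite (_ : (fun=> _) = fun=> a); last by apply/funext => y; ring.
by move=> h; apply: filterS3 h J1 z => x -> -> ->; ring.
Qed.

Lemma JZ (a : R) c : bm nu c -> {ae P, forall x, J (fun y => a * c y) x = a * J c x}.
Proof.
move=> bc; have := J_lin a bc (bm_cst nu 0) => h.
apply: filterS2 h (J_cst 0) => x; rewrite (_ : (fun y => _) = fun y => a * c y); last first.
  by apply/funext => y; ring.
by move=> -> ->; ring.
Qed.

Lemma JD c c' : bm nu c -> bm nu c' ->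
  {ae P, forall x, J (fun y => c y + c' y) x = J c x + J c' x}.
Proof.
move=> bc bc'; have := J_lin 1 bc bc'.
rewrite (_ : (fun y => _) = fun y => c y + c' y); last by apply/funext => y; ring.
by apply: filterS => x ->; ring.
Qed.

Lemma JB c c' : bm nu c -> bm nu c' ->
  {ae P, forall x, J (fun y => c y - c' y) x = J c x - J c' x}.
Proof.
move=> bc bc'; have := J_lin (-1) bc' bc.
rewrite (_ : (fun y => _) = fun y => c y - c' y); last by apply/funext => y; ring.
by apply: filterS => x ->; ring.
Qed.

Lemma J_le c c' : bm nu c -> bm nu c' -> {ae nu, forall y, c y <= c' y} ->
  {ae P, forall x, J c x <= J c' x}.
Proof.
move=> bc bc' cc'; have := J_ge0 (bmB bc' bc).
move=> /(_ _)/wrap[]; first by apply: filterS cc' => y; rewrite subr_ge0.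
by move=> h; apply: filterS2 h (JB bc' bc) => x + e; rewrite e subr_ge0.
Qed.

Lemma J_bound c (C : R) : bm nu c -> {ae nu, forall y, `|c y| <= C} ->
  {ae P, forall x, `|J c x| <= C}.
Proof.
move=> bc cC.
have h1 : {ae P, forall x, J c x <= J (fun=> C) x}.
  apply: J_le => //; first exact: bm_cst.
  by apply: filterS cC => y; rewrite ler_norml => /andP[].
have h2 : {ae P, forall x, J (fun=> - C) x <= J c x}.
  apply: J_le => //; first exact: bm_cst.
  by apply: filterS cC => y; rewrite ler_norml => /andP[].
have h3 := ae_and (J_cst C) (J_cst (- C)).
apply: filterS3 h1 h2 h3 => x + + [e1 e2]; rewrite e1 e2 ler_norml.
by move=> -> ->.
Qed.

Lemma bm_J c : bm nu c -> bm P (J c).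
Proof.
move=> bc; split; first exact: measurable_J.
by have [_ [C cC]] := bc; exists C; exact: J_bound.
Qed.

Lemma JM c c' : bm nu c -> bm nu c' ->
  {ae P, forall x, J (fun y => c y * c' y) x = J c x * J c' x}.
Proof.
move=> bc bc'; have := mf_mul (bm_inLoo bc) (bm_inLoo bc').
rewrite (_ : (fun y => _) = RC \o (fun y => c y * c' y)); last first.
  by apply/funext => y /=; rewrite rmorphM.
move=> h; apply: filterS3 h (op_real bc) (op_real bc') => x.
by rewrite /markov_re => -> -> ->; rewrite -rmorphM.
Qed.

Lemma J_intL1 (u : Y -> R) : rL1 nu u -> EI P (J u) = EI nu u.
Proof. by move=> hu; have := mf_integral (rL1_inLp hu) => -[]. Qed.

Lemma J_int c : bm nu c -> EI P (J c) = EI nu c.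
Proof. by move=> /bm_rL1; exact: J_intL1. Qed.

Lemma J_U n c : bm nu c -> {ae P, forall x, J (U n c) x = U n (J c) x}.
Proof.
have h1 c' : bm nu c' -> {ae P, forall x, J (U 1 c') x = U 1 (J c') x}.
  move=> bc'; have := mf_koopman (bm_inL1 bc').
  by apply: filterS => x; rewrite /markov_re /U => -> .
move=> bc; elim/int_rec: n => [|n IH|n IH]; first exact: aeW.
- have := h1 _ (bmU n bc); rewrite UD addrC -PoszD addn1 => h.
  by apply: filterS2 h (ae_U 1 IH) => x -> e; rewrite {1}/U e /U -mps_iterD -PoszD addn1.
- have e : 1 + - (n.+1)%:Z = - n%:Z by lia.
  have := h1 _ (bmU (- (n.+1)%:Z) bc); rewrite UD e => h.
  have h' : {ae P, forall x, U 1 (J (U (- (n.+1)%:Z) c)) x = U (- n%:Z) (J c) x}.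
    by apply: filterS2 h IH => x -> ->.
  have := ae_U (-1) h'; apply: filterS => x; rewrite /U -!mps_iterD.
  by rewrite mps_iter0 (_ : - n%:Z + -1 = - n.+1%:Z)//; lia.
Qed.

Lemma J_sum (I : Type) (s : seq I) (c : I -> Y -> R) : (forall i, bm nu (c i)) ->
  {ae P, forall x, J (fun y => \sum_(i <- s) c i y) x = \sum_(i <- s) J (c i) x}.
Proof.
move=> bc; elim: s => [|i s IH].
  rewrite (_ : (fun y => _) = fun=> 0); last by apply/funext => y; rewrite big_nil.
  by apply: filterS (J_cst 0) => x ->; rewrite big_nil.
rewrite (_ : (fun y => _) = fun y => c i y + \sum_(i <- s) c i y); last first.
  by apply/funext => y; rewrite big_cons.
have := JD (bc i) (bm_sum s xpredT bc) => h.
by apply: filterS2 h IH => x -> ->; rewrite big_cons.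
Qed.

End RealMarkov.

(** * Uniform approximation by step functions *)

Section StepApproximation.
Variable R : realType.

(** The sum counts the positive integers up to t, so it is the integer part of t. *)
Lemma count_le_approx (t : R) (m : nat) : 0 <= t -> t <= m%:R ->
  `|t - \sum_(0 <= j < m) (j.+1%:R <= t)%R%:R| <= 1.
Proof.
move=> t0.
pose S m : R := \sum_(0 <= j < m) (j.+1%:R <= t)%R%:R.
have SS n : S n.+1 = S n + (n.+1%:R <= t)%R%:R by rewrite /S big_nat_recr.
have c n : n%:R <= t -> S n = n%:R.
  elim: n => [|n IH] h; first by rewrite /S big_nil.
  have hn : n%:R <= t by apply: le_trans h; rewrite ler_nat.
  by rewrite SS h (IH hn) natr1.
have a n : S n <= t.
  elim: n => [|n IH]; first by rewrite /S big_nil.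
  rewrite SS; case: (leP n.+1%:R t) => h; last by rewrite addr0.
  have hn : n%:R <= t by apply: le_trans h; rewrite ler_nat.
  by rewrite (c _ hn) natr1.
have b n : t <= n%:R -> t <= S n + 1.
  elim: n => [|n IH] h; first by rewrite /S big_nil add0r (le_trans h).
  rewrite SS; have [tn|nt] := leP t n%:R.
    by apply: (le_trans (IH tn)); rewrite lerD2r lerDl ler0n.
  rewrite (c n (ltW nt)); apply: (le_trans h); rewrite -natr1 lerD2r lerDl ler0n//.
move=> tm; rewrite ler_norml; have := a m; have := b m tm; rewrite /S; lra.
Qed.

Lemma measurable_set_ge (d : measure_display) (T : measurableType d) (f : T -> R) (a : R) :
  measurable_fun setT f -> measurable [set y | a <= f y].
Proof.
move=> mf; rewrite (_ : [set y | _] = setT `&` f @^-1` [set` `[a, +oo[]).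
  by apply: mf => //; exact: measurable_itv.
by rewrite setTI; apply/seteqP; split => y /=; rewrite in_itv/= andbT.
Qed.

Lemma measurable_set_gt (d : measure_display) (T : measurableType d) (f : T -> R) (a : R) :
  measurable_fun setT f -> measurable [set y | a < f y].
Proof.
move=> mf; rewrite (_ : [set y | _] = setT `&` f @^-1` [set` `]a, +oo[]).
  by apply: mf => //; exact: measurable_itv.
by rewrite setTI; apply/seteqP; split => y /=; rewrite in_itv/= andbT.
Qed.

Lemma bm_step_approx (d : measure_display) (T : measurableType d) (P : probability T R)
    (c : T -> R) : bm P c -> forall e : R, 0 < e ->
  exists (n : nat) (a : nat -> R) (A : nat -> set T),
    (forall i, measurable (A i)) /\
    {ae P, forall y, `|c y - \sum_(0 <= i < n) a i * \1_(A i) y| <= e}.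
Proof.
move=> [mc [C0 cC0]] e e0; pose C : R := `|C0| + 1.
have C1 : 0 < C by rewrite ltr_wpDl.
have cC : {ae P, forall y, `|c y| <= C}.
  apply: filterS cC0 => y h; apply: (le_trans h).
  by apply: (le_trans (ler_norm _)); rewrite lerDl.
pose m := (Num.truncn (2 * C / e)).+1.
have m0 : 0 < m%:R :> R by rewrite ltr0n.
have hm : 2 * C / e <= m%:R by apply/ltW/truncnS_gt.
pose L : R := 2 * C / m%:R.
have L0 : 0 < L by rewrite divr_gt0// mulr_gt0.
have Le : L <= e by move: hm; rewrite /L !ler_pdivrMr// (mulrC e).
(* Index 0 contributes the constant -C, and index j + 1 a step of height [L] where c reaches the
   level -C + (j + 1) L. *)
exists m.+1, (fun i => if i is 0%N then - C else L),
  (fun i => if i is j.+1 then [set y | j.+1%:R <= (c y + C) / L] else setT).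
split.
  case=> [|j]; first exact: measurableT.
  apply: (measurable_set_ge (f := fun y => (c y + C) / L)).
  by apply: measurable_funM => //; apply: measurable_funD => //; exact: measurable_cst.
apply: filterS cC => y; rewrite ler_norml => /andP[h1 h2].
rewrite big_nat_recl// indicT mulr1.
rewrite (eq_bigr (fun j : nat => L * (j.+1%:R <= (c y + C) / L)%R%:R)); last first.
  move=> j _; rewrite indicE; congr (_ * (nat_of_bool _)%:R).
  by apply/idP/idP; rewrite inE.
rewrite -mulr_sumr.
have t0 : 0 <= (c y + C) / L by rewrite divr_ge0 ?(ltW L0)//; lra.
have tm : (c y + C) / L <= m%:R.
  rewrite ler_pdivrMr// /L mulrCA divff ?gt_eqF// mulr1; lra.
have := count_le_approx t0 tm; set S := \sum_(_ <= _ < _) _ => h.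
have -> : c y - (- C + L * S) = L * ((c y + C) / L - S).
  by rewrite mulrBr mulrCA divff ?gt_eqF// mulr1; ring.
rewrite normrM gtr0_norm//; apply: le_trans Le; rewrite ler_piMr// ltW//.
Qed.

End StepApproximation.

(** * Conditional expectation of bounded real functions *)

Section ConditionalExpectation.
Variables (R : realType) (X : mpsystem R) (Y : mfactor X).
Local Notation P := (mps_prob X).
Local Notation nu := (mps_prob Y).
Local Notation J := (@markov_re R X Y).
Implicit Types (c : Y -> R) (f g : X -> R).

Lemma fine_prob (A : set Y) : measurable A -> (fine (nu A))%:E = nu A.
Proof. by move=> mA; rewrite fineK// fin_num_measure. Qed.

Section Density.
Variables (F : X -> R) (bF : bm P F).

(** Signed measure on Y whose density is E_Y(F). The proof of [bm P F] is part of the term so that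
    the charge structure below attaches to it. *)
Definition weighted_charge of bm P F := fun A : set Y =>
  (EI P (fun x => F x * J \1_A x))%:E.

Local Notation lam := (weighted_charge bF).

Lemma weighted_charge0 : lam set0 = 0%E.
Proof.
rewrite /lam; congr (_%:E); rewrite -[RHS](EI_cst P 0); apply: ae_EI.
- by apply: bmM => //; apply: bm_J; exact: bm_indic.
- exact: bm_cst.
- rewrite indic0; apply: filterS (J_cst Y 0) => x.
  by rewrite (_ : cst 0 = (fun=> 0))// => ->; rewrite mulr0.
Qed.

Lemma weighted_charge_fin (A : set Y) : measurable A -> lam A \is a fin_num.
Proof. by []. Qed.

(** J preserves order and integrals. The tail of the series is therefore at most |C| times the
    integral of the remainder [r n], which tends to 0 by sigma-additivity of nu. *)
Lemma weighted_charge_sigma : semi_sigma_additive lam.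
Proof.
move=> A mA tA mU; set U := \bigcup_n A n in mU *.
have [_ [C FC]] := bF.
have bA n : bm nu (\1_(A n) : Y -> R) by exact: bm_indic.
have bU : bm nu (\1_U : Y -> R) by exact: bm_indic.
pose r n y : R := \1_U y - \sum_(0 <= i < n) \1_(A i) y.
have br n : bm nu (r n) by apply: bmB => //; exact: bm_sum.
have r0 n y : 0 <= r n y.
  rewrite subr_ge0; case: (pselect (U y)) => Uy; last first.
    rewrite big1 ?indicE// => i _; rewrite indicE memNset// => Ay.
    by apply: Uy; exists i.
  rewrite [leRHS]indicE mem_set//; case: Uy => j _ Ajy.
  have e i : \1_(A i) y = (i == j)%:R :> R.
    rewrite indicE; case: eqP => [->|ij]; first by rewrite mem_set.
    rewrite memNset// => Aiy; apply: ij; apply: (tA i j) => //; by exists y.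
  suff -> : \sum_(0 <= i < n) \1_(A i) y = (j < n)%:R :> R by case: (j < n)%N.
  elim: n => [|n IH]; first by rewrite big_nil.
  have -> : (j < n.+1)%N = ((n == j) || (j < n)%N) by rewrite ltnS leq_eqVlt eq_sym.
  rewrite big_nat_recr//= IH e -natrD.
  by case: eqP => [->|]; rewrite ?ltnn ?addn0.
have rn : tends0 (fun n => EI nu (r n)).
  have : (fun n => (\sum_(0 <= i < n) EI nu \1_(A i))%:E) @ \oo --> (fine (nu U))%:E.
    rewrite fine_prob//.
    have := @measure_semi_sigma_additive _ _ _ nu A mA tA mU.
    rewrite (_ : (fun n => _) = (fun n => (\sum_(0 <= i < n) EI nu \1_(A i))%:E))//.
    apply/funext => n; rewrite -sumEFin; apply: eq_bigr => i _.
    by rewrite EI_indic// fine_prob.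
  move=> /fine_cvg /= h.
  apply/cvg_tends0.
  have -> : (fun n => EI nu (r n)) = (fun n => fine (nu U) - \sum_(0 <= i < n) EI nu \1_(A i)).
    by apply/funext => n; rewrite /r EIB ?EI_sum ?EI_indic//; exact: bm_sum.
  by rewrite -[X in _ --> X](subrr (fine (nu U))); apply: cvgB => //; exact: cvg_cst.
have bd n : `|EI P (fun x => F x * J \1_U x) -
   \sum_(0 <= i < n) EI P (fun x => F x * J \1_(A i) x)| <= `|C| * EI nu (r n).
  have bJ i : bm P (fun x => F x * J \1_(A i) x) by apply: bmM => //; exact: bm_J.
  have bJU : bm P (fun x => F x * J \1_U x) by apply: bmM => //; exact: bm_J.
  rewrite -(EI_sum _ _ bJ) -EIB//; last exact: bm_sum.
  have bFr : bm P (fun x => F x * J (r n) x) by apply: bmM => //; exact: bm_J.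
  rewrite (_ : EI _ _ = EI P (fun x => F x * J (r n) x)); last first.
    apply: ae_EI => //; first by apply: bmB => //; exact: bm_sum.
    have h1 := JB bU (bm_sum (index_iota 0 n) xpredT bA).
    have h2 := J_sum (index_iota 0 n) bA.
    apply: filterS2 h1 h2 => x -> ->.
    by rewrite mulrBr mulr_sumr.
  apply: (le_trans (EI_le_norm bFr)).
  rewrite -(J_int (br n)) -EIZ; last exact: bm_J.
  apply: EI_le; [exact: bm_norm|by apply: bmZ; exact: bm_J|].
  have h := J_ge0 (br n) (aeW _ (r0 n)).
  apply: filterS2 h FC => x h1 h2.
  by rewrite normrM (ger0_norm h1) ler_wpM2r// (le_trans h2)// ler_norm.
have -> : (fun n => (\sum_(0 <= i < n) lam (A i))%E) =
  (fun n => (\sum_(0 <= i < n) EI P (fun x => F x * J \1_(A i) x))%:E).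
  by apply/funext => n; rewrite -sumEFin.
apply: cvg_EFin; first exact: nearW.
apply/cvgrPdist_le => e e0; have [N HN] := tends0Z `|C| rn e0.
exists N => // n /= /HN h; apply: (le_trans (bd n)).
exact: le_trans (ler_norm _) h.
Qed.

HB.instance Definition _ := isCharge.Build _ _ _ lam
  weighted_charge0 weighted_charge_fin weighted_charge_sigma.

Lemma weighted_charge_dominated : lam `<< nu.
Proof.
apply/null_content_dominatesP => A mA A0.
rewrite /lam; congr (_%:E); rewrite -[RHS](EI_cst P 0); apply: ae_EI.
- by apply: bmM => //; apply: bm_J; exact: bm_indic.
- exact: bm_cst.
- have h : {ae nu, forall y, \1_A y = 0 :> R}.
    exists A; split => // y /= h; apply: contrapT => Ay; apply: h.
    by rewrite indicE memNset.
  have := J_ae (bm_indic nu mA) (bm_cst nu 0) h => h'.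
  by apply: filterS2 h' (J_cst Y 0) => x -> ->; rewrite mulr0.
Qed.

Lemma cond_exp_density : exists h : Y -> R, [/\ measurable_fun setT h,
   nu.-integrable setT (EFin \o h) &
   forall A, measurable A ->
     (\int[nu]_(y in A) (h y)%:E = (EI P (fun x => F x * J \1_A x))%:E)%E].
Proof.
pose g := Radon_Nikodym lam nu.
have gf y : g y \is a fin_num by apply: Radon_Nikodym_fin_num; exact: weighted_charge_dominated.
have gi : nu.-integrable setT g by apply: Radon_Nikodym_integrable; exact: weighted_charge_dominated.
have e : EFin \o (fine \o g) = g by apply/funext => y /=; rewrite fineK.
exists (fine \o g); split.
- by apply/measurable_EFinP; rewrite e; exact: measurable_int gi.
- by rewrite e.
- move=> A mA; apply: etrans (esym (Radon_Nikodym_integral weighted_charge_dominated mA)).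
  by apply: eq_integral => y _; exact: fineK (gf y).
Qed.

End Density.

(** On the set A where h >= C + e, the integral of h is at least (C + e) nu(A). It equals the
    integral of F J 1_A, which is at most C nu(A), so that nu(A) = 0. *)
Lemma density_ub (F : X -> R) (h : Y -> R) (C : R) : bm P F ->
  measurable_fun setT h -> nu.-integrable setT (EFin \o h) ->
  (forall A, measurable A ->
     (\int[nu]_(y in A) (h y)%:E = (EI P (fun x => F x * J \1_A x))%:E)%E) ->
  {ae P, forall x, F x <= C} -> {ae nu, forall y, h y <= C}.
Proof.
move=> bF mh ih hA FC.
have key (e : R) : 0 < e -> {ae nu, forall y, h y < C + e}.
  move=> e0; pose A := [set y | C + e <= h y].
  have mA : measurable A by exact: measurable_set_ge.
  have bA : bm nu (\1_A : Y -> R) by exact: bm_indic.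
  have bJA := bm_J bA.
  suff A0 : nu A = 0%E.
    by exists A; split => // y /=; rewrite /A /= => /negP; rewrite -leNgt.
  have l1 : EI P (fun x => F x * J \1_A x) <= C * fine (nu A).
    rewrite -EI_indic// -(J_int bA) -EIZ//; apply: EI_le; [exact: bmM|exact: bmZ|].
    have h0 := J_indic_ge0 mA.
    by apply: filterS2 h0 FC => x a b; rewrite ler_wpM2r.
  have l2 : ((C + e)%:E * nu A <= \int[nu]_(y in A) (h y)%:E)%E.
    rewrite -integral_cst//; apply: le_integral => //.
    - exact: finite_measure_integrable_cst.
    - exact: integrableS ih.
    - by move=> y; rewrite inE /A /= lee_fin.
  move: l2; rewrite hA// -(fine_prob mA) -EFinM lee_fin => l2.
  have n0 : 0 <= fine (nu A) by rewrite fine_ge0.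
  have : fine (nu A) = 0 by apply/eqP; rewrite eq_le n0 andbT -(pmulr_rle0 _ e0); nra.
  by move=> ->.
have : {ae nu, forall y, forall n : nat, h y < C + n.+1%:R^-1}.
  by apply: ae_foralln => n; apply: key; rewrite invr_gt0.
apply: filterS => y hy; apply/ler_addgt0Pr => e e0.
have [N HN] := tends0_invn e0.
apply: ltW; apply: (lt_le_trans (hy N)); rewrite lerD2l.
by have := HN N.+1 (leqnSn _); rewrite ger0_norm.
Qed.

(** The identity for indicators extends to bounded c by uniform approximation with step functions,
    because both pairings are continuous for the essential supremum. *)
Lemma cond_exp_bounded (F : X -> R) : bm P F -> exists h : Y -> R, bm nu h /\
  forall c, bm nu c -> EI nu (fun y => h y * c y) = EI P (fun x => F x * J c x).
Proof.
move=> bF; have [h [mh ih hA]] := cond_exp_density bF.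
have [_ [C FC]] := bF.
have ub : {ae nu, forall y, h y <= C}.
  apply: density_ub bF mh ih hA _.
  by apply: filterS FC => x; apply: le_trans; exact: ler_norm.
have lb : {ae nu, forall y, - h y <= C}.
  apply: (@density_ub (fun x => - F x)).
  - exact: bmN.
  - exact: measurable_funN.
  - exact: integrableN ih.
  - move=> A mA; have bA : bm nu (\1_A : Y -> R) by exact: bm_indic.
    have bFA : bm P (fun x => F x * J \1_A x) by apply: bmM => //; exact: bm_J.
    rewrite (_ : (fun x => - F x * _) = (fun x => (-1) * (F x * J \1_A x))); last first.
      by apply/funext => x; ring.
    rewrite EIZ// mulN1r EFinN -hA//.
    under eq_integral do rewrite EFinN.
    have ihA := integrableS measurableT mA (@subsetT _ A) ih.
    by rewrite integralN//; exact: (integrable_add_def mA ihA).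
  - by apply: filterS FC => x; apply: le_trans; rewrite -normrN; exact: ler_norm.
have hC : {ae nu, forall y, `|h y| <= C}.
  by apply: filterS2 ub lb => y h1 h2; rewrite ler_norml h1 andbT lerNl.
have bh : bm nu h by split => //; exists C.
exists h; split => // c bc.
have step A : measurable A -> EI nu (fun y => h y * \1_A y) = EI P (fun x => F x * J \1_A x).
  move=> mA; rewrite /EI /Rintegral.
  have -> : (\int[nu]_y (h y * \1_A y)%:E = \int[nu]_(y in A) (h y)%:E)%E.
    rewrite [RHS]integral_mkcond; apply: eq_integral => y _.
    rewrite /patch indicE; case: (y \in A); rewrite ?mulr1 ?mulr0//.
  by rewrite hA.
apply/eqP; rewrite -subr_eq0 -normr_le0; apply/ler_addgt0Pr => e e0; rewrite add0r.
(* Each of the two errors will be at most |C| e / (2 |C| + 1); the summand 1 covers C = 0. *)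
have C1 : 0 < 2 * `|C| + 1 by rewrite ltr_wpDl// mulr_ge0.
have [|n [a [A [mA ap]]]] := bm_step_approx bc (e := e / (2 * `|C| + 1)); first exact: divr_gt0.
pose s y : R := \sum_(0 <= i < n) a i * \1_(A i) y.
have bA i : bm nu (\1_(A i) : Y -> R) by exact: bm_indic.
have bs : bm nu s by apply: bm_sum => i; exact: bmZ.
have bcs := bmB bc bs.
have bJc := bm_J bc; have bJs := bm_J bs; have bJcs := bm_J bcs.
have es : EI nu (fun y => h y * s y) = EI P (fun x => F x * J s x).
  have h1 : EI nu (fun y => h y * s y) = \sum_(0 <= i < n) a i * EI nu (fun y => h y * \1_(A i) y).
    have -> : (fun y => h y * s y) = (fun y => \sum_(0 <= i < n) a i * (h y * \1_(A i) y)).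
      by apply/funext => y; rewrite /s mulr_sumr; apply: eq_bigr => i _; ring.
    rewrite EI_sum; last by move=> i; apply: bmZ; exact: bmM.
    by apply: eq_bigr => i _; rewrite EIZ//; exact: bmM.
  have h2 : EI P (fun x => F x * J s x) = \sum_(0 <= i < n) a i * EI P (fun x => F x * J \1_(A i) x).
    have bFJ i : bm P (fun x => F x * J \1_(A i) x) by apply: bmM => //; exact: bm_J.
    have -> : EI P (fun x => F x * J s x) = EI P (fun x => \sum_(0 <= i < n) a i * (F x * J \1_(A i) x)).
      apply: ae_EI; [exact: bmM|by apply: bm_sum => i; exact: bmZ|].
      have q1 := J_sum (index_iota 0 n) (fun i => bmZ (a i) (bA i)).
      have q2 : {ae P, forall x, forall i, J (fun y => a i * \1_(A i) y) x = a i * J \1_(A i) x}.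
        by apply: ae_foralln => i; exact: JZ.
      apply: filterS2 q1 q2 => x -> e2; rewrite mulr_sumr.
      by apply: eq_bigr => i _; rewrite e2; ring.
    rewrite EI_sum; last by move=> i; exact: bmZ.
    by apply: eq_bigr => i _; rewrite EIZ.
  by rewrite h1 h2; apply: eq_bigr => i _; rewrite step.
have -> : EI nu (fun y => h y * c y) - EI P (fun x => F x * J c x) =
  EI nu (fun y => h y * (c y - s y)) - EI P (fun x => F x * J (fun y => c y - s y) x).
  have -> : EI P (fun x => F x * J (fun y => c y - s y) x) =
      EI P (fun x => F x * J c x - F x * J s x).
    apply: ae_EI; [exact: bmM|by apply: bmB; exact: bmM|].
    by apply: filterS (JB bc bs) => x ->; ring.
  have -> : (fun y => h y * (c y - s y)) = (fun y => h y * c y - h y * s y).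
    by apply/funext => y; ring.
  rewrite !EIB; try exact: bmM.
  rewrite es; ring.
have small (d : measure_display) (T : measurableType d) (Q : probability T R) (u v : T -> R) (t : R) :
    0 <= t -> bm Q u -> bm Q v -> {ae Q, forall x, `|u x| <= C} -> {ae Q, forall x, `|v x| <= t} ->
    `|EI Q (fun x => u x * v x)| <= `|C| * t.
  move=> t0 bu bv uC vt; apply: (le_trans (EI_le_norm (bmM bu bv))).
  rewrite -(EI_cst Q (`|C| * t)); apply: EI_le.
  - by apply: bm_norm; exact: bmM.
  - exact: bm_cst.
  - apply: filterS2 uC vt => x h1 h2; rewrite normrM ler_pM//.
    by apply: (le_trans h1); exact: ler_norm.
have t0 : 0 <= e / (2 * `|C| + 1) by rewrite divr_ge0 ?ltW.
have k1 := small _ _ nu _ _ _ t0 bh bcs hC ap.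
have k2 := small _ _ P _ _ _ t0 bF bJcs FC (J_bound bcs ap).
apply: (le_trans (ler_normB _ _)); apply: (le_trans (lerD k1 k2)).
rewrite -mulrDl mulrCA ler_piMr ?(ltW e0)// ler_pdivrMr// mul1r; lra.
Qed.

(* [cE] is E_Y on bounded real functions and [ce] is J E_Y; [Mfun] singles out the bounded
   functions of the factor. *)
Definition cE (F : X -> R) : Y -> R := xget (fun=> 0) [set h | bm nu h /\
  forall c, bm nu c -> EI nu (fun y => h y * c y) = EI P (fun x => F x * J c x)].

Definition ce (F : X -> R) : X -> R := J (cE F).

Lemma cEP F : bm P F -> bm nu (cE F) /\
  forall c, bm nu c -> EI nu (fun y => cE F y * c y) = EI P (fun x => F x * J c x).
Proof.
move=> bF; have [h hP] := cond_exp_bounded bF; rewrite /cE.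
by case: xgetP => [g -> //|/(_ h)].
Qed.

Lemma bm_cE F : bm P F -> bm nu (cE F).
Proof. by move=> /cEP[]. Qed.

Lemma bm_ce F : bm P F -> bm P (ce F).
Proof. by move=> /bm_cE/bm_J. Qed.

Definition Mfun (m : X -> R) : Prop :=
  bm P m /\ exists c, bm nu c /\ {ae P, forall x, m x = J c x}.

Lemma Mfun_J c : bm nu c -> Mfun (J c).
Proof. by move=> bc; split; [exact: bm_J|exists c; split => //; exact: aeW]. Qed.

Lemma Mfun_ce F : bm P F -> Mfun (ce F).
Proof. by move=> bF; apply: Mfun_J; exact: bm_cE. Qed.

Lemma Mfun_cst (a : R) : Mfun (fun=> a).
Proof.
split; first exact: bm_cst.
by exists (fun=> a); split; [exact: bm_cst|apply: filterS (J_cst Y a) => x ->].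
Qed.

Lemma MfunD m m' : Mfun m -> Mfun m' -> Mfun (fun x => m x + m' x).
Proof.
move=> [bm1 [c [bc mc]]] [bm2 [c' [bc' mc']]]; split; first exact: bmD.
exists (fun y => c y + c' y); split; first exact: bmD.
by apply: filterS3 (JD bc bc') mc mc' => x -> -> ->.
Qed.

Lemma MfunM m m' : Mfun m -> Mfun m' -> Mfun (fun x => m x * m' x).
Proof.
move=> [bm1 [c [bc mc]]] [bm2 [c' [bc' mc']]]; split; first exact: bmM.
exists (fun y => c y * c' y); split; first exact: bmM.
by apply: filterS3 (JM bc bc') mc mc' => x -> -> ->.
Qed.

Lemma Mfun_ext m m' : Mfun m -> m =1 m' -> Mfun m'.
Proof. by move=> ? /funext <-. Qed.

Lemma MfunZ (a : R) m : Mfun m -> Mfun (fun x => a * m x).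
Proof. by move=> h; apply: MfunM h; exact: Mfun_cst. Qed.

Lemma MfunB m m' : Mfun m -> Mfun m' -> Mfun (fun x => m x - m' x).
Proof.
move=> h h'; apply: (Mfun_ext (MfunD h (MfunZ (-1) h'))) => x; ring.
Qed.

Lemma Mfun_sum (I : Type) (s : seq I) (Q : pred I) (m : I -> X -> R) :
  (forall i, Mfun (m i)) -> Mfun (fun x => \sum_(i <- s | Q i) m i x).
Proof. by apply: closed_big; [exact: Mfun_cst|exact: MfunD]. Qed.

Lemma Mfun_prod (I : Type) (s : seq I) (Q : pred I) (m : I -> X -> R) :
  (forall i, Mfun (m i)) -> Mfun (fun x => \prod_(i <- s | Q i) m i x).
Proof. by apply: closed_big; [exact: Mfun_cst|exact: MfunM]. Qed.

Lemma MfunU n m : Mfun m -> Mfun (U n m).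
Proof.
move=> [bm1 [c [bc mc]]]; split; first exact: bmU.
exists (U n c); split; first exact: bmU.
by apply: filterS2 (J_U n bc) (ae_U n mc) => x -> ; rewrite /U.
Qed.

Lemma Mfun_bm m : Mfun m -> bm P m. Proof. by case. Qed.

Lemma ce_adj F m : bm P F -> Mfun m -> EI P (fun x => F x * m x) = EI P (fun x => ce F x * m x).
Proof.
move=> bF [bm1 [c [bc mc]]]; have [bE EP] := cEP bF.
have bJ := bm_J bc; have bJE := bm_J bE.
transitivity (EI P (fun x => F x * J c x)).
  by apply: ae_EI; [exact: bmM..|apply: filterS mc => x ->].
rewrite -EP// -J_int; last exact: bmM.
apply: ae_EI; [by apply: bm_J; exact: bmM|by apply: bmM|].
by apply: filterS2 (JM bE bc) mc => x -> ->.
Qed.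

(** Test against the difference m - m' itself. *)
Lemma Mfun_uniq m m' : Mfun m -> Mfun m' ->
  (forall m'', Mfun m'' -> EI P (fun x => m x * m'' x) = EI P (fun x => m' x * m'' x)) ->
  {ae P, forall x, m x = m' x}.
Proof.
move=> h h' H; have hd := MfunB h h'; have bd := Mfun_bm hd.
have b1 := Mfun_bm h; have b2 := Mfun_bm h'.
have := EI_eq0 (bmX 2 bd) (aeW _ (fun x => sqr_ge0 (m x - m' x))).
move=> /(_ _)/wrap[].
  rewrite (_ : (fun x => _) = (fun x => m x * (m x - m' x) - m' x * (m x - m' x))); last first.
    by apply/funext => x; ring.
  by rewrite EIB ?H ?subrr//; exact: bmM.
by apply: filterS => x /eqP; rewrite sqrf_eq0 subr_eq0 => /eqP.
Qed.

Lemma ce_uniq F m : bm P F -> Mfun m ->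
  (forall m', Mfun m' -> EI P (fun x => F x * m' x) = EI P (fun x => m x * m' x)) ->
  {ae P, forall x, ce F x = m x}.
Proof.
move=> bF hm H; apply: Mfun_uniq => //; first exact: Mfun_ce.
by move=> m' hm'; rewrite -ce_adj// H.
Qed.

Lemma ce_Mfun m : Mfun m -> {ae P, forall x, ce m x = m x}.
Proof. by move=> hm; apply: ce_uniq => //; exact: Mfun_bm. Qed.

Lemma ceD F G : bm P F -> bm P G ->
  {ae P, forall x, ce (fun x => F x + G x) x = ce F x + ce G x}.
Proof.
move=> bF bG; apply: ce_uniq; [exact: bmD|by apply: MfunD; exact: Mfun_ce|] => m hm.
have b0 := Mfun_bm hm; have b1 := bm_ce bF; have b2 := bm_ce bG.
have -> : (fun x => (F x + G x) * m x) = (fun x => F x * m x + G x * m x).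
  by apply/funext => x; ring.
have -> : (fun x => (ce F x + ce G x) * m x) = (fun x => ce F x * m x + ce G x * m x).
  by apply/funext => x; ring.
rewrite EID; [|exact: bmM..]; rewrite EID; [|exact: bmM..].
by rewrite (ce_adj bF hm) (ce_adj bG hm).
Qed.

Lemma ce_mod m F : Mfun m -> bm P F ->
  {ae P, forall x, ce (fun x => m x * F x) x = m x * ce F x}.
Proof.
move=> hm bF; have bm1 := Mfun_bm hm.
apply: ce_uniq; [exact: bmM|by apply: MfunM => //; exact: Mfun_ce|] => m' hm'.
have -> : (fun x => m x * F x * m' x) = (fun x => F x * (m x * m' x)).
  by apply/funext => x; ring.
have -> : (fun x => m x * ce F x * m' x) = (fun x => ce F x * (m x * m' x)).
  by apply/funext => x; ring.
by apply: ce_adj => //; exact: MfunM.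
Qed.

Lemma ceZ (a : R) F : bm P F -> {ae P, forall x, ce (fun x => a * F x) x = a * ce F x}.
Proof. by move=> bF; apply: ce_mod => //; exact: Mfun_cst. Qed.

Lemma ce_sum (I : Type) (s : seq I) (F : I -> X -> R) : (forall i, bm P (F i)) ->
  {ae P, forall x, ce (fun x => \sum_(i <- s) F i x) x = \sum_(i <- s) ce (F i) x}.
Proof.
move=> bF; elim: s => [|i s IH].
  have := ce_Mfun (Mfun_cst 0); rewrite (_ : (fun=> 0) = (fun x => \sum_(i <- [::]) F i x)).
    by apply: filterS => x ->; rewrite !big_nil.
  by apply/funext => x; rewrite big_nil.
rewrite (_ : (fun y => _) = fun y => F i y + \sum_(i <- s) F i y); last first.
  by apply/funext => y; rewrite big_cons.
have h := ceD (bF i) (bm_sum s xpredT bF).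
by apply: filterS2 h IH => x -> ->; rewrite big_cons.
Qed.

(** The functions of the factor form a T-invariant class, so the adjunction can be translated by
    -n. *)
Lemma ceU n F : bm P F -> {ae P, forall x, ce (U n F) x = U n (ce F) x}.
Proof.
move=> bF; apply: ce_uniq; [exact: bmU|by apply: MfunU; exact: Mfun_ce|] => m hm.
have hm' := MfunU (- n) hm.
have eU (G : X -> R) : bm P G -> EI P (fun x => U n G x * m x) = EI P (fun x => G x * U (- n) m x).
  move=> bG; rewrite -(EIU n (bmM bG (Mfun_bm hm'))).
  by congr (EI P); apply/funext => x; rewrite /U mps_iterNK.
rewrite !eU//; first exact: ce_adj.
exact: bm_ce.
Qed.

(** Test against the indicator of the set where the bound fails. *)
Lemma cE_ub F (C : R) : bm P F -> {ae P, forall x, F x <= C} -> {ae nu, forall y, cE F y <= C}.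
Proof.
move=> bF FC; have [bE EP] := cEP bF.
pose A := [set y | C < cE F y].
have mA : measurable A by apply: measurable_set_gt; case: bE.
have bA : bm nu (\1_A : Y -> R) by exact: bm_indic.
have bEC : bm nu (fun y => (cE F y - C) * \1_A y).
  by apply: bmM => //; apply: bmB => //; exact: bm_cst.
have ge0 y : 0 <= (cE F y - C) * \1_A y.
  rewrite indicE; case: (boolP (y \in A)) => [|_]; last by rewrite mulr0.
  by rewrite inE /A /= mulr1 subr_ge0 => /ltW.
have := EI_eq0 bEC (aeW _ ge0); move=> /(_ _)/wrap[].
  apply/eqP; rewrite eq_le; apply/andP; split; last by apply: EI_ge0 => //; exact: aeW.
  have -> : (fun y => (cE F y - C) * \1_A y) = (fun y => cE F y * \1_A y - C * \1_A y).
    by apply/funext => y; ring.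
  rewrite EIB; [|exact: bmM|exact: bmZ].
  rewrite EP// EIZ// -J_int// -EIZ; last exact: bm_J.
  rewrite subr_le0; apply: EI_le; [by apply: bmM => //; exact: bm_J|by apply: bmZ; exact: bm_J|].
  have h0 := J_indic_ge0 mA.
  by apply: filterS2 h0 FC => x a b; rewrite ler_wpM2r.
apply: filterS => y; rewrite indicE; case: (boolP (y \in A)) => [|] yA.
  by rewrite mulr1 => /eqP; rewrite subr_eq0 => /eqP ->.
by move=> _; rewrite leNgt; apply: contra yA; rewrite inE.
Qed.

Lemma cEN F : bm P F -> {ae nu, forall y, cE (fun x => - F x) y = - cE F y}.
Proof.
move=> bF; have bN := bmN bF; have [bE EP] := cEP bF; have [bE' EP'] := cEP bN.
pose d y := cE (fun x => - F x) y + cE F y.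
have bd : bm nu d by exact: bmD.
have := EI_eq0 (bmX 2 bd) (aeW _ (fun x => sqr_ge0 (d x))); move=> /(_ _)/wrap[].
  have -> : (fun x => d x ^+ 2) = (fun x => cE (fun x => - F x) x * d x + cE F x * d x).
    by apply/funext => x; rewrite /d; ring.
  have bJ := bm_J bd.
  rewrite EID; try exact: bmM.
  rewrite EP// EP'// -EID; try by apply: bmM.
  rewrite -[RHS](EI_cst P 0); congr (EI P); apply/funext => x; ring.
by apply: filterS => y /eqP; rewrite sqrf_eq0 addr_eq0 => /eqP.
Qed.

Lemma cE_bound F (C : R) : bm P F -> {ae P, forall x, `|F x| <= C} ->
  {ae nu, forall y, `|cE F y| <= C}.
Proof.
move=> bF FC.
have h1 : {ae nu, forall y, cE F y <= C}.
  by apply: cE_ub => //; apply: filterS FC => x; apply: le_trans; exact: ler_norm.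
have h2 : {ae nu, forall y, cE (fun x => - F x) y <= C}.
  apply: cE_ub; first exact: bmN.
  by apply: filterS FC => x; apply: le_trans; rewrite -normrN ler_norm.
by apply: filterS3 h1 h2 (cEN bF) => y a b e; rewrite ler_norml a andbT lerNl -e.
Qed.

Lemma ce_bound F (C : R) : bm P F -> {ae P, forall x, `|F x| <= C} ->
  {ae P, forall x, `|ce F x| <= C}.
Proof. by move=> bF FC; apply: J_bound; [exact: bm_cE|exact: cE_bound]. Qed.

Lemma ce_ge0 F : bm P F -> {ae P, forall x, 0 <= F x} -> {ae P, forall x, 0 <= ce F x}.
Proof.
move=> bF F0; apply: J_ge0; first exact: bm_cE.
have h : {ae nu, forall y, cE (fun x => - F x) y <= 0}.
  by apply: cE_ub; [exact: bmN|apply: filterS F0 => x; rewrite oppr_le0].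
by apply: filterS2 h (cEN bF) => y + e; rewrite e oppr_le0.
Qed.

End ConditionalExpectation.

(** * Correlation operators *)

Section PositiveSemidefinite.

Lemma ae_forall_count (d : measure_display) (T : measurableType d) (R : realType)
    (mu : {measure set T -> \bar R}) (I : countType) (Q : I -> T -> Prop) :
  (forall i, {ae mu, forall x, Q i x}) -> {ae mu, forall x, forall i, Q i x}.
Proof.
move=> H; have : {ae mu, forall x, forall n : nat, if unpickle n is Some i then Q i x else True}.
  apply: ae_foralln => n; case: (unpickle n) => [i|]; first exact: H.
  exact: aeW.
by apply: filterS => x h i; have := h (pickle i); rewrite pickleK.
Qed.

Lemma cvgn_sum (R : realType) (I : Type) (s : seq I) (u : I -> nat -> R) (l : I -> R) :
  (forall i, u i @ \oo --> l i) ->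
  (fun k => \sum_(i <- s) u i k) @ \oo --> \sum_(i <- s) l i.
Proof.
move=> H; elim: s => [|i s IH].
  rewrite (_ : (fun k => _) = fun=> 0); last by apply/funext => k; rewrite big_nil.
  by rewrite big_nil; exact: cvg_cst.
rewrite (_ : (fun k => _) = fun k => u i k + \sum_(i <- s) u i k); last first.
  by apply/funext => k; rewrite big_cons.
by rewrite big_cons; apply: cvgD => //; exact: H.
Qed.

(** The quadratic form is continuous. Rational vectors matter because they are countable: one null
    set serves all of them in [ce_gram_psd]. *)
Lemma psd_rat_dense (R : realType) (n : nat) (G : 'I_n -> 'I_n -> R) :
  (forall q : {ffun 'I_n -> rat}, 0 <= \sum_i \sum_j ratr (q i) * ratr (q j) * G i j) ->
  forall z : 'I_n -> R, 0 <= \sum_i \sum_j z i * z j * G i j.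
Proof.
move=> H z.
have rat_near (a : R) (k : nat) : exists q : rat, `|a - ratr q| <= k.+1%:R^-1.
  have k0 : 0 < k.+1%:R^-1 :> R by rewrite invr_gt0.
  move: k0; move: (_^-1) => t t0.
  have [|q] := @rat_in_itvoo R (a - t) (a + t); first by lra.
  by rewrite in_itv /= => /andP[h1 h2]; exists q; rewrite ler_norml; lra.
have /choice[q qP] : forall k, exists q : {ffun 'I_n -> rat},
    forall i, `|z i - ratr (q i)| <= k.+1%:R^-1.
  move=> k; have /choice[g gP] : forall i, exists r : rat, `|z i - ratr r| <= k.+1%:R^-1.
    by move=> i; exact: rat_near.
  by exists (finfun g) => i; rewrite ffunE.
have qc i : (fun k => ratr (q k i) : R) @ \oo --> z i.
  apply/cvgrPdist_le => e e0; have [N HN] := tends0_invn e0.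
  exists N => // k /= Nk; apply: (le_trans (qP k i)).
  by have := HN k.+1 (leqW Nk); rewrite ger0_norm.
have c : (fun k => \sum_i \sum_j ratr (q k i) * ratr (q k j) * G i j : R) @ \oo -->
    \sum_i \sum_j z i * z j * G i j.
  apply: cvgn_sum => i; apply: cvgn_sum => j.
  by apply: cvgM; [exact: cvgM|exact: cvg_cst].
rewrite -(cvg_lim _ c)//; apply: limr_ge; first by apply/cvg_ex; eexists; exact: c.
by apply: nearW => k; exact: H.
Qed.

Variables (R : realType) (X : mpsystem R) (Y : mfactor X).
Local Notation P := (mps_prob X).
Local Notation ce := (@ce R X Y).
Local Notation Mfun := (@Mfun R X Y).

(** For fixed rational coefficients the form is the conditional expectation of a square. The vector
    z is quantified inside the null set, as it will depend on the point x. *)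
Lemma ce_gram_psd (n : nat) (phi : 'I_n -> X -> R) : (forall i, bm P (phi i)) ->
  {ae P, forall x, forall z : 'I_n -> R,
     0 <= \sum_i \sum_j z i * z j * ce (fun x => phi i x * phi j x) x}.
Proof.
move=> bphi.
suff : {ae P, forall x, forall q : {ffun 'I_n -> rat},
     0 <= \sum_i \sum_j ratr (q i) * ratr (q j) * ce (fun x => phi i x * phi j x) x}.
  by apply: filterS => x h; exact: psd_rat_dense.
apply: ae_forall_count => q.
have bij i j : bm P (fun x => phi i x * phi j x) by exact: bmM.
pose s x : R := \sum_i ratr (q i) * phi i x.
have bs : bm P s by apply: bm_sum => i; exact: bmZ.
have sE : (fun x => s x ^+ 2) =
    (fun x => \sum_i \sum_j (ratr (q i) * ratr (q j)) * (phi i x * phi j x)).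
  apply/funext => x; rewrite expr2 /s mulr_suml; apply: eq_bigr => i _.
  by rewrite mulr_sumr; apply: eq_bigr => j _; ring.
have h0 := ce_ge0 Y (bmX 2 bs) (aeW _ (fun x => sqr_ge0 (s x))).
rewrite sE in h0.
have h1 := ce_sum Y (index_enum 'I_n)
  (fun i => bm_sum (index_enum 'I_n) xpredT (fun j => bmZ (ratr (q i) * ratr (q j)) (bij i j))).
have h2 : {ae P, forall x, forall i : 'I_n,
   ce (fun x => \sum_j (ratr (q i) * ratr (q j)) * (phi i x * phi j x)) x =
   \sum_j (ratr (q i) * ratr (q j)) * ce (fun x => phi i x * phi j x) x}.
  apply: ae_forall_count => i.
  have k1 := ce_sum Y (index_enum 'I_n) (fun j => bmZ (ratr (q i) * ratr (q j)) (bij i j)).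
  have k2 : {ae P, forall x, forall j : 'I_n,
      ce (fun x => (ratr (q i) * ratr (q j)) * (phi i x * phi j x)) x =
      (ratr (q i) * ratr (q j)) * ce (fun x => phi i x * phi j x) x}.
    by apply: ae_forall_count => j; exact: ceZ.
  by apply: filterS2 k1 k2 => x -> e; apply: eq_bigr => j _; rewrite e.
apply: filterS3 h0 h1 h2 => x + e1 e2; rewrite e1.
by rewrite (eq_bigr _ (fun i _ => e2 i)).
Qed.

Section HilbertSchmidt.
Variables (F : nat -> X -> R) (bF : forall a, bm P (F a)).

(** Operator with kernel K(x, x') = sum_a w_a F_a(x) F_a(x') on pairs of points in one fibre over Y,
    with the conditional expectation as fibre integral. [hs_norm2] is the fibre integral of K^2, the
    squared Hilbert-Schmidt norm. *)
Definition hs_op (w : nat -> R) (n : nat) (g : X -> R) : X -> R :=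
  fun x => \sum_(a < n) w a * F a x * ce (fun x => F a x * g x) x.

Definition hs_norm2 (w : nat -> R) (n : nat) : X -> R :=
  fun x => \sum_(a < n) \sum_(b < n) w a * w b * ce (fun x => F a x * F b x) x ^+ 2.

Lemma bm_hs_op w n g : bm P g -> bm P (hs_op w n g).
Proof.
move=> bg; apply: bm_sum => a; apply: bmM; first exact: bmZ.
by apply: bm_ce; exact: bmM.
Qed.

Lemma Mfun_hs_norm2 w n : Mfun (hs_norm2 w n).
Proof.
apply: Mfun_sum => a; apply: Mfun_sum => b; apply: MfunZ.
by apply: MfunM; apply: Mfun_ce; exact: bmM.
Qed.

(* Cauchy-Schwarz for the fibrewise Hilbert-Schmidt norm: the Gram matrix of
   [F 0, ..., F (n-1), h] is applied to the vector [w a * F a x], [- g x]. *)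
Lemma hs_op_bound w n g m : bm P g -> {ae P, forall x, `|g x| <= 1} ->
  Mfun m -> {ae P, forall x, 0 <= m x} ->
  EI P (fun x => m x * hs_op w n g x ^+ 2) <= EI P (fun x => m x * hs_norm2 w n x).
Proof.
move=> bg g1 hm m0; set h := hs_op w n g.
have bh : bm P h by exact: bm_hs_op.
have hE x : h x = hs_op w n g x by [].
clearbody h.
have bm0 := Mfun_bm hm.
pose phi (i : 'I_n.+1) := if (i < n)%N then F i else h.
have bphi i : bm P (phi i) by rewrite /phi; case: ifP.
have psd := ce_gram_psd bphi.
have bFF a b : bm P (fun x => F a x * F b x) by exact: bmM.
have bFh a : bm P (fun x => F a x * h x) by exact: bmM.
have bFg a : bm P (fun x => F a x * g x) by exact: bmM.
have bhh : bm P (fun x => h x * h x) by exact: bmM.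
have MFF a b : Mfun (ce (fun x => F a x * F b x)) by exact: Mfun_ce.
have MFh a : Mfun (ce (fun x => F a x * h x)) by exact: Mfun_ce.
have MFg a : Mfun (ce (fun x => F a x * g x)) by exact: Mfun_ce.
have Mhh : Mfun (ce (fun x => h x * h x)) by exact: Mfun_ce.
have cFF a b := Mfun_bm (MFF a b).
have cFh a := Mfun_bm (MFh a).
have cFg a := Mfun_bm (MFg a).
have chh := Mfun_bm Mhh.
(* [A - 2 B + C] is m times the Gram form at the chosen vector. Integration turns [A] into the
   Hilbert-Schmidt term, [B] into the integral of m h^2, and [C] into at most that integral, because
   |g| <= 1. *)
pose A x : R := \sum_(a < n) \sum_(b < n)
  (w a * w b) * ((F a x * F b x) * (m x * ce (fun x => F a x * F b x) x)).
pose B x : R := \sum_(a < n) w a * ((F a x * g x) * (m x * ce (fun x => F a x * h x) x)).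
pose C x : R := g x ^+ 2 * (m x * ce (fun x => h x * h x) x).
have MmFF a b := MfunM hm (MFF a b); have bmFF a b := Mfun_bm (MmFF a b).
have MmFh a := MfunM hm (MFh a); have bmFh a := Mfun_bm (MmFh a).
have MmFg a := MfunM hm (MFg a); have bmFg a := Mfun_bm (MmFg a).
have bA1 a b := bmM (bFF a b) (bmFF a b).
have bA : bm P A by apply: bm_sum => a; apply: bm_sum => b; exact: (bmZ _ (bA1 a b)).
have bB1 a := bmM (bFg a) (bmFh a).
have bB : bm P B by apply: bm_sum => a; exact: (bmZ _ (bB1 a)).
have bC : bm P C := bmM (bmX 2 bg) (bmM bm0 chh).
have pos : {ae P, forall x, 0 <= A x - 2 * B x + C x}.
  apply: filterS2 psd m0 => x H mx.
  have := H (fun i => if (i < n)%N then w i * F i x else - g x).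
  rewrite big_ord_recr /=.
  under eq_bigr do rewrite big_ord_recr /=.
  rewrite big_ord_recr /= /phi /= ltnn big_split /=.
  move=> /(mulr_ge0 mx); set s1 := \sum_(i < n) \sum_(j < n) _; set s2 := \sum_(i < n) _.
  set s3 := \sum_(i < n) _.
  have -> : A x = m x * s1.
    rewrite /A /s1 mulr_sumr; apply: eq_bigr => a _; rewrite mulr_sumr; apply: eq_bigr => b _.
    by rewrite !ltn_ord; ring.
  have e2 : m x * s2 = - B x.
    rewrite /B /s2 mulr_sumr -sumrN; apply: eq_bigr => a _; rewrite !ltn_ord; ring.
  have e3 : m x * s3 = - B x.
    rewrite /B /s3 mulr_sumr -sumrN; apply: eq_bigr => a _; rewrite !ltn_ord.
    rewrite (_ : (fun x0 => h x0 * F a x0) = (fun x0 => F a x0 * h x0)); first by ring.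
    by apply/funext => t; rewrite mulrC.
  rewrite !mulrDr e2 e3 /C; move=> H'; apply: (le_trans H'); rewrite le_eqVlt; apply/orP; left.
  by apply/eqP; ring.
have IA : EI P A = EI P (fun x => m x * hs_norm2 w n x).
  have -> : (fun x => m x * hs_norm2 w n x) = (fun x => \sum_(a < n) \sum_(b < n)
     (w a * w b) * (ce (fun x => F a x * F b x) x * (m x * ce (fun x => F a x * F b x) x))).
    apply/funext => x; rewrite /hs_norm2 mulr_sumr; apply: eq_bigr => a _.
    by rewrite mulr_sumr; apply: eq_bigr => b _; ring.
  have q3 a b := bmM (cFF a b) (bmFF a b).
  have q1 a b := bmZ (w a * w b) (bA1 a b).
  have q2 a b := bmZ (w a * w b) (q3 a b).
  rewrite /A EI_sum; last by move=> a; apply: bm_sum => b; exact: q1.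
  rewrite [RHS]EI_sum; last by move=> a; apply: bm_sum => b; exact: q2.
  apply: eq_bigr => a _; rewrite EI_sum; last by move=> b; exact: q1.
  rewrite [RHS]EI_sum; last by move=> b; exact: q2.
  apply: eq_bigr => b _; rewrite (EIZ _ (bA1 a b)) (EIZ _ (q3 a b)).
  by rewrite (ce_adj (bFF a b) (MmFF a b)).
have IB : EI P B = EI P (fun x => m x * h x ^+ 2).
  have -> : (fun x => m x * h x ^+ 2) =
     (fun x => \sum_(a < n) w a * ((F a x * h x) * (m x * ce (fun x => F a x * g x) x))).
    apply/funext => x; rewrite expr2 {1}hE /hs_op mulr_suml mulr_sumr.
    by apply: eq_bigr => a _; ring.
  have q2 a := bmM (bFh a) (bmFg a).
  rewrite /B EI_sum; last by move=> a; exact: (bmZ _ (bB1 a)).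
  rewrite [RHS]EI_sum; last by move=> a; exact: (bmZ _ (q2 a)).
  apply: eq_bigr => a _; rewrite (EIZ _ (bB1 a)) (EIZ _ (q2 a)).
  rewrite (ce_adj (bFg a) (MmFh a)) (ce_adj (bFh a) (MmFg a)).
  rewrite (_ : (fun x => ce (fun x => F a x * g x) x * _) =
    (fun x => ce (fun x => F a x * h x) x * (m x * ce (fun x => F a x * g x) x)))//.
  by apply/funext => x; rewrite mulrCA [RHS]mulrCA; congr (_ * _); exact: mulrC.
have IC : EI P C <= EI P (fun x => m x * h x ^+ 2).
  have -> : EI P (fun x => m x * h x ^+ 2) = EI P (fun x => m x * ce (fun x => h x * h x) x).
    have -> : (fun x => m x * h x ^+ 2) = (fun x => (h x * h x) * m x).
      by apply/funext => x; ring.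
    rewrite (ce_adj bhh hm); congr (EI P); apply/funext => x; ring.
  apply: (EI_le bC (bmM bm0 chh)).
  have h0 : {ae P, forall x, 0 <= ce (fun x => h x * h x) x}.
    by apply: ce_ge0 => //; apply: aeW => x; rewrite -expr2 sqr_ge0.
  apply: filterS3 h0 m0 g1 => x k1 k2 k3; rewrite /C ler_piMl ?mulr_ge0//.
  by rewrite -real_normK ?num_real// exprn_ile1.
have bB2 := bmZ 2 bB; have bAB := bmB bA bB2.
have := EI_ge0 (bmD bAB bC) pos.
rewrite (EID bAB bC) (EIB bA bB2) (EIZ 2 bB) IA IB; lra.
Qed.

End HilbertSchmidt.

End PositiveSemidefinite.

Section CorrelationOperators.
Variables (R : realType) (X : mpsystem R) (Y : mfactor X).
Local Notation P := (mps_prob X).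
Local Notation ce := (@ce R X Y).
Local Notation Mfun := (@Mfun R X Y).
Local Notation cavg := (@cavg R).
Implicit Types p q : {poly R}.

Lemma coef_cavg N a : (cavg N)`_a = N%:R^-1 * ((0 < a) && (a <= N))%N%:R.
Proof.
rewrite /cavg coefZ coef_sum; congr (_ * _).
case: (boolP (0 < a)%N) => a0 /=; last first.
  rewrite big_nat_cond big1// => i /andP[/andP[i0 _] _].
  by rewrite coefXn; case: eqP => // ai; rewrite -ai in i0; rewrite i0 in a0.
elim: N => [|N IH]; first by rewrite big_geq// leqNgt a0.
rewrite big_nat_recr//= IH coefXn -natrD [(a <= N.+1)%N]leq_eqVlt ltnS.
by case: eqP => [->|]; rewrite ?ltnn ?addn0.
Qed.

Lemma size_cavg N : (size (cavg N) <= N.+1)%N.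
Proof.
by apply/leq_sizeP => j Nj; rewrite coef_cavg [(j <= N)%N]leqNgt Nj andbF mulr0.
Qed.

Lemma sum_cavg N n (t : nat -> R) : (N < n)%N ->
  \sum_(a < n) (cavg N)`_a * t a = N%:R^-1 * \sum_(1 <= a < N.+1) t a.
Proof.
move=> Nn; rewrite -(big_mkord xpredT (fun a => (cavg N)`_a * t a)).
rewrite (@big_cat_nat _ _ _ N.+1)//= [X in _ + X]big_nat_cond [X in _ + X]big1 ?addr0.
  rewrite big_ltn// coef_cavg mulr0 mul0r add0r mulr_sumr; apply: eq_big_nat => a /andP[a1 aN].
  by rewrite coef_cavg a1 -ltnS aN mulr1.
by move=> a /andP[/andP[Na _] _]; rewrite coef_cavg [(a <= N)%N]leqNgt Na andbF mulr0 mul0r.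
Qed.

Variable f : X -> R.
Hypothesis bf : bm P f.
Hypothesis f1 : {ae P, forall x, `|f x| <= 1}.

Let F (a : nat) : X -> R := U a%:Z f.

Let bF a : bm P (F a). Proof. exact: bmU. Qed.

Let F1 a : {ae P, forall x, `|F a x| <= 1}.
Proof. exact: (ae_U a%:Z f1). Qed.

Definition corr_op p (g : X -> R) : X -> R := hs_op Y F (fun a => p`_a) (size p) g.

Definition corr_norm2 p : X -> R := hs_norm2 Y F (fun a => p`_a) (size p).

(* [corr_op p] is the kernel operator g |-> sum_a p_a T^a f E_Y(T^a f g), and [corr a b] is the
   inner product of the kernels of T^a f and T^b f. *)
Definition corr (a b : nat) : R := EI P (fun x => ce (fun x => F a x * F b x) x ^+ 2).

Lemma bm_corr_op p g : bm P g -> bm P (corr_op p g).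
Proof. exact: bm_hs_op. Qed.

Lemma Mfun_corr_norm2 p : Mfun (corr_norm2 p).
Proof. exact: Mfun_hs_norm2. Qed.

Lemma corr_opE p n g x : (size p <= n)%N ->
  corr_op p g x = \sum_(a < n) p`_a * F a x * ce (fun x => F a x * g x) x.
Proof.
move=> pn; rewrite /corr_op /hs_op.
rewrite (big_ord_widen _ (fun a => p`_a * F a x * ce (fun x => F a x * g x) x) pn).
rewrite big_mkcond; apply: eq_bigr => i _; case: ltnP => h //.
by rewrite nth_default// !mul0r.
Qed.

Lemma corr_opB p q g x : corr_op (p - q) g x = corr_op p g x - corr_op q g x.
Proof.
pose n := maxn (size (p - q)) (maxn (size p) (size q)).
rewrite !(@corr_opE _ n)//; try by rewrite /n !leq_max leqnn ?orbT.
rewrite -sumrB; apply: eq_bigr => a _; rewrite coefB; ring.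
Qed.

Lemma pform_corrE p : pform corr p p = EI P (corr_norm2 p).
Proof.
have b a b : bm P (fun x => p`_a * p`_b * ce (fun x => F a x * F b x) x ^+ 2).
  by apply: bmZ; apply: bmX; apply: bm_ce; apply: bmM; exact: bF.
rewrite /pform /corr_norm2 /hs_norm2 EI_sum; last by move=> a; apply: bm_sum => c; exact: b.
apply: eq_bigr => a _; rewrite EI_sum; last by move=> c; exact: b.
apply: eq_bigr => c _; rewrite EIZ//.
by apply: bmX; apply: bm_ce; apply: bmM; exact: bF.
Qed.

Lemma corr_op_bound p g m : bm P g -> {ae P, forall x, `|g x| <= 1} ->
  Mfun m -> {ae P, forall x, 0 <= m x} ->
  EI P (fun x => m x * corr_op p g x ^+ 2) <= EI P (fun x => m x * corr_norm2 p x).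
Proof. exact: hs_op_bound. Qed.

Lemma corr_sym a b : corr a b = corr b a.
Proof.
rewrite /corr (_ : (fun x => F a x * F b x) = (fun x => F b x * F a x))//.
by apply/funext => x; rewrite mulrC.
Qed.

(** E_Y commutes with T, and T preserves the measure. *)
Lemma corr_shift a b : corr a.+1 b.+1 = corr a b.
Proof.
have bab : bm P (fun x => F a x * F b x) by exact: bmM.
have bc := bm_ce Y bab.
rewrite /corr -[RHS](EIU 1); last exact: bmX.
have e : (fun x => F a.+1 x * F b.+1 x) = U 1 (fun x => F a x * F b x).
  by apply/funext => x; rewrite /F /U -!mps_iterD -!PoszD !addn1.
rewrite e; apply: ae_EI.
- by apply: bmX; apply: bm_ce; exact: bmU.
- by apply: bmU; exact: bmX.
- by apply: filterS (ceU Y 1 bab) => x ->.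
Qed.

(** This is [corr_op_bound] for g = 0 and m = 1. *)
Lemma corr_psd p : 0 <= pform corr p p.
Proof.
rewrite pform_corrE.
have b0 : bm P (fun=> 0 : R) by exact: bm_cst.
have h0 : {ae P, forall x : X, `|0 : R| <= 1} by apply: aeW => x; rewrite normr0.
have h1 : {ae P, forall x : X, (0 : R) <= 1} by apply: aeW.
have := corr_op_bound p b0 h0 (Mfun_cst Y 1) h1.
rewrite (_ : (fun x => 1 * corr_norm2 p x) = corr_norm2 p); last first.
  by apply/funext => x; rewrite mul1r.
apply: le_trans; apply: EI_ge0.
  by apply: bmZ; apply: bmX; exact: bm_corr_op.
by apply: aeW => x; rewrite mul1r sqr_ge0.
Qed.

Lemma corr_cauchy (e : R) : 0 < e -> exists N0, forall N M,
  (N0 <= N)%N -> (N0 <= M)%N -> EI P (corr_norm2 (cavg N - cavg M)) <= e.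
Proof.
move=> e0; have [N0 H] := cavg_cauchy corr_sym corr_shift corr_psd e0.
by exists N0 => N M hN hM; rewrite -pform_corrE; exact: H.
Qed.

Lemma corr_op_diff p q g m : bm P g -> {ae P, forall x, `|g x| <= 1} ->
  Mfun m -> {ae P, forall x, 0 <= m x} ->
  EI P (fun x => m x * (corr_op p g x - corr_op q g x) ^+ 2) <=
  EI P (fun x => m x * corr_norm2 (p - q) x).
Proof.
move=> bg g1 hm m0; have := corr_op_bound (p - q) bg g1 hm m0.
by rewrite (_ : (fun x => _ * corr_op _ _ x ^+ 2) =
  (fun x => m x * (corr_op p g x - corr_op q g x) ^+ 2))//;
  apply/funext => x; rewrite corr_opB.
Qed.

Lemma corr_avgE N g x : corr_op (cavg N) g x =
  N%:R^-1 * \sum_(1 <= a < N.+1) F a x * ce (fun x => F a x * g x) x.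
Proof.
rewrite (corr_opE _ _ (size_cavg N)); under eq_bigr do rewrite -mulrA.
exact: (sum_cavg (fun a => F a x * ce (fun x => F a x * g x) x) (ltnSn N)).
Qed.

Lemma corr_term_bound g : bm P g -> {ae P, forall x, `|g x| <= 1} ->
  {ae P, forall x, forall a : nat, `|F a x * ce (fun x => F a x * g x) x| <= 1}.
Proof.
move=> bg g1; apply: ae_foralln => a.
have h : {ae P, forall x, `|ce (fun x => F a x * g x) x| <= 1}.
  apply: ce_bound; first exact: bmM.
  by apply: filterS2 (F1 a) g1 => x h1 h2; rewrite normrM mulr_ile1.
by apply: filterS2 (F1 a) h => x h1 h2; rewrite normrM mulr_ile1.
Qed.

(** Bounds the integral of |y| by that of y^2 with a free parameter t, in place of a square root of
    an integral. *)
Lemma norm_le_amgm (t y : R) : 0 < t -> `|y| <= t + t^-1 * y ^+ 2.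
Proof.
move=> t0; rewrite -(ler_pM2l t0) mulrDr mulrA divff ?gt_eqF// mul1r -(real_normK (num_real y)).
have := sqr_ge0 (`|y| - t); have := normr_ge0 y; nra.
Qed.

Lemma avg_bound (N : nat) (t : nat -> R) : (forall a, `|t a| <= 1) ->
  `|N%:R^-1 * \sum_(1 <= a < N.+1) t a| <= 1.
Proof.
move=> t1; case: N => [|N]; first by rewrite invr0 mul0r normr0.
rewrite normrM ger0_norm ?invr_ge0// ler_pdivrMl ?ltr0n// mulr1.
apply: (le_trans (ler_norm_sum _ _ _)).
apply: (le_trans (ler_sum _ (fun a _ => t1 a))).
by rewrite sumr_const_nat subn1.
Qed.

Lemma corr_avg_bound N g : bm P g -> {ae P, forall x, `|g x| <= 1} ->
  {ae P, forall x, `|corr_op (cavg N) g x| <= 1}.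
Proof.
move=> bg g1; apply: filterS (corr_term_bound bg g1) => x h.
rewrite corr_avgE; exact: avg_bound.
Qed.

(** T turns the summand of index a into that of index a + 1, so everything cancels except two
    boundary terms, each at most 1. *)
Lemma corr_avg_shift N g : bm P g -> {ae P, forall x, `|g x| <= 1} ->
  {ae P, forall x, `|U 1 (corr_op (cavg N) g) x - corr_op (cavg N) (U 1 g) x|
     <= 2 * N%:R^-1}.
Proof.
move=> bg g1.
have bFg a : bm P (fun x => F a x * g x) by exact: bmM.
have hU : {ae P, forall x, forall a, ce (U 1 (fun x => F a x * g x)) x =
    U 1 (ce (fun x => F a x * g x)) x}.
  by apply: ae_foralln => a; exact: ceU.
have hB := corr_term_bound (bmU 1 bg) (ae_U 1 g1).
apply: filterS2 hU hB => x eU tB.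
pose t a := F a x * ce (fun x => F a x * U 1 g x) x.
have e1 : U 1 (corr_op (cavg N) g) x = N%:R^-1 * \sum_(1 <= a < N.+1) t a.+1.
  rewrite {1}/U corr_avgE; congr (_ * _); apply: eq_bigr => a _.
  rewrite /t; congr (_ * _).
    by rewrite /F /U -mps_iterD -PoszD addn1.
  transitivity (U 1 (ce (fun x => F a x * g x)) x) => //.
  rewrite -eU; congr (ce _ x); apply/funext => z.
  by rewrite /F /U -mps_iterD -PoszD addn1.
rewrite e1 corr_avgE -/(t _) -mulrBr -sumrB.
rewrite telescope_sumr// normrM ger0_norm ?invr_ge0// mulrC ler_wpM2r ?invr_ge0//.
by apply: (le_trans (ler_normB _ _)); rewrite -[2]/(1 + 1) lerD//; exact: tB.
Qed.

Section Limit.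
Variable phi : X -> R.
Hypothesis bphi : bm P phi.
Hypothesis phi_lim : l2null P (fun N x => corr_op (cavg N) f x - phi x).

(** The approximate commutation [corr_avg_shift] propagates the limit along T in both directions;
    the rate of convergence may depend on n. *)
Lemma corr_limU n : l2null P (fun N x => corr_op (cavg N) (U n f) x - U n phi x).
Proof.
pose S n := l2null P (fun N x => corr_op (cavg N) (U n f) x - U n phi x).
have bK m N : bm P (corr_op (cavg N) (U m f)) by apply: bm_corr_op; exact: bmU.
have bS m N : bm P (fun x => corr_op (cavg N) (U m f) x - U m phi x).
  by apply: bmB => //; exact: bmU.
have f1U m : {ae P, forall x, `|U m f x| <= 1} by exact: (ae_U m f1).
have bd m N : bm P (fun x => U 1 (corr_op (cavg N) (U m f)) x - corr_op (cavg N) (U 1 (U m f)) x).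
  apply: bmB; first by apply: bmU; exact: bK.
  by rewrite UD; exact: bK.
have dnull m : l2null P (fun N x => U 1 (corr_op (cavg N) (U m f)) x - corr_op (cavg N) (U 1 (U m f)) x).
  apply: (@l2null_unif _ _ _ _ _ (fun N => 2 * N%:R^-1)) => //.
  - by move=> N; apply: corr_avg_shift => //; exact: bmU.
  - by apply: tends0Z; exact: tends0_invn.
have dnull' m := l2nullZ (-1) (bd m) (dnull m).
have SU m : S m <-> l2null P (fun N => U 1 (fun x => corr_op (cavg N) (U m f) x - U m phi x)).
  split=> H; apply: (tends0_eq H) => N.
    by rewrite -[RHS](EIU 1)//; exact: bmX.
  by rewrite -[LHS](EIU 1)//; exact: bmX.
have up m : S m -> S (1 + m).
  move=> /SU H; have := l2nullD (fun N => bmU 1 (bS m N)) (fun N => bmZ (-1) (bd m N)) H (dnull' m).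
  apply: l2null_ae.
  - by move=> N; apply: bmD; [exact: bmU|exact: bmZ].
  - by move=> N; exact: bS.
  - by move=> N; apply: aeW => x; rewrite -!UD /U; ring.
have down m : S (1 + m) -> S m.
  move=> H; apply/SU; have := l2nullD (bS (1 + m)) (bd m) H (dnull m).
  apply: l2null_ae.
  - by move=> N; apply: bmD.
  - by move=> N; apply: bmU.
  - by move=> N; apply: aeW => x; rewrite -!UD /U; ring.
elim/int_rec: n => [|n IH|n IH]; first exact: phi_lim.
  by have := up _ IH; rewrite /S -PoszD add1n.
by apply: down; rewrite (_ : 1 + _ = - n%:Z)//; lia.
Qed.

(** Letting M grow preserves a bound on K_N - K_M that does not depend on n, although the rate in
    [corr_limU] may. Arbitrarily large M suffice, as the bound will be known along a subsequence.
    The factor 2 comes from (u + v)^2 <= 2 u^2 + 2 v^2. *)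
Lemma corr_lim_dist n N m (e : R) : Mfun m -> {ae P, forall x, 0 <= m x} ->
  {ae P, forall x, m x <= 1} ->
  (forall N0, exists2 M, (N0 <= M)%N &
     EI P (fun x => m x * (corr_op (cavg N) (U n f) x - corr_op (cavg M) (U n f) x) ^+ 2) <= e) ->
  EI P (fun x => m x * (corr_op (cavg N) (U n f) x - U n phi x) ^+ 2) <= 2 * e.
Proof.
move=> hm m0 m1 H; have bm0 := Mfun_bm hm.
have bK M : bm P (corr_op (cavg M) (U n f)) by apply: bm_corr_op; exact: bmU.
have bU := bmU n bphi.
apply/ler_addgt0Pr => d d0.
have [N0 HN] := tends0Z 2 (corr_limU n) d0.
have [M /HN hM /(ler_wpM2l (ler0n R 2)) hM'] := H N0.
apply: le_trans (lerD hM' (le_trans (ler_norm _) hM)).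
have b1 := bmM bm0 (bmX 2 (bmB (bK N) (bK M))).
have b2 := bmX 2 (bmB (bK M) bU).
have b3 := bmM bm0 (bmX 2 (bmB (bK N) bU)).
rewrite -(EIZ 2 b1) -(EIZ 2 b2) -(EID (bmZ 2 b1) (bmZ 2 b2)).
apply: (EI_le b3 (bmD (bmZ 2 b1) (bmZ 2 b2))).
apply: filterS2 m0 m1 => x h0 h1.
  set a := corr_op (cavg N) _ x; set b := corr_op (cavg M) _ x; set c := U n phi x.
  have s1 := sqr_ge0 (b - c).
  have s2 : m x * (b - c) ^+ 2 <= (b - c) ^+ 2 by rewrite ler_piMl.
  have s3 : 0 <= m x * ((a - b) - (b - c)) ^+ 2 by rewrite mulr_ge0 ?sqr_ge0.
  have -> : (a - c) ^+ 2 = 2 * (a - b) ^+ 2 + 2 * (b - c) ^+ 2 - ((a - b) - (b - c)) ^+ 2.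
    by ring.
  rewrite mulrBr mulrDr !(mulrCA (m x)); lra.
Qed.

(** By the adjunction c(a, b) is the integral of F_a E_Y(F_a F_b) F_b, so that the sum over a alone
    restores the operator. *)
Lemma pform_corr_avgE N : pform corr (cavg N) (cavg N) =
  N%:R^-1 * \sum_(1 <= b < N.+1) EI P (fun x => corr_op (cavg N) (F b) x * F b x).
Proof.
rewrite (pformE _ (size_cavg N) (size_cavg N)) exchange_big /=.
under eq_bigr => b _ do under eq_bigr do rewrite mulrAC mulrC.
under eq_bigr do rewrite -mulr_sumr.
rewrite (sum_cavg (fun b => \sum_(a < N.+1) (cavg N)`_a * corr a b) (ltnSn N)); congr (_ * _).
apply: eq_bigr => b _.
have bFF a c : bm P (fun x => F a x * F c x) by exact: bmM.
have bc a c := bm_ce Y (bFF a c).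
have -> : (fun x => corr_op (cavg N) (F b) x * F b x) =
  (fun x => \sum_(a < N.+1) (cavg N)`_a * ((F a x * F b x) * ce (fun x => F a x * F b x) x)).
  apply/funext => x; rewrite (corr_opE _ _ (size_cavg N)) mulr_suml.
  by apply: eq_bigr => a _; ring.
have b2 a : bm P (fun x => (F a x * F b x) * ce (fun x => F a x * F b x) x) by exact: bmM.
rewrite EI_sum; last by move=> a; exact: (bmZ _ (b2 a)).
by apply: eq_bigr => a _; rewrite (EIZ _ (b2 a)) (ce_adj (bFF a b) (Mfun_ce Y (bFF a b))).
Qed.

(** Each inner product of K_N T^b f with T^b f is close, uniformly in b, to that of T^b phi with T^b
    f, which is 0 by invariance. *)
Lemma corr_avg_tends0 : EI P (fun x => f x * phi x) = 0 ->
  tends0 (fun N => pform corr (cavg N) (cavg N)).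
Proof.
move=> fphi e e0.
(* [norm_le_amgm] with the bound 2 t^2 below will give t + t^-1 (2 t^2) = 3 t. *)
have [t [t0 tE]] : exists t : R, 0 < t /\ 3 * t = e.
  by exists (e / 3); split; [rewrite divr_gt0|rewrite mulrCA divff ?mulr1].
have t2 : 0 < t ^+ 2 by rewrite exprn_gt0.
have [N0 HN] := corr_cauchy t2.
exists N0 => N NN; rewrite ger0_norm; last exact: corr_psd.
have dist n : EI P (fun x => (corr_op (cavg N) (U n f) x - U n phi x) ^+ 2) <= 2 * t ^+ 2.
  have h1 : {ae P, forall x : X, (1 : R) <= 1} by apply: aeW.
  have h0 : {ae P, forall x : X, (0 : R) <= 1} by apply: aeW.
  have H N1 : exists2 M, (N1 <= M)%N &
     EI P (fun x => 1 * (corr_op (cavg N) (U n f) x - corr_op (cavg M) (U n f) x) ^+ 2) <= t ^+ 2.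
    exists (maxn N0 N1); first exact: leq_maxr.
    apply: (le_trans (corr_op_diff _ _ _ _ (Mfun_cst Y 1) h0)); first exact: bmU.
      exact: (ae_U n f1).
    rewrite (_ : (fun x => 1 * corr_norm2 _ x) = corr_norm2 (cavg N - cavg (maxn N0 N1))).
      by apply: HN => //; exact: leq_maxl.
    by apply/funext => x; rewrite mul1r.
  have := corr_lim_dist (Mfun_cst Y 1) h0 h1 H.
  rewrite (_ : (fun x => 1 * _) = (fun x => (corr_op (cavg N) (U n f) x - U n phi x) ^+ 2))//.
  by apply/funext => x; rewrite mul1r.
have term b : EI P (fun x => corr_op (cavg N) (F b) x * F b x) <= e.
  have bK : bm P (corr_op (cavg N) (F b)) by apply: bm_corr_op; exact: bF.
  have bU := bmU b%:Z bphi.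
  pose w x := corr_op (cavg N) (F b) x - U b%:Z phi x.
  have bw : bm P w by exact: bmB.
  have -> : EI P (fun x => corr_op (cavg N) (F b) x * F b x) = EI P (fun x => w x * F b x).
    have -> : (fun x => corr_op (cavg N) (F b) x * F b x) =
       (fun x => w x * F b x + U b%:Z (fun x => f x * phi x) x).
      by apply/funext => x; rewrite /w /F /U; ring.
    rewrite EID; [|exact: bmM|by apply: bmU; exact: bmM].
    by rewrite EIU ?fphi ?addr0//; exact: bmM.
  apply: (@le_trans _ _ (EI P (fun x => t + t^-1 * w x ^+ 2))).
    apply: EI_le; [exact: bmM|by apply: bmD; [exact: bm_cst|apply: bmZ; exact: bmX]|].
    apply: filterS (F1 b) => x h.
    apply: (le_trans (ler_norm _)); rewrite normrM.
    apply: (@le_trans _ _ `|w x|); first by rewrite ler_piMr.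
    exact: norm_le_amgm.
  rewrite EID; [|exact: bm_cst|by apply: bmZ; exact: bmX].
  rewrite EI_cst EIZ; last exact: bmX.
  have := ler_wpM2l (ltW (_ : 0 < t^-1)) (dist b%:Z); rewrite invr_gt0 => /(_ t0).
  rewrite /w => h; apply: (le_trans (lerD (lexx t) h)).
  have -> : t^-1 * (2 * t ^+ 2) = 2 * t by field; rewrite gt_eqF.
  by rewrite -tE; lra.
rewrite pform_corr_avgE; case: N NN dist term => [|n] NN dist term; first by rewrite invr0 mul0r ltW.
rewrite ler_pdivrMl ?ltr0n//; apply: (le_trans (ler_sum _ (fun b _ => term b))).
by rewrite sumr_const_nat subn1 /= mulr_natl.
Qed.

End Limit.

Lemma corr_limit_exists : exists phi : X -> R, [/\ bm P phi,
  {ae P, forall x, `|phi x| <= 1} &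
  l2null P (fun N x => corr_op (cavg N) f x - phi x)].
Proof.
have bK N : bm P (corr_op (cavg N) f) by exact: bm_corr_op.
have [||e e0|phi [mphi phi1 H]] := @l2_complete _ _ _ P (fun N => corr_op (cavg N) f) 1.
- by move=> N; case: (bK N).
- by move=> N; exact: corr_avg_bound.
- have [N0 HN] := corr_cauchy e0; exists N0 => N M hN hM.
  apply: le_trans (HN N M hN hM).
  have h0 : {ae P, forall x : X, (0 : R) <= 1} by apply: aeW.
  have := corr_op_diff (cavg N) (cavg M) bf f1 (Mfun_cst Y 1) h0.
  rewrite (_ : (fun x => 1 * corr_norm2 _ x) = corr_norm2 (cavg N - cavg M)); last first.
    by apply/funext => x; rewrite mul1r.
  rewrite (_ : (fun x => 1 * _) = (fun x => (corr_op (cavg N) f x - corr_op (cavg M) f x) ^+ 2))//.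
  by apply/funext => x; rewrite mul1r.
- by exists phi; split => //; split => //; exists 1.
Qed.

End CorrelationOperators.

(** * Conditional almost periodicity *)

Section FactorErgodic.
Variables (R : realType) (X : mpsystem R) (Y : mfactor X).
Hypothesis Xerg : ergodic X.
Local Notation P := (mps_prob X).
Local Notation nu := (mps_prob Y).
Local Notation J := (@markov_re R X Y).

(** J sends an indicator to an idempotent, hence to a function with values 0 and 1 almost
    everywhere. This set plays the part of the preimage of B under a factor map, which need not
    exist pointwise; the threshold only separates 0 from 1. *)
Definition Jset (B : set Y) : set X := [set x | 2^-1 < J \1_B x].

Lemma measurable_Jset B : measurable B -> measurable (Jset B).
Proof. by move=> mB; apply: measurable_set_gt; apply: measurable_J; exact: bm_indic. Qed.

Lemma indic_Jset B : measurable B -> {ae P, forall x, J \1_B x = \1_(Jset B) x}.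
Proof.
move=> mB; have bB : bm nu (\1_B : Y -> R) by exact: bm_indic.
have := JM bB bB; rewrite (_ : (fun y => \1_B y * \1_B y) = \1_B :> (Y -> R)); last first.
  by apply/funext => y; rewrite indicE; case: (y \in B); rewrite ?mulr1 ?mulr0.
apply: filterS => x h.
have : J \1_B x * (1 - J \1_B x) = 0 by rewrite mulrBr mulr1 -h subrr.
move=> /eqP; rewrite mulf_eq0 subr_eq0 indicE => /orP[/eqP e|/eqP e].
  by rewrite memNset ?e// /Jset /= e ltNge invr_ge0 ler0n.
by rewrite mem_set -?e// /Jset /= -e invf_lt1 ?ltr1n.
Qed.

Lemma prob_Jset B : measurable B -> fine (P (Jset B)) = fine (nu B).
Proof.
move=> mB; have bB : bm nu (\1_B : Y -> R) by exact: bm_indic.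
rewrite -EI_indic; last exact: measurable_Jset.
rewrite -EI_indic// -J_int//; apply: ae_EI.
- by apply: bm_indic; exact: measurable_Jset.
- exact: bm_J.
- by apply: filterS (indic_Jset mB) => x ->.
Qed.

(** [Jset] carries C to a set of the same measure that contains its preimage up to a null set, and
    ergodicity of X applies to it. *)
Lemma factor_ergodic (C : set Y) : measurable C -> mps_map Y @^-1` C `<=` C ->
  fine (nu C) = 0 \/ fine (nu C) = 1.
Proof.
move=> mC CC; have bC : bm nu (\1_C : Y -> R) by exact: bm_indic.
have CU : {ae nu, forall y, U 1 (\1_C : Y -> R) y <= \1_C y}.
  apply: aeW => y; rewrite /U !indicE; case: (boolP (mps_iter 1 y \in C)) => // h.
  by rewrite mem_set//; apply: CC; move: h; rewrite inE.
have h := J_le (bmU 1 bC) bC CU.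
have neg : P.-negligible ((mps_map X @^-1` Jset C) `\` Jset C).
  have [N [mN N0 NP]] : {ae P, forall x, U 1 (J \1_C) x <= J \1_C x}.
    by apply: filterS2 h (J_U 1 bC) => x + e; rewrite e.
  exists N; split => // x [/= h1 h2]; apply: NP => /= h3; apply: h2.
  by apply: lt_le_trans h3; exact: h1.
have [e|e] := Xerg (measurable_Jset mC) neg; [left|right]; by rewrite -prob_Jset// e.
Qed.

Lemma hitting_cover (B : set Y) : measurable B -> 0 < fine (nu B) ->
  {ae nu, forall y, exists l : nat, B (mps_iter l%:Z y)}.
Proof.
move=> mB B0; pose C := \bigcup_l ((fun y : Y => mps_iter (Posz l) y) @^-1` B).
have mC : measurable C.
  by apply: bigcupT_measurable => l; exact: measurable_preimage_iter.
have CC : mps_map Y @^-1` C `<=` C.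
  move=> y [l _ /= h]; exists l.+1 => //=.
  by move: h; rewrite -iterSr.
have BC : (nu B <= nu C)%E.
  by apply: le_measure; rewrite ?inE// => y By; exists 0%N.
have [e|e] := factor_ergodic mC CC.
  move: BC; rewrite -(fine_prob mB) -(fine_prob mC) e lee_fin => /(lt_le_trans B0).
  by rewrite ltxx.
exists (~` C); split; first exact: measurableC.
  by rewrite probability_setC// -(fine_prob mC) e subee.
move=> y /= h [l _ hl]; by apply: h; exists l.
Qed.

End FactorErgodic.

(** * First hitting times *)

Section FirstHit.
Variable R : realType.

(** For an indicator g this is the indicator of the points whose orbit first meets the set at time l
    >= 0. As a polynomial in translates of g it is carried from Y to X by the multiplicative map
    J. *)
Definition first_hit (Z : mpsystem R) (g : Z -> R) (l : nat) : Z -> R :=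
  fun z => U l%:Z g z * \prod_(0 <= j < l) (1 - U j%:Z g z).

Lemma first_hit01 (Z : mpsystem R) (g : Z -> R) (l : nat) z :
  (forall z, g z = 0 \/ g z = 1) -> first_hit g l z = 0 \/ first_hit g l z = 1.
Proof.
move=> g01.
have p01 : \prod_(0 <= j < l) (1 - U j%:Z g z) = 0 \/ \prod_(0 <= j < l) (1 - U j%:Z g z) = 1.
  elim: l => [|l IH]; first by right; rewrite big_nil.
  rewrite big_nat_recr//= /U; case: (g01 (mps_iter l z)) => ->.
    by rewrite subr0 mulr1.
  by left; rewrite subrr mulr0.
rewrite /first_hit /U; case: (g01 (mps_iter l z)) => ->; first by left; rewrite mul0r.
by rewrite mul1r.
Qed.

Lemma first_hit_disj (Z : mpsystem R) (g : Z -> R) (l k : nat) z :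
  (forall z, g z = 0 \/ g z = 1) -> first_hit g l z = 1 -> l != k -> first_hit g k z = 0.
Proof.
move=> g01; wlog lk : l k / (l < k)%N => [H h lk|hl _].
  have [kl|kl|kl] := ltngtP l k; first by apply: (H l k).
    have [//|h'] := first_hit01 k z g01.
    have := H k l kl h'; rewrite eq_sym lk => /(_ isT) h0.
    by move: h; rewrite h0 => /esym/eqP; rewrite oner_eq0.
  by rewrite kl eqxx in lk.
have gl : U l%:Z g z = 1.
  case: (g01 (mps_iter l z)) => // h0.
  by move: hl; rewrite /first_hit /U h0 mul0r => /esym/eqP; rewrite oner_eq0.
rewrite /first_hit (@big_cat_nat _ _ _ l)//=; last exact: ltnW.
by rewrite [X in _ * (_ * X)]big_ltn// gl subrr mul0r mulr0 mulr0.
Qed.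

Lemma first_hit_exists (Z : mpsystem R) (g : Z -> R) z :
  (forall z, g z = 0 \/ g z = 1) -> (exists l : nat, U l%:Z g z = 1) ->
  exists l, first_hit g l z = 1.
Proof.
move=> g01 [l hl]; have ex : exists l : nat, U l%:Z g z == 1 by exists l; apply/eqP.
case: (ex_minnP ex) => k /eqP hk mink; exists k.
rewrite /first_hit hk mul1r big_nat_cond big1// => j /andP[/andP[_ jk] _].
rewrite /U; case: (g01 (mps_iter j z)) => h; first by rewrite h subr0.
by have := mink j (introT eqP h); rewrite leqNgt jk.
Qed.

Lemma bm_first_hit (Z : mpsystem R) (g : Z -> R) l :
  bm (mps_prob Z) g -> bm (mps_prob Z) (first_hit g l).
Proof.
move=> bg; apply: bmM; first exact: bmU.
by apply: bm_prod => j; apply: bmB; [exact: bm_cst|exact: bmU].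
Qed.

Lemma J_first_hit (X : mpsystem R) (Y : mfactor X) (B : set Y) l : measurable B ->
  {ae mps_prob X, forall x, markov_re (first_hit \1_B l) x = first_hit \1_(Jset B) l x}.
Proof.
move=> mB; have bB : bm (mps_prob Y) (\1_B : Y -> R) by exact: bm_indic.
have hU (j : int) : {ae mps_prob X, forall x, markov_re (U j \1_B) x = U j \1_(Jset B) x}.
  by apply: filterS2 (J_U j bB) (ae_U j (indic_Jset mB)) => x ->; rewrite /U => ->.
pose r (k : nat) : Y -> R := fun y => \prod_(0 <= j < k) (1 - U j%:Z \1_B y).
have br k : bm (mps_prob Y) (r k).
  by apply: bm_prod => j; apply: bmB; [exact: bm_cst|exact: bmU].
have hr k : {ae mps_prob X, forall x, markov_re (r k) x = \prod_(0 <= j < k) (1 - U j%:Z \1_(Jset B) x)}.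
  elim: k => [|k IH].
    rewrite (_ : r 0%N = fun=> 1); last by apply/funext => y; rewrite /r big_nil.
    by apply: filterS (J1 Y) => x ->; rewrite big_nil.
  have b1 : bm (mps_prob Y) (fun y => 1 - U k%:Z \1_B y).
    by apply: bmB; [exact: bm_cst|exact: bmU].
  rewrite (_ : r k.+1 = fun y => r k y * (1 - U k%:Z \1_B y)); last first.
    by apply/funext => y; rewrite /r big_nat_recr.
  have h1 := JM (br k) b1; have h2 := JB (bm_cst _ 1) (bmU k%:Z bB).
  have h3 := ae_and IH (hU k%:Z).
  apply: filterS3 h1 (ae_and h2 (J1 Y)) h3 => x -> [-> ->] [-> ->].
  by rewrite big_nat_recr.
by apply: filterS3 (JM (bmU l%:Z bB) (br l)) (hU l%:Z) (hr l) => x -> -> ->.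
Qed.

End FirstHit.

Section AlmostPeriodicLimit.
Variables (R : realType) (X : mpsystem R) (Y : mfactor X).
Hypothesis Xerg : ergodic X.
Local Notation P := (mps_prob X).
Local Notation nu := (mps_prob Y).
Local Notation J := (@markov_re R X Y).
Local Notation ce := (@ce R X Y).
Local Notation cE := (@cE R X Y).
Local Notation Mfun := (@Mfun R X Y).
Local Notation cavg := (@cavg R).

(** Iterates (a + b)^2 <= 2 a^2 + 2 b^2. The weights do not depend on k, so the inequality fits
    telescoping sums of any length. *)
Lemma sqr_sum_geometric (h : nat -> R) (k : nat) :
  (\sum_(0 <= j < k) h j) ^+ 2 <= \sum_(0 <= j < k) 2 ^+ j.+1 * h j ^+ 2.
Proof.
elim: k h => [|k IH] h; first by rewrite !big_nil expr0n.
rewrite !big_nat_recl// expr1.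
have := IH (fun j => h j.+1); set s := \sum_(_ <= _ < _) _; set t := \sum_(_ <= _ < _) _ => st.
have -> : \sum_(0 <= i < k) 2 ^+ i.+2 * h i.+1 ^+ 2 = 2 * t.
  by rewrite /t mulr_sumr; apply: eq_bigr => i _; rewrite mulrA -exprS.
have := sqr_ge0 (h 0%N - s); move: st; rewrite !expr2; lra.
Qed.

Variable f : X -> R.
Hypothesis bf : bm P f.
Hypothesis f1 : {ae P, forall x, `|f x| <= 1}.
Variable phi : X -> R.
Hypothesis bphi : bm P phi.
Hypothesis phi_lim : l2null P (fun N x => corr_op Y f (cavg N) f x - phi x).

Local Notation K := (corr_op Y f).
Local Notation Dn := (corr_norm2 Y f).

(** [corr_op_bound] at the zero function. *)
Lemma corr_norm2_pos p (A : set Y) : measurable A ->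
  0 <= EI P (fun x => J \1_A x * Dn p x).
Proof.
move=> mA; have bA : bm nu (\1_A : Y -> R) by exact: bm_indic.
have h0 := J_indic_ge0 mA.
have b0 : bm P (fun=> 0 : R) by exact: bm_cst.
have z : {ae P, forall x : X, `|0 : R| <= 1} by apply: aeW => x; rewrite normr0.
apply: le_trans (corr_op_bound bf p b0 z (Mfun_J bA) h0).
apply: EI_ge0; first by apply: bmM; [exact: bm_J|apply: bmX; exact: bm_corr_op].
by apply: filterS h0 => x h; rewrite mulr_ge0// sqr_ge0.
Qed.

(* A rapidly converging subsequence of the averaged correlation operators
   converges uniformly over a base set of positive measure (Egorov). *)
Lemma corr_uniform_base (e : R) : 0 < e -> exists (N : nat) (B : set Y),
  [/\ measurable B, 0 < fine (nu B) &
   forall n (A : set Y), measurable A -> A `<=` B ->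
     EI P (fun x => J \1_A x * (K (cavg N) (U n f) x - U n phi x) ^+ 2) <= e * fine (nu A)].
Proof.
move=> e0.
(* [t j] will bound the squared Hilbert-Schmidt norm of [q j] outside a set of measure at most
   [s j]. The sum of the [s j] is at most 1/2, so the good set has positive measure. The sum of the
   2^(j+1) t_j is at most e / 2, which the factor 2 of [corr_lim_dist] brings to e. *)
pose t j : R := e / 8 * (2^-1 ^+ j * 2^-1 ^+ j).
pose s j : R := 4^-1 * 2^-1 ^+ j.
have h0 j : 0 < 2^-1 ^+ j :> R by rewrite exprn_gt0// invr_gt0.
have t0 j : 0 < t j by rewrite /t !mulr_gt0.
have s0 j : 0 < s j by rewrite /s mulr_gt0// invr_gt0.
have /choice[N HN] : forall j, exists N0, forall N M, (N0 <= N)%N -> (N0 <= M)%N ->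
    EI P (Dn (cavg N - cavg M)) <= t j * s j.
  by move=> j; apply: corr_cauchy => //; exact: mulr_gt0.
pose M j := (\sum_(i < j.+1) (N i).+1)%N.
have MN j : (N j <= M j)%N by rewrite /M big_ord_recr /=; lia.
have Mj j : (j <= M j)%N.
  by elim: j => [//|j]; rewrite /M [in X in _ -> X]big_ord_recr /=; lia.
have MS j : (M j <= M j.+1)%N by rewrite /M [leqRHS]big_ord_recr /= leq_addr.
pose q j := cavg (M j) - cavg (M j.+1).
have Dq j : EI P (Dn (q j)) <= t j * s j.
  by apply: HN; [exact: MN|exact: leq_trans (MN j) (MS j)].
(* The Hilbert-Schmidt norm is a function of the factor, so Markov's inequality can be used on Y. *)
have /choice[dd dP] : forall j, exists c, bm nu c /\ {ae P, forall x, Dn (q j) x = J c x}.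
  by move=> j; have [_ h] := Mfun_corr_norm2 Y bf (q j).
have bd j : bm nu (dd j) by case: (dP j).
have IA j (A : set Y) : measurable A ->
    EI P (fun x => J \1_A x * Dn (q j) x) = EI nu (fun y => \1_A y * dd j y).
  move=> mA; have bA : bm nu (\1_A : Y -> R) by exact: bm_indic.
  have bAd : bm nu (fun y => \1_A y * dd j y) by exact: bmM.
  rewrite -(J_int bAd); apply: ae_EI.
  - by apply: bmM; [exact: bm_J|apply: (@Mfun_bm _ _ Y); exact: Mfun_corr_norm2].
  - exact: bm_J.
  - by case: (dP j) => _ h; apply: filterS2 h (JM bA (bd j)) => x -> ->.
pose Bad j := [set y | t j < dd j y].
have mBad j : measurable (Bad j) by apply: measurable_set_gt; case: (bd j).
have nuBad j : fine (nu (Bad j)) <= s j.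
  have bB : bm nu (\1_(Bad j) : Y -> R) by exact: bm_indic.
  have mC : measurable (~` Bad j) by exact: measurableC.
  have bC : bm nu (\1_(~` Bad j) : Y -> R) by exact: bm_indic.
  rewrite -(ler_pM2l (t0 j)); apply: le_trans (Dq j).
  have -> : EI P (Dn (q j)) = EI nu (dd j).
    rewrite -J_int//; apply: ae_EI; [|exact: bm_J|by case: (dP j)].
    by apply: (@Mfun_bm _ _ Y); exact: Mfun_corr_norm2.
  have -> : dd j = (fun y => \1_(Bad j) y * dd j y + \1_(~` Bad j) y * dd j y).
    apply/funext => y; rewrite !indicE in_setC; case: (y \in Bad j); rewrite /= ?mul1r ?mul0r ?addr0 ?add0r//.
  rewrite EID; [|exact: bmM|exact: bmM].
  rewrite -[X in _ <= _ + X](IA j _ mC) -[leLHS]addr0 lerD//; last exact: corr_norm2_pos.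
  rewrite -EI_indic// -EIZ//; apply: EI_le; [exact: bmZ|exact: bmM|].
  apply: aeW => y; rewrite indicE; case: (boolP (y \in Bad j)) => [|_]; last by rewrite mulr0 mul0r.
  by rewrite inE /Bad /= mulr1 mul1r => /ltW.
pose B := ~` \bigcup_j Bad j.
have mU : measurable (\bigcup_j Bad j) by exact: bigcupT_measurable.
have mB : measurable B by exact: measurableC.
have nuU : (nu (\bigcup_j Bad j) <= (2^-1)%:E)%E.
  have sub := @measure_sigma_subadditive _ _ _ nu _ _ mBad mU (@subset_refl _ _).
  apply: (le_trans sub).
  apply: lime_le; first by apply: is_cvg_nneseries => j _ _; exact: measure_ge0.
  apply: nearW => n; rewrite (eq_bigr (fun j => (fine (nu (Bad j)))%:E)); last first.
    by move=> j _; rewrite fine_prob.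
  rewrite sumEFin lee_fin; apply: (le_trans (ler_sum _ (fun j _ => nuBad j))).
  by rewrite -mulr_sumr; have := sum_half R n; lra.
have nuB : 0 < fine (nu B).
  have : (nu B = 1 - nu (\bigcup_j Bad j))%E by rewrite probability_setC.
  rewrite -(fine_prob mB) -(fine_prob mU) => -[->] /=.
  by move: nuU; rewrite -(fine_prob mU) lee_fin; lra.
exists (M 0%N), B; split => // n A mA AB.
have bA : bm nu (\1_A : Y -> R) by exact: bm_indic.
have A0 := J_indic_ge0 mA.
have A1 : {ae P, forall x, J \1_A x <= 1}.
  by apply: filterS (indic_Jset mA) => x ->; rewrite indicE; case: (_ \in _).
have bUf := bmU n bf; have Uf1 : {ae P, forall x, `|U n f x| <= 1} by exact: (ae_U n f1).
have bK p : bm P (K p (U n f)) by exact: bm_corr_op.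
have bJA := bm_J bA.
have -> : e * fine (nu A) = 2 * (e / 2 * fine (nu A)) by rewrite mulrA; congr (_ * _); lra.
apply: (corr_lim_dist bf f1 bphi phi_lim (Mfun_J bA) A0 A1) => k.
exists (M k); first exact: Mj.
have b1 j := bmM bJA (bmX 2 (bK (q j))).
apply: (@le_trans _ _ (EI P (fun x => \sum_(0 <= j < k) 2 ^+ j.+1 * (J \1_A x * K (q j) (U n f) x ^+ 2)))).
  apply: EI_le.
  - by apply: bmM => //; apply: bmX; exact: (bmB (bK _) (bK _)).
  - by apply: bm_sum => j; exact: (bmZ _ (b1 j)).
  - apply: filterS A0 => x a0.
    have -> : K (cavg (M 0%N)) (U n f) x - K (cavg (M k)) (U n f) x =
        \sum_(0 <= j < k) K (q j) (U n f) x.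
      rewrite (eq_bigr (fun j => - (K (cavg (M j.+1)) (U n f) x - K (cavg (M j)) (U n f) x))).
        by rewrite sumrN telescope_sumr// opprB.
      by move=> j _; rewrite /q corr_opB opprB.
    apply: (le_trans (ler_wpM2l a0 (sqr_sum_geometric _ k))).
    by rewrite mulr_sumr; apply: ler_sum => j _; rewrite mulrCA.
rewrite EI_sum; last by move=> j; exact: (bmZ _ (b1 j)).
have term j : EI P (fun x => 2 ^+ j.+1 * (J \1_A x * K (q j) (U n f) x ^+ 2)) <=
    (e / 4 * fine (nu A)) * 2^-1 ^+ j.
  rewrite (EIZ _ (b1 j)).
  have tj : 2 ^+ j.+1 * t j = e / 4 * 2^-1 ^+ j.
    have e1 : 2 ^+ j * 2^-1 ^+ j = 1 :> R by rewrite -exprMn divff// expr1n.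
    rewrite /t exprS (_ : _ * _ = 2 * (e / 8) * 2^-1 ^+ j * (2 ^+ j * 2^-1 ^+ j)); last by ring.
    by rewrite e1 mulr1; congr (_ * _); lra.
  rewrite mulrAC -tj -mulrA ler_wpM2l ?exprn_ge0//.
  apply: (le_trans (corr_op_bound bf (q j) bUf Uf1 (Mfun_J bA) A0)).
  rewrite IA// -EI_indic// -EIZ//; apply: EI_le; [exact: bmM|exact: bmZ|].
  apply: aeW => y; rewrite indicE; case: (boolP (y \in A)) => [|_]; last by rewrite mul0r mulr0.
  rewrite inE mul1r mulr1 => Ay; rewrite leNgt; apply/negP => h.
  by apply: (AB _ Ay); exists j.
apply: (le_trans (ler_sum _ (fun j _ => term j))); rewrite -mulr_sumr.
have nA : 0 <= fine (nu A) by rewrite fine_ge0.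
have eA : 0 <= e / 4 * fine (nu A) by rewrite mulr_ge0// divr_ge0// ltW.
apply: (le_trans (ler_wpM2l eA (sum_half R k))); lra.
Qed.

Lemma indic01 (T : Type) (B : set T) z : (\1_B z : R) = 0 \/ (\1_B z : R) = 1.
Proof. by rewrite indicE; case: (_ \in _); [right|left]. Qed.

(* The estimate over the base set is transported to almost all of [Y] along the first hitting time
   [l] of that set: on the fibres where it equals [l], translate by [l] and use the functions
   [U (l + i) f]. *)
Lemma corr_limit_ap (e : R) : 0 < e ->
  exists (N : nat) (fs : 'I_N -> X -> R) (Bl : nat -> set Y),
  [/\ forall i, bm P (fs i), forall l, measurable (Bl l),
      {ae nu, forall y, exists l, Bl l y} &
      forall n : int, exists c : 'I_N -> Y -> R,
        (forall i, bm nu (c i) /\ {ae nu, forall y, `|c i y| <= 1}) /\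
        forall l A, measurable A -> A `<=` Bl l ->
          EI P (fun x => J \1_A x * (U n phi x - \sum_(i < N) J (c i) x * fs i x) ^+ 2)
            <= e * fine (nu A)].
Proof.
move=> e0; have [N [B [mB B0 HB]]] := corr_uniform_base e0.
have bB : bm nu (\1_B : Y -> R) by exact: bm_indic.
have mB' := measurable_Jset mB.
have bB' : bm P (\1_(Jset B) : X -> R) by exact: bm_indic.
pose b l : X -> R := first_hit \1_(Jset B) l.
have bb l : bm P (b l) by exact: bm_first_hit.
have b01 l x : b l x = 0 \/ b l x = 1 by apply: first_hit01 => z; exact: indic01.
(* Where the first hit is l, this is T^(i+1) f evaluated at the hitting point. The exponent is i + 1
   because [cavg] starts at exponent 1. *)
pose g (i l : nat) : X -> R := U (l + i.+1)%:Z f.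
have bg i l : bm P (g i l) by exact: bmU.
pose s (i L : nat) (x : X) : R := \sum_(0 <= l < L) b l x * g i l x.
have bs i L : bm P (s i L) by apply: bm_sum => l; exact: bmM.
have s0 i L x : (forall l, b l x = 0) -> s i L x = 0.
  by move=> h; rewrite /s big1// => l _; rewrite h mul0r.
have s1 i L l x : b l x = 1 -> (l < L)%N -> s i L x = g i l x.
  move=> h lL; rewrite /s big_mkord (bigD1 (Ordinal lL))//= h mul1r big1 ?addr0// => j jl.
  rewrite (_ : b j x = 0) ?mul0r//; apply: (@first_hit_disj _ _ _ l) => //.
    by move=> z; exact: indic01.
  by apply: contraNneq jl => lj; apply/eqP/val_inj.
have scvg i x : cvgn (fun L => s i L x).
  have [[l hl]|h] := pselect (exists l, b l x = 1).
    apply/cvg_ex; exists (g i l x); apply: cvg_near_cst.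
    by exists l.+1 => // L /= lL; rewrite (s1 _ _ l).
  rewrite (_ : (fun L => s i L x) = fun=> 0); first exact: is_cvg_cst.
  apply/funext => L; apply: s0 => l; case: (b01 l x) => // hl.
  by exfalso; apply: h; exists l.
(* At most one summand is nonzero at each point, so the partial sums are eventually constant, and
   [fs i] inherits measurability as their limit. *)
pose fs (i : nat) (x : X) : R := limn (fun L => s i L x).
have fs1 i l x : b l x = 1 -> fs i x = g i l x.
  move=> h; apply: cvg_lim => //; apply: cvg_near_cst.
  by exists l.+1 => // L /= lL; rewrite (s1 _ _ l).
have fs0 i x : (forall l, b l x = 0) -> fs i x = 0.
  move=> h; apply: cvg_lim => //; apply: cvg_near_cst.
  by apply: nearW => L; exact: s0.
have bfs_eq i l x : b l x * fs i x = b l x * g i l x.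
  by case: (b01 l x) => h; [rewrite h !mul0r|rewrite (fs1 _ _ _ h)].
have fsb i : {ae P, forall x, `|fs i x| <= 1}.
  have : {ae P, forall x, forall l, `|g i l x| <= 1}.
    by apply: ae_foralln => l; exact: (ae_U _ f1).
  apply: filterS => x h; have [[l hl]|h'] := pselect (exists l, b l x = 1).
    by rewrite (fs1 _ _ _ hl).
  rewrite fs0 ?normr0// => l; case: (b01 l x) => // hl.
  by exfalso; apply: h'; exists l.
have bfs i : bm P (fs i).
  split; last by exists 1; exact: fsb.
  apply: (@measurable_fun_cvg _ _ _ _ (s i)) => [L|x _]; first by case: (bs i L).
  exact: scvg.
pose Bl l := [set y | 2^-1 < (first_hit \1_B l y : R)].
have y01 l y : first_hit \1_B l y = 0 :> R \/ first_hit \1_B l y = 1 :> R.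
  by apply: first_hit01 => z; exact: indic01.
have BlP l y : Bl l y -> first_hit \1_B l y = 1 :> R.
  by rewrite /Bl /=; case: (y01 l y) => ->//; rewrite ltNge invr_ge0 ler0n.
exists N, (fun i => fs i), Bl; split => //.
- by move=> l; apply: measurable_set_gt; case: (bm_first_hit l bB).
- apply: filterS (hitting_cover Xerg mB B0) => y [l hl].
  have [|k hk] := @first_hit_exists _ _ (\1_B : Y -> R) y (fun z => indic01 B z).
    by exists l; rewrite /U indicE mem_set.
  by exists k; rewrite /Bl /= hk invf_lt1 ?ltr1n.
move=> n.
have bUn := bmU n bf; have Un1 : {ae P, forall x, `|U n f x| <= 1} := ae_U n f1.
have bfsU i := bmM (bfs i) bUn.
have fsU1 i : {ae P, forall x, `|fs i x * U n f x| <= 1}.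
  by apply: filterS2 (fsb i) Un1 => x h1 h2; rewrite normrM mulr_ile1.
(* On the fibres with first hit l these are the coefficients of K_N(T^(n-l) f), read at the hitting
   point. *)
exists (fun i : 'I_N => fun y => N%:R^-1 * cE (fun x => fs i x * U n f x) y); split.
  move=> i; split; first by apply: bmZ; exact: bm_cE.
  apply: filterS (cE_bound Y (bfsU i) (fsU1 i)) => y h.
  rewrite normrM ger0_norm ?invr_ge0// mulr_ile1// ?invr_ge0//.
  have N0 : (0 < N)%N := leq_ltn_trans (leq0n i) (ltn_ord i).
  by rewrite invf_le1 ?ler1n ?ltr0n.
move=> l A mA AB.
have bA : bm nu (\1_A : Y -> R) by exact: bm_indic.
(* The image of A under the l-th power of the transformation of Y, which lies in [B]; the estimate
   over [B] is used there with n - l in place of n. *)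
pose A' := (fun y : Y => mps_iter (- l%:Z) y) @^-1` A.
have mA' : measurable A' by exact: measurable_preimage_iter.
have A'B : A' `<=` B.
  move=> y /AB/BlP; rewrite /first_hit /U -mps_iterD subrr /= => h.
  apply: contrapT => By; move: h; rewrite indicE memNset// mul0r => /esym/eqP.
  by rewrite oner_eq0.
have A'A : nu A' = nu A by exact: prob_preimage_iter.
have := HB (n - l%:Z) A' mA' A'B; rewrite A'A; apply: le_trans.
have bA' : bm nu (\1_A' : Y -> R) by exact: bm_indic.
have bK : bm P (K (cavg N) (U (n - l%:Z) f)) by apply: bm_corr_op => //; exact: bmU.
have bsum : bm P (fun x => \sum_(i < N) J (fun y => N%:R^-1 * cE (fun x => fs i x * U n f x) y) x * fs i x).
  by apply: bm_sum => i; apply: bmM => //; apply: bm_J; apply: bmZ; exact: bm_cE.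
rewrite -[leRHS](EIU l%:Z); last first.
  by apply: bmM; [exact: bm_J|apply: bmX; apply: bmB => //; exact: bmU].
rewrite le_eqVlt; apply/orP; left; apply/eqP; apply: ae_EI.
- by apply: bmM; [exact: bm_J|apply: bmX; apply: bmB => //; exact: bmU].
- by apply: bmU; apply: bmM; [exact: bm_J|apply: bmX; apply: bmB => //; exact: bmU].
have hA : {ae P, forall x, U l%:Z (J \1_A') x = J \1_A x}.
  have := J_U l%:Z bA'; rewrite (_ : U l%:Z \1_A' = \1_A :> (Y -> R)).
    by apply: filterS => x ->.
  apply/funext => y; rewrite /U !indicE; congr (_ _)%:R.
  have e1 : mps_iter (- l%:Z) (mps_iter l%:Z y) = y by rewrite -mps_iterD addNr.
  apply/idP/idP => /set_mem h; apply/mem_set; last by rewrite /A' /preimage /mkset e1.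
  by move: h; rewrite /A' /preimage /mkset e1.
have hAb : {ae P, forall x, J \1_A x = J \1_A x * b l x}.
  have := JM bA (bm_first_hit l bB).
  rewrite (_ : (fun y => \1_A y * first_hit \1_B l y) = \1_A :> (Y -> R)); last first.
    apply/funext => y; rewrite indicE; case: (boolP (y \in A)); last by rewrite mul0r.
    by rewrite inE => /AB/BlP ->; rewrite mulr1.
  by move=> h; apply: filterS2 h (J_first_hit l mB) => x + e1; rewrite e1.
have Mb l' : Mfun (b l').
  split => //; exists (first_hit \1_B l'); split; first exact: bm_first_hit.
  by apply: filterS (J_first_hit l' mB) => x ->.
(* [b l] is a function of the factor, so it enters the conditional expectation, where it allows
   [fs i] to be replaced by [g i l]. *)
have hE : {ae P, forall x, forall i, b l x * ce (fun x => fs i x * U n f x) x =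
    b l x * U l%:Z (ce (fun x => U i.+1%:Z f x * U (n - l%:Z) f x)) x}.
  apply: ae_foralln => i.
  have h1 := ce_mod (Mb l) (bfsU i).
  have h2 := ce_mod (Mb l) (bmM (bg i l) bUn).
  have h3 := ceU Y l%:Z (bmM (bmU i.+1%:Z bf) (bmU (n - l%:Z) bf)).
  apply: filterS3 h1 h2 h3 => x e1 e2 e3; rewrite -e1 -e3.
  rewrite (_ : (fun x => b l x * (fs i x * U n f x)) = (fun x => b l x * (g i l x * U n f x))).
    rewrite e2; congr (_ * _); congr (ce _ x); apply/funext => z.
    rewrite /g /U -!mps_iterD; congr (f (mps_iter _ z) * f (mps_iter _ z)); lia.
  by apply/funext => z; rewrite mulrA bfs_eq mulrA.
have hJ : {ae P, forall x, forall i : 'I_N, J (fun y => N%:R^-1 * cE (fun x => fs i x * U n f x) y) x =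
    N%:R^-1 * ce (fun x => fs i x * U n f x) x}.
  by apply: ae_forall_count => i; apply: JZ; exact: bm_cE.
apply: filterS3 (ae_and hA hAb) hE hJ => x [eA eAb] eE eJ.
under eq_bigr do rewrite eJ.
rewrite -[RHS]/(U l%:Z (J \1_A') x * (U l%:Z (K (cavg N) (U (n - l%:Z) f)) x - U l%:Z (U (n - l%:Z) phi) x) ^+ 2).
rewrite eA UD (_ : l%:Z + (n - l%:Z) = n); last by lia.
rewrite eAb; case: (b01 l x) => h; first by rewrite h mulr0 !mul0r.
rewrite h mulr1; congr (_ * _).
rewrite -sqrrN opprB; congr ((_ - _) ^+ 2).
rewrite /U corr_avgE big_add1 /= big_mkord mulr_sumr; apply: eq_bigr => i _.
have := eE i; rewrite h !mul1r => ->.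
have e2 : fs i x = U i.+1%:Z f (mps_iter l%:Z x).
  by rewrite (fs1 _ _ _ h) /g /U -mps_iterD -PoszD addnC.
by rewrite e2 -mulrA; congr (_ * _); exact: mulrC.
Qed.

End AlmostPeriodicLimit.

(** * Integrable functions of the factor *)

Section MarkovL1.
Variables (R : realType) (X : mpsystem R) (Y : mfactor X).
Local Notation P := (mps_prob X).
Local Notation nu := (mps_prob Y).
Local Notation J := (@markov_re R X Y).
Local Notation RC := (fun x : R => x%:C%C).

Lemma rL1_J (u : Y -> R) : rL1 nu u -> rL1 P (J u).
Proof. by move=> /rL1_inLp/mf_L1/inL1_Re. Qed.

Lemma J_normL1 (u : Y -> R) : rL1 nu u -> {ae P, forall x, `|J u x| <= J (fun y => `|u y|) x}.
Proof.
move=> hu; have hn := rL1_norm hu.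
have h1 : {ae P, forall x, 0 <= J (fun y => 1 * u y + `|u y|) x}.
  apply: J_ge0L1; first by apply: rL1D => //; exact: rL1Z.
  by apply: aeW => y; rewrite mul1r -lerBlDl sub0r -normrN ler_norm.
have h2 : {ae P, forall x, 0 <= J (fun y => -1 * u y + `|u y|) x}.
  apply: J_ge0L1; first by apply: rL1D => //; exact: rL1Z.
  by apply: aeW => y; rewrite mulN1r addrC subr_ge0 ler_norm.
apply: filterS3 (ae_and h1 h2) (J_linL1 1 hu hn) (J_linL1 (-1) hu hn) => x [k1 k2] e1 e2.
by move: k1 k2; rewrite e1 e2 ler_norml => k1 k2; apply/andP; split; lra.
Qed.

(* [u] is the L^1 limit of its truncations, which are bounded. *)
Lemma orth_L1 (F : X -> R) (u : Y -> R) : bm P F ->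
  (forall c, bm nu c -> EI P (fun x => F x * J c x) = 0) ->
  rL1 nu u -> EI P (fun x => F x * J u x) = 0.
Proof.
move=> bF HF hu; have mu := rL1_measurable hu.
have [mF [C FC]] := bF.
pose A n := [set y | `|u y| <= n%:R].
have mA n : measurable (A n).
  rewrite (_ : A n = [set y | - n%:R <= - `|u y|]); last first.
    by apply/seteqP; split => y /=; rewrite lerN2.
  by apply: measurable_set_ge; apply: measurable_funN; exact: measurableT_comp.
pose v n y := u y * \1_(A n) y.
have bv n : bm nu (v n).
  split; first by apply: measurable_funM => //; exact: measurable_indic.
  exists n%:R; apply: aeW => y; rewrite /v indicE; case: (boolP (y \in A n)) => h.
    by move: h; rewrite inE /A /= mulr1.
  by rewrite mulr0 normr0.
have hv n := bm_rL1 (bv n).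
have hd n : rL1 nu (fun y => u y - v n y) := rL1B hu (hv n).
have lim0 : tends0 (fun n => EI nu (fun y => `|u y - v n y|)).
  apply/cvg_tends0.
  have := @dominated_convergence _ _ _ nu setT measurableT
    (fun n y => (`|u y - v n y|)%:E) (fun=> 0%E) (fun y => (`|u y|)%:E).
  case.
  - by move=> n; exact: (measurable_int nu (rL1_norm (hd n))).
  - exact: measurable_cst.
  - apply: aeW => y _; apply: cvg_near_cst.
    exists (Num.truncn `|u y|).+1 => // n /= hn.
    rewrite /v indicE mem_set ?mulr1 ?subrr ?normr0// /A /=.
    by apply/ltW/(lt_le_trans (truncnS_gt _)); rewrite ler_nat.
  - exact: rL1_norm.
  - apply: aeW => y n _ /=; rewrite lee_fin normr_id /v indicE.
    by case: (y \in A n); rewrite ?mulr1 ?mulr0 ?subrr ?subr0 ?normr0.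
  move=> _ _; rewrite integral0 => /fine_cvg /= h.
  exact: h.
apply/eqP; rewrite -normr_le0.
apply: (tends0_cst_le0 (tends0Z `|C| lim0)) => n.
have hJ := rL1_J hu; have hJv := rL1_J (hv n); have hJd := rL1_J (hd n).
have hJn := rL1_J (rL1_norm (hd n)).
have -> : EI P (fun x => F x * J u x) = EI P (fun x => F x * J (fun y => u y - v n y) x).
  have : {ae P, forall x, J (fun y => u y - v n y) x = J u x - J (v n) x}.
    have := J_linL1 (-1) (hv n) hu; rewrite (_ : (fun y => -1 * v n y + u y) = (fun y => u y - v n y)).
      by apply: filterS => x ->; ring.
    by apply/funext => y; ring.
  move=> h; transitivity (EI P (fun x => F x * J u x - F x * J (v n) x)).
    by rewrite (rEIB (rL1_bmM bF hJ) (rL1_bmM bF hJv)) (HF _ (bv n)) subr0.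
  apply: rEI_ae; [exact: rL1B (rL1_bmM bF hJ) (rL1_bmM bF hJv)|exact: rL1_bmM bF hJd|].
  by apply: filterS h => x e; rewrite e mulrBr.
rewrite -(J_intL1 (rL1_norm (hd n))).
apply: (le_trans (le_normr_Rintegral measurableT (rL1_bmM bF hJd))).
rewrite -(rEIZ _ hJn).
apply: rEI_le; [exact: rL1_norm (rL1_bmM bF hJd)|exact: rL1Z|].
apply: filterS2 FC (J_normL1 (hd n)) => x h1 h2.
by rewrite normrM ler_pM// (le_trans h1)// ler_norm.
Qed.

Lemma op_ReIm (g : Y -> R[i]) : inLp nu 1%E g -> {ae P, forall x,
  mf_op Y g x = Complex (J (@complex.Re R \o g) x) (J (@complex.Im R \o g) x)}.
Proof.
move=> hg; have hu := inL1_Re hg; have hv := inL1_Im hg.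
have := mf_linear 'i%C (rL1_inLp hv) (rL1_inLp hu).
rewrite (_ : (fun y => _) = g); last first.
  by apply/funext => y /=; rewrite addrC -complexE.
move=> h; apply: filterS3 h (op_realL1 hu) (op_realL1 hv) => x -> -> ->.
by rewrite addrC [RHS]complexE.
Qed.

(** As F is bounded, orthogonality to the bounded functions of the factor extends to integrable ones
    by [orth_L1], applied to real and imaginary parts. *)
Lemma orth_factor_space (F : X -> R) (h : X -> R[i]) : bm P F ->
  (forall m, Mfun Y m -> EI P (fun x => F x * m x) = 0) -> factor_space Y h ->
  EI P (fun x => F x * complex.Re (h x)) = 0 /\ EI P (fun x => F x * complex.Im (h x)) = 0.
Proof.
move=> bF HF [h2 [g g2 hg]].
have h1 : inLp P 1%E h by apply: inLp_le h2; rewrite ?lee_fin ?ler1n.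
have g1 : inLp nu 1%E g by apply: inLp_le g2; rewrite ?lee_fin ?ler1n.
have HF' c : bm nu c -> EI P (fun x => F x * J c x) = 0.
  by move=> bc; apply: HF; exact: Mfun_J.
have e := op_ReIm g1; have hu := inL1_Re g1; have hv := inL1_Im g1.
rewrite -{1}(orth_L1 bF HF' hu) -(orth_L1 bF HF' hv); split; apply: rEI_ae.
- exact: rL1_bmM bF (inL1_Re h1).
- exact: rL1_bmM bF (rL1_J hu).
- by apply: filterS2 hg e => x -> ->.
- exact: rL1_bmM bF (inL1_Im h1).
- exact: rL1_bmM bF (rL1_J hv).
- by apply: filterS2 hg e => x -> ->.
Qed.

End MarkovL1.

Section CMeasurable.
Context (d : measure_display) (T : measurableType d) (R : realType).
Implicit Types f g : T -> R[i].

Lemma cmeasurableD f g : cmeasurable f -> cmeasurable g -> cmeasurable (fun x => f x + g x).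
Proof.
move=> [a b] [a' b']; split.
  by apply: (eq_ind _ _ (measurable_funD a a')); apply/funext => x; rewrite raddfD.
by apply: (eq_ind _ _ (measurable_funD b b')); apply/funext => x; rewrite raddfD.
Qed.

Lemma cmeasurableM f g : cmeasurable f -> cmeasurable g -> cmeasurable (fun x => f x * g x).
Proof.
move=> [a b] [a' b']; split.
  apply: (eq_ind _ _ (measurable_funB (measurable_funM a a') (measurable_funM b b'))).
  by apply/funext => x /=; case: (f x) (g x) => u v [u' v'].
apply: (eq_ind _ _ (measurable_funD (measurable_funM a b') (measurable_funM b a'))).
by apply/funext => x /=; case: (f x) (g x) => u v [u' v'].
Qed.

Lemma cmeasurable_cst (a : R[i]) : cmeasurable (fun _ : T => a).
Proof. by split; exact: measurable_cst. Qed.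

Lemma cmeasurableB f g : cmeasurable f -> cmeasurable g -> cmeasurable (fun x => f x - g x).
Proof.
move=> hf hg; rewrite (_ : (fun x => _) = (fun x => f x + (-1) * g x)).
  by apply: cmeasurableD => //; apply: cmeasurableM => //; exact: cmeasurable_cst.
by apply/funext => x; rewrite mulN1r.
Qed.

Lemma cmeasurable_sum (I : Type) (s : seq I) (F : I -> T -> R[i]) :
  (forall i, cmeasurable (F i)) -> cmeasurable (fun x => \sum_(i <- s) F i x).
Proof. by apply: closed_big; [exact: cmeasurable_cst|exact: cmeasurableD]. Qed.

Lemma cmeasurable_prod (I : Type) (s : seq I) (F : I -> T -> R[i]) :
  (forall i, cmeasurable (F i)) -> cmeasurable (fun x => \prod_(i <- s) F i x).
Proof. by apply: closed_big; [exact: cmeasurable_cst|exact: cmeasurableM]. Qed.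

End CMeasurable.

(** * From integral estimates to the conditional norm *)

Section ConditionalNorm.
Variables (R : realType) (X : mpsystem R) (Y : mfactor X).
Local Notation P := (mps_prob X).
Local Notation nu := (mps_prob Y).
Local Notation J := (@markov_re R X Y).
Local Notation RC := (fun x : R => x%:C%C).

Lemma cLnorm_oo_le (d : measure_display) (T : measurableType d) (Q : probability T R)
    (f : T -> R[i]) (C : R) : {ae Q, forall x, cmod (f x) <= C} -> (cLnorm Q +oo%E f <= C%:E)%E.
Proof.
move=> fC; have Q0 : (0 < Q setT)%E by rewrite probability_setT lte_fin.
rewrite /cLnorm unlock Q0; apply/ess_supP.
by apply: filterS fC => x h /=; rewrite lee_fin ger0_norm// cmod_ge0.
Qed.

(** An essential bound on the conditional second moment follows from bounds on its integrals over
    sets. Subsets of the [Bl l] suffice: being a countable cover, they meet any set of positive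
    measure in positive measure. *)
Lemma cond_norm_sup_le (F : X -> R[i]) (G : X -> R) (e : R) (Bl : nat -> set Y) :
  0 <= e -> cmeasurable F -> bm P G -> {ae P, forall x, F x = RC (G x)} ->
  (forall l, measurable (Bl l)) -> {ae nu, forall y, exists l, Bl l y} ->
  (forall l A, measurable A -> A `<=` Bl l ->
     EI P (fun x => J \1_A x * G x ^+ 2) <= e ^+ 2 * fine (nu A)) ->
  (cond_norm_sup Y F <= e%:E)%E.
Proof.
move=> e0 mF bG FG mBl cBl H.
have nu0 : (0 < nu setT)%E by rewrite probability_setT lte_fin.
rewrite /cond_norm_sup unlock nu0; apply/ess_supP.
suff : {ae nu, forall y, complex.Re (@cond_exp _ _ Y (fun x => `|F x| ^+ 2) y) <= e ^+ 2}.
  apply: filterS => y h /=; rewrite lee_fin ger0_norm ?sqrtr_ge0// /cond_norm.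
  by rewrite -[leRHS]ger0_norm// -sqrtr_sqr ler_wsqrtr.
(* If no conditional expectation exists, the default value 0 satisfies the bound. *)
rewrite /cond_exp; case: xgetP => [h _ [h1 hE]|_]; last first.
  by apply: aeW => y /=; rewrite sqr_ge0.
have mh := rL1_measurable (inL1_Re h1).
(* The part of [Bl l] where the bound fails. The hypothesis makes the integral of the excess over it
   nonpositive, so it is a null set. *)
pose A l := Bl l `&` [set y | e ^+ 2 < complex.Re (h y)].
have mA l : measurable (A l) by apply: measurableI => //; exact: measurable_set_gt.
suff H0 l : {ae nu, forall y, \1_(A l) y = 0 :> R}.
  have := ae_foralln H0 => H1; apply: filterS2 cBl H1 => y [l Bly] /(_ l).
  rewrite leNgt => /eqP Aly; apply/negP => hy; move: Aly.
  by rewrite indicE mem_set ?oner_eq0.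
have bA : bm nu (\1_(A l) : Y -> R) by exact: bm_indic.
have bJ := bm_J bA.
have hr1 : rL1 nu (fun y => \1_(A l) y * complex.Re (h y)) by exact: rL1_bmM bA (inL1_Re h1).
have mF2 : measurable_fun setT (fun x => cmod (F x) ^+ 2).
  by apply: measurable_funX; exact: cmeasurable_cmod.
have FG2 : {ae P, forall x, cmod (F x) ^+ 2 = G x ^+ 2}.
  by apply: filterS FG => x ->; rewrite cmod_real real_normK ?num_real.
have bF2 : bm P (fun x => cmod (F x) ^+ 2).
  split => //; have [_ [C GC]] := bmX 2 bG; exists C.
  by apply: filterS2 FG2 GC => x ->.
have I1 : EI nu (fun y => \1_(A l) y * complex.Re (h y)) <= e ^+ 2 * fine (nu (A l)).
  have := hE _ (bm_inLoo bA) => -[+ _].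
  rewrite (_ : (fun y => complex.Re (h y * RC (\1_(A l) y))) =
     (fun y => \1_(A l) y * complex.Re (h y))); last first.
    by apply/funext => y; case: (h y) => a b /=; rewrite mulr0 subr0 mulrC.
  rewrite (_ : (fun x => complex.Re (`|F x| ^+ 2 * mf_op Y (RC \o \1_(A l)) x)) =
     (fun x => cmod (F x) ^+ 2 * J \1_(A l) x)); last first.
    apply/funext => x; rewrite -add_Re2_Im2 -cmod_sq /markov_re.
    by case: (mf_op Y _ x) => a b /=; rewrite mul0r subr0.
  rewrite -/(EI nu _) -/(EI P _) => ->.
  apply: le_trans (H l (A l) (mA l) (@subIsetl _ _ _)).
  apply: EI_le; [exact: bmM bF2 bJ|exact: bmM bJ (bmX 2 bG)|].
  by apply: filterS FG2 => x ->; rewrite mulrC.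
pose w y := \1_(A l) y * (complex.Re (h y) - e ^+ 2).
have hw : rL1 nu w.
  by apply: rL1_bmM => //; apply: rL1B (inL1_Re h1) (bm_rL1 (bm_cst nu _)).
have w0 y : 0 <= w y.
  rewrite /w indicE; case: (boolP (y \in A l)) => [|_]; last by rewrite mul0r.
  by rewrite inE => -[_ /= /ltW]; rewrite mul1r subr_ge0.
have Iw : EI nu w <= 0.
  rewrite (_ : w = (fun y => \1_(A l) y * complex.Re (h y) - e ^+ 2 * \1_(A l) y)); last first.
    by apply/funext => y; rewrite /w; ring.
  rewrite rEIB//; last exact: bm_rL1 (bmZ _ bA).
  by rewrite EIZ// EI_indic// subr_le0.
have wz := rEI_eq0 hw (aeW _ w0) (le_anti (introT andP (conj Iw (Rintegral_ge0 _ (fun y _ => w0 y))))).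
apply: filterS wz => y; rewrite /w indicE; case: (boolP (y \in A l)) => // yA.
rewrite mul1r => /eqP; rewrite subr_eq0 => /eqP e1.
by move: yA; rewrite inE => -[_ /=]; rewrite e1 ltxx.
Qed.

Lemma L2cond_bm (phi : X -> R) : bm P phi -> L2cond Y (RC \o phi).
Proof.
move=> bphi; split; first exact: bm_inL2.
have [_ [C phiC]] := bphi.
have C0 : 0 <= `|C| by exact: normr_ge0.
apply: le_lt_trans (ltry `|C|).
apply: (@cond_norm_sup_le _ phi _ (fun=> setT)) => //.
- exact: bm_cmeasurable bphi.
- exact: aeW.
- by apply: aeW => y; exists 0%N.
move=> _ A mA _; have bA : bm nu (\1_A : Y -> R) by exact: bm_indic.
rewrite -EI_indic// -(J_int bA) -EIZ; last exact: bm_J.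
apply: EI_le; [exact: bmM (bm_J bA) (bmX 2 bphi)|exact: bmZ _ (bm_J bA)|].
apply: filterS2 phiC (indic_Jset mA) => x h ->.
rewrite [leLHS]mulrC ler_wpM2r//.
rewrite -(real_normK (num_real (phi x))) lerXn2r ?nnegrE//.
by rewrite (le_trans h)// ler_norm.
Qed.

Hypothesis Xerg : ergodic X.

Lemma corr_limit_almost_periodic (f phi : X -> R) : bm P f ->
  {ae P, forall x, `|f x| <= 1} -> bm P phi ->
  l2null P (fun N x => corr_op Y f (@cavg R N) f x - phi x) ->
  cond_almost_periodic Y (RC \o phi).
Proof.
move=> bf f1 bphi lphi; split; first exact: L2cond_bm.
move=> e e0; have e2 : 0 < e / 2 by rewrite divr_gt0.
have e3 : 0 < (e / 2) ^+ 2 by rewrite exprn_gt0.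
have [N [fs [Bl [bfs mBl cBl H]]]] := corr_limit_ap Xerg bf f1 bphi lphi e3.
exists N, (fun i => RC \o fs i); split; first by move=> i; exact: L2cond_bm.
move=> n; have [c [bc Hc]] := H n.
have bc' i : bm nu (c i) by case: (bc i).
exists (fun i => RC \o c i); split.
  move=> i; split; first exact: bm_inLoo.
  by apply: cLnorm_oo_le; case: (bc i) => _; apply: filterS => y /=; rewrite cmod_real.
apply: (@le_lt_trans _ _ (e / 2)%:E); last by rewrite lte_fin; lra.
have bU := bmU n bphi.
have bS : bm P (fun x => \sum_(i < N) J (c i) x * fs i x).
  by apply: bm_sum => i; apply: bmM => //; exact: bm_J.
apply: (@cond_norm_sup_le _ (fun x => U n phi x - \sum_(i < N) J (c i) x * fs i x) _ Bl) => //.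
- exact: ltW.
- apply: cmeasurableB; first exact: bm_cmeasurable bU.
  apply: cmeasurable_sum => i; apply: cmeasurableM; last exact: bm_cmeasurable (bfs i).
  by have [] := mf_L1 (bm_inL1 (bc' i)).
- exact: bmB.
- have : {ae P, forall x, forall i, mf_op Y (RC \o c i) x = RC (J (c i) x)}.
    by apply: ae_forall_count => i; exact: op_real.
  apply: filterS => x hx; rewrite rmorphB rmorph_sum; congr (_ - _).
  by apply: eq_bigr => i _; rewrite hx rmorphM.
Qed.

Lemma cLnorm0 (d : measure_display) (T : measurableType d) (Q : probability T R) :
  cLnorm Q 2%:E (fun=> 0 : R[i]) = 0%E.
Proof.
rewrite /cLnorm (_ : EFin \o (@cmod R \o (fun=> 0)) = cst 0%E); first by rewrite Lnorm0.
by apply/funext => x /=; rewrite (_ : 0 = RC 0)// cmod_real normr0.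
Qed.

Lemma sub_L2_closure (A : set (X -> R[i])) f : A f -> inLp P 2%:E f -> L2_closure P A f.
Proof.
move=> Af hf; split => // e e0; exists f => //.
by rewrite (_ : (fun x => _) = fun=> 0) ?cLnorm0 ?lte_fin//; apply/funext => x; rewrite subrr.
Qed.

(* One half of the Furstenberg-Zimmer dichotomy: [f] is conditionally weakly mixing. *)
Lemma corr_tends0_of_orth (D : mfactor X) (f : X -> R) :
  induces D (L2_closure P (cond_almost_periodic Y)) -> bm P f ->
  {ae P, forall x, `|f x| <= 1} ->
  (forall m, Mfun D m -> EI P (fun x => f x * m x) = 0) ->
  tends0 (fun N => pform (corr Y f) (@cavg R N) (@cavg R N)).
Proof.
move=> DA bf f1 fD.
have [phi [bphi phi1 lphi]] := corr_limit_exists Y bf f1.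
have hphi : factor_space D (RC \o phi).
  rewrite -DA; apply: sub_L2_closure; last exact: bm_inL2.
  exact: corr_limit_almost_periodic bf f1 bphi lphi.
have [h _] := orth_factor_space bf fD hphi.
exact: (corr_avg_tends0 (Y := Y) bf f1 bphi lphi h).
Qed.

End ConditionalNorm.

(** * Multiple averages of real functions *)

Section AverageLemmas.
Variable R : realType.

(** Jensen's inequality, from the nonnegative variance; for N = 0 both sides are 0. *)
Lemma sq_avg_le (N : nat) (t : nat -> R) :
  (N%:R^-1 * \sum_(1 <= n < N.+1) t n) ^+ 2 <= N%:R^-1 * \sum_(1 <= n < N.+1) t n ^+ 2.
Proof.
case: N => [|N]; first by rewrite invr0 !mul0r expr0n.
set n := N.+1; have n0 : 0 < n%:R :> R by rewrite ltr0n.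
set s := \sum_(_ <= _ < _) t _; set q := \sum_(_ <= _ < _) _.
have : 0 <= \sum_(1 <= i < n.+1) (t i - n%:R^-1 * s) ^+ 2.
  by apply: sumr_ge0 => i _; exact: sqr_ge0.
have -> : \sum_(1 <= i < n.+1) (t i - n%:R^-1 * s) ^+ 2 =
    q - 2 * (n%:R^-1 * s) * s + n%:R * (n%:R^-1 * s) ^+ 2.
  rewrite (eq_bigr (fun i => t i ^+ 2 + ((- 2 * (n%:R^-1 * s)) * t i + (n%:R^-1 * s) ^+ 2))).
    rewrite !big_split /= -mulr_sumr -/s -/q sumr_const_nat subn1 /= -mulr_natl; ring.
  by move=> i _; ring.
have -> : n%:R * (n%:R^-1 * s) ^+ 2 = (n%:R^-1 * s) * s by field; rewrite gt_eqF.
move=> h; rewrite expr2 -mulrA ler_pM2l ?invr_gt0//; lra.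
Qed.

Lemma sum_multiples_le (phi : nat -> R) (j H : nat) : (0 < j)%N -> (forall a, 0 <= phi a) ->
  \sum_(1 <= h < H.+1) phi (j * h)%N <= \sum_(1 <= a < (j * H).+1) phi a.
Proof.
move=> j0 phi0; elim: H => [|H IH]; first by rewrite muln0 !big_geq.
have [l jl] : exists l, (j * H.+1 = (j * H + l).+1)%N.
  by exists j.-1; rewrite mulnS; lia.
rewrite big_nat_recr//= jl [leRHS]big_nat_recr//=; apply: lerD => //.
have -> : (j * H + l).+1 = ((j * H).+1 + l)%N by lia.
elim: l {jl} => [|l IHl]; first by rewrite addn0.
by apply: (le_trans IHl); rewrite addnS [leRHS]big_nat_recr//= lerDl.
Qed.

End AverageLemmas.

(** * Van der Corput's inequality *)

Section VanDerCorput.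
Context (d : measure_display) (T : measurableType d) (R : realType).
Variable P : probability T R.

Lemma tends0_EI (F : T -> R) (u : nat -> T -> R) : bm P F -> {ae P, forall x, `|F x| <= 1} ->
  (forall N, bm P (u N)) -> l2null P u -> tends0 (fun N => EI P (fun x => F x * u N x)).
Proof.
move=> bF F1 bu u0 e e0; have e2 : 0 < e ^+ 2 by rewrite exprn_gt0.
have [N0 HN] := u0 _ e2; exists N0 => N /HN h.
have bFu := bmM bF (bu N).
rewrite -(ler_pXn2r (n := 2))// ?nnegrE ?(ltW e0)// real_normK ?num_real//.
apply: (le_trans (EI_sq_le bFu)); apply: le_trans (le_trans (ler_norm _) h).
apply: EI_le; [exact: bmX|exact: bmX|].
apply: filterS F1 => x k; rewrite exprMn ler_piMl ?sqr_ge0//.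
by rewrite -real_normK ?num_real// exprn_ile1.
Qed.

(** The average is replaced by that of the means of H consecutive translates, at a cost of order H /
    N, and Jensen's inequality is applied to the outer average. Keeping both shifts h and h' matches
    the double sums of [pform]. *)
Lemma van_der_corput (u : nat -> T -> R) : (forall n, bm P (u n)) ->
  (forall n, {ae P, forall x, `|u n x| <= 1}) ->
  (forall e : R, 0 < e -> exists (H : nat) (g : nat -> nat -> R), [/\ (0 < H)%N,
     H%:R^-1 * (H%:R^-1 * \sum_(1 <= h < H.+1) \sum_(1 <= h' < H.+1) g h h') <= e &
     forall h h', exists b, tends0 b /\ forall N,
       EI P (fun x => N%:R^-1 * \sum_(1 <= n < N.+1) u (n + h)%N x * u (n + h')%N x)
         <= g h h' + b N]) ->
  l2null P (fun N x => N%:R^-1 * \sum_(1 <= n < N.+1) u n x).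
Proof.
move=> bu u1 hyp; apply: tends0_approx => e e0.
have e2 : 0 < e / 2 by rewrite divr_gt0.
have [H [g [H0 gH hb]]] := hyp _ e2.
have {}hb : forall h, exists b : nat -> nat -> R, forall h', tends0 (b h') /\ forall N,
    EI P (fun x => N%:R^-1 * \sum_(1 <= n < N.+1) u (n + h)%N x * u (n + h')%N x)
         <= g h h' + b h' N.
  by move=> h; have /choice[b hb'] := hb h; exists b.
have /choice[b bP] := hb.
pose A N x := N%:R^-1 * \sum_(1 <= n < N.+1) u n x.
pose B N x := N%:R^-1 * \sum_(1 <= n < N.+1) (H%:R^-1 * \sum_(1 <= h < H.+1) u (n + h)%N x).
have bA N : bm P (A N) by apply: bmZ; exact: bm_sum.
have bB N : bm P (B N) by apply: bmZ; apply: bm_sum => n; apply: bmZ; exact: bm_sum.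
have Hn0 : 0 < H%:R :> R by rewrite ltr0n.
have u1' : {ae P, forall x, forall n, `|u n x| <= 1} by exact: ae_foralln.
have dAB N : {ae P, forall x, `|A N x - B N x| <= 2 * H%:R * N%:R^-1}.
  apply: filterS u1' => x ux.
  (* Each shift of the summation range by one exchanges a single term for another, both at most 1 in
     modulus. *)
  have sh h : `|\sum_(1 <= n < N.+1) u n x - \sum_(1 <= n < N.+1) u (n + h)%N x| <= 2 * h%:R.
    elim: h => [|h IH].
      by under [X in _ - X]eq_bigr do rewrite addn0; rewrite subrr normr0 mulr0.
    have st : \sum_(1 <= n < N.+1) u (n + h)%N x - \sum_(1 <= n < N.+1) u (n + h.+1)%N x =
        u (1 + h)%N x - u (N.+1 + h)%N x.
      rewrite -sumrB -opprB -(telescope_sumr (fun n => u (n + h)%N x))// -sumrN.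
      by apply: eq_bigr => n _; rewrite opprB addnS addSn.
    rewrite -(subrK (\sum_(1 <= n < N.+1) u (n + h)%N x) (\sum_(1 <= n < N.+1) u n x)) -addrA st.
    apply: (le_trans (ler_normD _ _)).
    have -> : 2 * h.+1%:R = 2 * h%:R + 2 :> R by rewrite -[h.+1]addn1 natrD mulrDr mulr1.
    rewrite lerD//; apply: (le_trans (ler_normB _ _)).
    by rewrite -[2]/(1 + 1) lerD.
  have -> : A N x - B N x = N%:R^-1 * (H%:R^-1 * \sum_(1 <= h < H.+1)
      (\sum_(1 <= n < N.+1) u n x - \sum_(1 <= n < N.+1) u (n + h)%N x)).
    rewrite /A /B -mulrBr; congr (_ * _); rewrite sumrB sumr_const_nat subn1 /= mulrBr.
    rewrite -(mulr_natl (\sum_(1 <= n < N.+1) u n x) H) mulKf ?gt_eqF//; congr (_ - _).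
    by rewrite -mulr_sumr exchange_big.
  rewrite normrM ger0_norm ?invr_ge0// mulrC ler_wpM2r ?invr_ge0//.
  rewrite normrM ger0_norm ?invr_ge0// ler_pdivrMl//.
  apply: (le_trans (ler_norm_sum _ _ _)).
  apply: (@le_trans _ _ (\sum_(1 <= h < H.+1) 2 * H%:R)).
    apply: ler_sum_nat => h /andP[_ hH]; apply: (le_trans (sh h)).
    by rewrite ler_wpM2l// ler_nat -ltnS.
  by rewrite sumr_const_nat subn1 /= -(mulr_natl (2 * H%:R) H).
have nAB : l2null P (fun N x => A N x - B N x).
  apply: (@l2null_unif _ _ _ P _ (fun N => 2 * H%:R * N%:R^-1)) => //.
    by move=> N; exact: bmB.
  by apply: tends0Z; exact: tends0_invn.
pose S N : R := H%:R^-1 * (H%:R^-1 * \sum_(1 <= h < H.+1) \sum_(1 <= h' < H.+1) b h h' N).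
have S0 : tends0 S.
  by do 2 apply: tends0Z; apply: tends0_sum => h; apply: tends0_sum => h'; case: (bP h h').
have IB N : EI P (fun x => B N x ^+ 2) <= e / 2 + S N.
  pose w h h' x := N%:R^-1 * \sum_(1 <= n < N.+1) u (n + h)%N x * u (n + h')%N x.
  have bw h h' : bm P (w h h') by apply: bmZ; apply: bm_sum => n; exact: bmM.
  have bW : bm P (fun x => H%:R^-1 * (H%:R^-1 * \sum_(1 <= h < H.+1) \sum_(1 <= h' < H.+1) w h h' x)).
    by do 2 apply: bmZ; apply: bm_sum => h; exact: bm_sum.
  apply: (@le_trans _ _ (EI P (fun x => H%:R^-1 * (H%:R^-1 *
      \sum_(1 <= h < H.+1) \sum_(1 <= h' < H.+1) w h h' x)))).
    apply: EI_le => //; first exact: bmX.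
    apply: aeW => x; apply: (le_trans (sq_avg_le _ _)).
    rewrite le_eqVlt; apply/orP; left; apply/eqP.
    have -> : \sum_(1 <= h < H.+1) \sum_(1 <= h' < H.+1) w h h' x =
        N%:R^-1 * \sum_(1 <= n < N.+1) (\sum_(1 <= h < H.+1) u (n + h)%N x) ^+ 2.
      rewrite /w; under eq_bigr do rewrite -mulr_sumr.
      rewrite -mulr_sumr; congr (_ * _).
      rewrite [RHS](eq_bigr (fun n => \sum_(1 <= h < H.+1) \sum_(1 <= h' < H.+1) u (n + h)%N x * u (n + h')%N x)).
        rewrite [RHS]exchange_big; apply: eq_bigr => h _; rewrite exchange_big; exact: eq_bigr.
      by move=> n _; rewrite expr2 mulr_suml; apply: eq_bigr => h _; rewrite mulr_sumr.
    rewrite (mulrCA H%:R^-1 N%:R^-1) [RHS]mulrCA; congr (_ * _).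
    rewrite 2!mulr_sumr; apply: eq_bigr => n _; rewrite exprMn; ring.
  rewrite EIZ; last by apply: bmZ; apply: bm_sum => h; exact: bm_sum.
  rewrite EIZ; last by apply: bm_sum => h; exact: bm_sum.
  rewrite EI_sum; last by move=> h; exact: bm_sum.
  apply: le_trans (lerD gH (lexx (S N))).
  rewrite /S -!mulrDr ler_wpM2l ?invr_ge0// ler_wpM2l ?invr_ge0//.
  rewrite -big_split; apply: ler_sum => h _; rewrite EI_sum// -big_split.
  by apply: ler_sum => h' _; case: (bP h h') => _; exact.
exists (fun N => 2 * S N + 2 * EI P (fun x => (A N x - B N x) ^+ 2)); split.
  by apply: tends0D; apply: tends0Z.
exists 0%N => N _; rewrite ger0_norm; last exact: (EI_sqr_ge0 (bA N)).
have b2 := bmX 2 (bB N); have b3 := bmX 2 (bmB (bA N) (bB N)).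
apply: (@le_trans _ _ (2 * EI P (fun x => B N x ^+ 2) + 2 * EI P (fun x => (A N x - B N x) ^+ 2))); last first.
  by have := IB N; lra.
rewrite -(EIZ 2 b2) -(EIZ 2 b3) -(EID (bmZ 2 b2) (bmZ 2 b3)).
apply: (EI_le (bmX 2 (bA N)) (bmD (bmZ 2 b2) (bmZ 2 b3))).
apply: aeW => x; have := sqr_ge0 (A N x - B N x - B N x); rewrite /A; nra.
Qed.

End VanDerCorput.

Section RealAverages.
Variables (R : realType) (X : mpsystem R).
Local Notation P := (mps_prob X).

Definition ravg (k : nat) (f : 'I_k -> X -> R) (N : nat) : X -> R := fun x =>
  N%:R^-1 * \sum_(1 <= n < N.+1) \prod_(i < k) U (i.+1 * n)%N%:Z (f i) x.

Lemma bm_ravg k (f : 'I_k -> X -> R) N : (forall i, bm P (f i)) -> bm P (ravg f N).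
Proof. by move=> bf; apply: bmZ; apply: bm_sum => n; apply: bm_prod => i; exact: bmU. Qed.

Lemma ravgZ k (f : 'I_k -> X -> R) (C : R) N x :
  ravg (fun i x => C * f i x) N x = C ^+ k * ravg f N x.
Proof.
rewrite /ravg mulrCA; congr (_ * _); rewrite mulr_sumr; apply: eq_bigr => n _.
by rewrite /U big_split /= prodr_const card_ord.
Qed.

Lemma ravgB k (f g : 'I_k -> X -> R) (t : 'I_k) N x : (forall i, i != t -> f i = g i) ->
  ravg f N x - ravg g N x = ravg (fun i => if i == t then (fun x => f i x - g i x) else f i) N x.
Proof.
move=> fg; rewrite /ravg -mulrBr -sumrB; congr (_ * _); apply: eq_bigr => n _.
rewrite (bigD1 t)//= [X in _ - X](bigD1 t)//= [RHS](bigD1 t)//= eqxx.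
rewrite [X in _ - _ * X](eq_bigr (fun i : 'I_k => U (i.+1 * n)%N (f i) x)); last first.
  by move=> i it; rewrite fg.
rewrite [X in _ = _ * X](eq_bigr (fun i : 'I_k => U (i.+1 * n)%N (f i) x)); last first.
  by move=> i /negbTE ->.
by rewrite /U mulrBl.
Qed.

(** Vanishing as soon as one function, in any position, is orthogonal to the factor: the form that
    suits van der Corput. [characteristic_replace] derives from it the comparison of averages. *)
Definition characteristic (D : mfactor X) (k : nat) : Prop :=
  forall (f : 'I_k -> X -> R) (j : 'I_k), (forall i, bm P (f i)) ->
    (forall m, Mfun D m -> EI P (fun x => f j x * m x) = 0) -> l2null P (ravg f).

(** The average is homogeneous of degree k, so all functions may be divided by a common bound. *)
Lemma characteristic_scale (D : mfactor X) k :
  (forall (f : 'I_k -> X -> R) (j : 'I_k), (forall i, bm P (f i)) ->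
    (forall i, {ae P, forall x, `|f i x| <= 1}) ->
    (forall m, Mfun D m -> EI P (fun x => f j x * m x) = 0) -> l2null P (ravg f)) ->
  characteristic D k.
Proof.
move=> H f j bf fj.
have /choice[c cP] : forall i, exists C : R, {ae P, forall x, `|f i x| <= C}.
  by move=> i; case: (bf i).
pose C : R := 1 + \sum_i `|c i|.
have C0 : 0 < C by rewrite ltr_pwDl// sumr_ge0.
have cC i : c i <= C.
  apply: (le_trans (ler_norm _)); rewrite /C (bigD1 i)//= addrCA lerDl.
  by rewrite addr_ge0// sumr_ge0.
have nul : l2null P (ravg (fun i x => C^-1 * f i x)).
  apply: (H _ j) => [i|i|m hm]; first exact: bmZ.
    apply: filterS (cP i) => x h; rewrite normrM ger0_norm ?invr_ge0 ?(ltW C0)//.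
    by rewrite ler_pdivrMl// mulr1 (le_trans h).
  rewrite (_ : (fun x => _) = (fun x => C^-1 * (f j x * m x))); last by apply/funext => x; ring.
  by rewrite EIZ ?fj ?mulr0//; apply: bmM => //; exact: Mfun_bm hm.
have bg N : bm P (ravg (fun i x => C^-1 * f i x) N) by apply: bm_ravg => i; exact: bmZ.
apply: l2null_ae (l2nullZ (C ^+ k) bg nul) => N; first exact: bmZ.
  exact: bm_ravg.
apply: aeW => x; rewrite ravgZ mulrA -exprMn divff ?gt_eqF// expr1n mul1r//.
Qed.

Lemma characteristic_replace (D : mfactor X) k (f g : 'I_k -> X -> R) :
  characteristic D k -> (forall i, bm P (f i)) -> (forall i, bm P (g i)) ->
  (forall i m, Mfun D m -> EI P (fun x => (f i x - g i x) * m x) = 0) ->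
  l2null P (fun N x => ravg f N x - ravg g N x).
Proof.
move=> chD bf bg fg.
(* By multilinearity the functions are exchanged one at a time: [H t] has g in the positions below
   t. *)
pose H (t : nat) (i : 'I_k) : X -> R := if (i < t)%N then g i else f i.
have bH t i : bm P (H t i) by rewrite /H; case: ifP.
have step (t : 'I_k) : l2null P (fun N x => ravg (H t) N x - ravg (H t.+1) N x).
  pose K (i : 'I_k) : X -> R := if i == t then (fun x => H t i x - H t.+1 i x) else H t i.
  have bK i : bm P (K i) by rewrite /K; case: ifP => _ //; exact: bmB.
  have : l2null P (ravg K).
    apply: (chD K t bK) => m hm; rewrite /K eqxx /H ltnn ltnSn; exact: fg.
  apply: l2null_ae => N; [exact: bm_ravg|by apply: bmB; exact: bm_ravg|].
  apply: aeW => x; rewrite (ravgB (t := t))// => i it.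
  by rewrite /H ltnS [in RHS]leq_eqVlt (_ : (_ == _ :> nat) = false)//; apply/negbTE.
have := l2null_sum (index_enum 'I_k) (fun t N => bmB (bm_ravg N (bH t)) (bm_ravg N (bH t.+1))) step.
apply: l2null_ae => N.
- by apply: bm_sum => t; apply: bmB; exact: bm_ravg.
- by apply: bmB; exact: bm_ravg.
apply: aeW => x.
rewrite -(big_mkord xpredT (fun t => ravg (H t) N x - ravg (H t.+1) N x)).
rewrite (eq_bigr (fun t => - (ravg (H t.+1) N x - ravg (H t) N x))); last by move=> t _; rewrite opprB.
rewrite sumrN telescope_sumr// opprB.
by congr (ravg _ N x - ravg _ N x); apply/funext => i; rewrite /H // ltn_ord.
Qed.

End RealAverages.

(** * Mean ergodic theorem and induction on the order *)

Section MeanErgodic.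
Variables (R : realType) (X : mpsystem R).
Hypothesis Xerg : ergodic X.
Local Notation P := (mps_prob X).
Local Notation cavg := (@cavg R).

Lemma pform_cavg (c : nat -> nat -> R) N : pform c (cavg N) (cavg N) =
  N%:R^-1 * (N%:R^-1 * \sum_(1 <= a < N.+1) \sum_(1 <= b < N.+1) c a b).
Proof.
rewrite (pformE _ (size_cavg _ N) (size_cavg _ N)).
under eq_bigr do under eq_bigr do rewrite -mulrA.
under eq_bigr do rewrite -mulr_sumr (sum_cavg _ (ltnSn N)).
by rewrite (sum_cavg (fun a => N%:R^-1 * \sum_(1 <= b < N.+1) c a b) (ltnSn N)) -mulr_sumr.
Qed.

(* Only the exponents [l * h] of f_l occur in the van der Corput differences; as [c] is
   nonnegative, they may be completed to all exponents. *)
Lemma pform_cavg_multiples (c : nat -> nat -> R) (l H : nat) :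
  (0 < l)%N -> (0 < H)%N -> (forall a b, 0 <= c a b) ->
  H%:R^-1 * (H%:R^-1 * \sum_(1 <= h < H.+1) \sum_(1 <= h' < H.+1) c (l * h)%N (l * h')%N) <=
  l%:R ^+ 2 * pform c (cavg (l * H)) (cavg (l * H)).
Proof.
move=> l0 H0 c0; have Hp : 0 < H%:R :> R by rewrite ltr0n.
have lp : 0 < l%:R :> R by rewrite ltr0n.
rewrite pform_cavg; set S' := \sum_(1 <= _ < (l * H).+1) _.
have -> : l%:R ^+ 2 * ((l * H)%:R^-1 * ((l * H)%:R^-1 * S')) = H%:R^-1 * (H%:R^-1 * S').
  by rewrite natrM; field; rewrite !gt_eqF.
do 2 rewrite ler_pM2l ?invr_gt0//.
have p1 a : 0 <= \sum_(1 <= b < (l * H).+1) c a b by exact: sumr_ge0.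
apply: le_trans (sum_multiples_le H l0 p1).
by apply: ler_sum => h _; exact: sum_multiples_le H l0 (c0 (l * h)%N).
Qed.

Lemma pform_U (f : X -> R) (p : {poly R}) n : bm P f -> (size p <= n)%N ->
  pform (fun a b => EI P (fun x => U a%:Z f x * U b%:Z f x)) p p =
  EI P (fun x => (\sum_(a < n) p`_a * U a%:Z f x) ^+ 2).
Proof.
move=> bf pn; rewrite (pformE _ pn pn).
have b2 a b : bm P (fun x => U a f x * U b f x) by apply: bmM; exact: bmU.
have -> : (fun x => (\sum_(a < n) p`_a * U a f x) ^+ 2) =
    (fun x => \sum_(a < n) \sum_(b < n) p`_a * p`_b * (U a f x * U b f x)).
  apply/funext => x; rewrite expr2 mulr_suml; apply: eq_bigr => a _.
  by rewrite mulr_sumr; apply: eq_bigr => b _; ring.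
rewrite EI_sum; last by move=> a; apply: bm_sum => b; exact: bmZ.
apply: eq_bigr => a _; rewrite EI_sum; last by move=> b; exact: bmZ.
by apply: eq_bigr => b _; rewrite EIZ.
Qed.

(** The set where phi > 0 has measure 0 or 1, so phi has a constant sign, and a function of constant
    sign with integral 0 vanishes. *)
Lemma ergodic_ae_eq0 (phi : X -> R) : bm P phi -> {ae P, forall x, U 1 phi x = phi x} ->
  EI P phi = 0 -> {ae P, forall x, phi x = 0}.
Proof.
move=> bphi inv I0; pose C : set X := [set x | 0 < phi x].
have mC : measurable C.
  rewrite (_ : C = setT `&` phi @^-1` `]0, +oo[%classic); last first.
    by apply/seteqP; split => x /=; rewrite in_itv/= andbT; [move=> ?; split|case].
  by case: bphi => mphi _; apply: mphi.
have neg : P.-negligible ((mps_map X @^-1` C) `\` C).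
  case: inv => N [mN N0 NP]; exists N; split => // x [/= h1 h2]; apply: NP => /= h3.
  by apply: h2; rewrite /C /= -h3.
have [C0|C1] := Xerg mC neg.
  have le0 : {ae P, forall x, phi x <= 0}.
    by exists C; split => // x /= /negP; rewrite -ltNge.
  have ge0 : {ae P, forall x, 0 <= - phi x} by apply: filterS le0 => x; rewrite oppr_ge0.
  have IN : EI P (fun x => - phi x) = 0.
    rewrite (_ : (fun x => - phi x) = (fun x => -1 * phi x)) ?EIZ ?I0 ?mulr0//.
    by apply/funext => x; rewrite mulN1r.
  apply: filterS (EI_eq0 (bmN bphi) ge0 IN) => x /eqP.
  by rewrite oppr_eq0 => /eqP.
apply: EI_eq0 => //; exists (~` C); split; first exact: measurableC.
  by rewrite probability_setC// C1 subee.
by move=> x /= h1 h2; apply: h1; exact: ltW.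
Qed.

(** [cavg_cauchy] applies to the inner products of T^a f and T^b f. The limit of the averages is
    invariant with integral 0, hence 0 by ergodicity. *)
Lemma mean_ergodic (f : X -> R) : bm P f -> {ae P, forall x, `|f x| <= 1} -> EI P f = 0 ->
  l2null P (fun N x => N%:R^-1 * \sum_(1 <= n < N.+1) U n%:Z f x).
Proof.
move=> bf f1 I0; pose A N x := N%:R^-1 * \sum_(1 <= n < N.+1) U n%:Z f x.
pose c a b := EI P (fun x => U a%:Z f x * U b%:Z f x).
have bA N : bm P (A N) by apply: bmZ; apply: bm_sum => n; exact: bmU.
have Uf1 : {ae P, forall x, forall n : nat, `|U n%:Z f x| <= 1}.
  by apply: ae_foralln => n; exact: (ae_U n%:Z f1).
have A1 N : {ae P, forall x, `|A N x| <= 1}.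
  by apply: filterS Uf1 => x h; apply: (avg_bound N (t := fun n => U n%:Z f x)).
have c_sym a b : c a b = c b a by congr (EI P _); apply/funext => x; rewrite mulrC.
have c_shift a b : c a.+1 b.+1 = c a b.
  rewrite /c -(EIU 1 (bmM (bmU a%:Z bf) (bmU b%:Z bf))); congr (EI P _); apply/funext => x.
  by rewrite /U -!mps_iterD -![in RHS]PoszD !addn1.
have c_psd p : 0 <= pform c p p.
  rewrite (pform_U bf (leqnn _)); apply: EI_sqr_ge0.
  by apply: bm_sum => a; apply: bmZ; exact: bmU.
have cau (e : R) : 0 < e -> exists N0, forall N M, (N0 <= N)%N -> (N0 <= M)%N ->
    EI P (fun x => (A N x - A M x) ^+ 2) <= e.
  move=> /(cavg_cauchy c_sym c_shift c_psd)[N0 H]; exists N0 => N M N0N N0M.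
  apply: le_trans (H N M N0N N0M).
  have sz : (size (cavg N - cavg M)%R <= (maxn N M).+1)%N.
    rewrite (leq_trans (size_polyD _ _))// size_polyN geq_max.
    by rewrite (leq_trans (size_cavg _ N)) ?(leq_trans (size_cavg _ M))// ltnS leq_max leqnn ?orbT.
  rewrite (pform_U bf sz) le_eqVlt; apply/orP; left; apply/eqP; congr (EI P _); apply/funext => x.
  under [in RHS]eq_bigr do rewrite coefB mulrBl.
  by rewrite sumrB !(sum_cavg (fun a => U a%:Z f x)) ?ltnS ?leq_max ?leqnn ?orbT.
have [phi [mphi phi1 lim]] := l2_complete (fun N => (bA N).1) A1 cau.
have bphi : bm P phi by split => //; exists 1.
have shift : l2null P (fun N x => U 1 (A N) x - A N x).
  apply: (@l2null_unif _ _ _ P _ (fun N => 2 * N%:R^-1)).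
  - by move=> N; apply: bmB => //; exact: bmU.
  - move=> N; apply: filterS Uf1 => x h.
    have -> : U 1 (A N) x - A N x = N%:R^-1 * (U N.+1%:Z f x - U 1 f x).
      rewrite /A /U -mulrBr -sumrB; congr (_ * _).
      rewrite -(telescope_sumr (fun n => f (mps_iter n x)))//.
      by apply: eq_bigr => n _; rewrite -mps_iterD -PoszD addn1.
    rewrite normrM ger0_norm ?invr_ge0// mulrC ler_wpM2r ?invr_ge0//.
    by apply: (le_trans (ler_normB _ _)); rewrite -[2]/(1 + 1) lerD// (h 1%N).
  - by apply: tends0Z; exact: tends0_invn.
have inv : {ae P, forall x, U 1 phi x = phi x}.
  have Ulim : l2null P (fun N x => - 1 * (U 1 (A N) x - U 1 phi x)).
    apply: l2nullZ; first by move=> N; apply: bmB; exact: bmU.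
    apply: tends0_eq lim _ => N.
    by rewrite -[RHS](EIU 1 (bmX 2 (bmB (bA N) bphi))).
  have b1 N : bm P (fun x => - 1 * (U 1 (A N) x - U 1 phi x)).
    by apply: bmZ; apply: bmB; exact: bmU.
  have b2 N : bm P (fun x => U 1 (A N) x - A N x) by apply: bmB => //; exact: bmU.
  have b3 N : bm P (fun x => A N x - phi x) by exact: bmB.
  have := l2nullD (fun N => bmD (b1 N) (b2 N)) b3 (l2nullD b1 b2 Ulim shift) lim.
  rewrite (_ : (fun (N : nat) x => _) = fun (N : nat) x => U 1 phi x - phi x); last first.
    by apply/funext => N; apply/funext => x; ring.
  have bd : bm P (fun x => U 1 phi x - phi x) by apply: bmB => //; exact: bmU.
  move=> h; have le0 := tends0_cst_le0 h (fun=> lexx _).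
  have sq0 : {ae P, forall x, 0 <= (U 1 phi x - phi x) ^+ 2} by apply: aeW => x; exact: sqr_ge0.
  have := EI_eq0 (bmX 2 bd) sq0 (le_anti (introT andP (conj le0 (EI_ge0 (bmX 2 bd) sq0)))).
  by apply: filterS => x /eqP; rewrite sqrf_eq0 subr_eq0 => /eqP.
have Iphi : EI P phi = 0.
  have IA N : EI P (A N) = 0.
    rewrite EIZ; last by apply: bm_sum => n; exact: bmU.
    rewrite EI_sum; last by move=> n; exact: bmU.
    by rewrite big1 ?mulr0// => n _; rewrite EIU.
  apply/eqP; rewrite -sqrf_eq0; apply/eqP/le_anti; rewrite sqr_ge0 andbT.
  apply: (tends0_cst_le0 lim) => N; apply: le_trans (EI_sq_le (bmB (bA N) bphi)).
  by rewrite EIB// IA sub0r sqrrN.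
have phi0 := ergodic_ae_eq0 bphi inv Iphi.
apply: l2null_ae lim => N; [exact: bmB|exact: bA|].
by apply: filterS phi0 => x ->; rewrite subr0.
Qed.

(** Translating the n-th product by T^(-n) lowers every exponent by n: the first function loses its
    power, and the others form an average of k functions. *)
Lemma EI_ravg_shift k (F : 'I_k.+1 -> X -> R) N : (forall i, bm P (F i)) ->
  EI P (ravg F N) = EI P (fun x => F ord0 x * ravg (fun i => F (lift ord0 i)) N x).
Proof.
move=> bF.
pose G (n : nat) x := F ord0 x * \prod_(i < k) U (i.+1 * n)%N%:Z (F (lift ord0 i)) x.
have bG n : bm P (G n) by apply: bmM => //; apply: bm_prod => i; exact: bmU.
transitivity (N%:R^-1 * \sum_(1 <= n < N.+1) EI P (G n)).
  rewrite EIZ; last by apply: bm_sum => n; apply: bm_prod => i; exact: bmU.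
  rewrite EI_sum; last by move=> n; apply: bm_prod => i; exact: bmU.
  congr (_ * _); apply: eq_bigr => n _; rewrite -(EIU n%:Z (bG n)); congr (EI P _).
  apply/funext => x; rewrite big_ord_recl /U /G mul1n; congr (_ * _).
  by apply: eq_bigr => i _; rewrite /U -mps_iterD -PoszD lift0 [in LHS]mulSn addnC.
rewrite -EI_sum// -EIZ; last exact: bm_sum.
congr (EI P _); apply/funext => x; rewrite /ravg mulrCA; congr (_ * _).
by rewrite mulr_sumr.
Qed.

Lemma ae_prod_le1 k (g : 'I_k -> X -> R) : (forall i, {ae P, forall x, `|g i x| <= 1}) ->
  {ae P, forall x, `|\prod_(i < k) g i x| <= 1}.
Proof.
move=> /ae_forall_count; apply: filterS => x h; rewrite normr_prod.
by apply: prodr_ile1 => i _; rewrite normr_ge0 h.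
Qed.

(** In each product all factors but the j-th are bounded by 1, and [norm_le_amgm] estimates the
    j-th. *)
Lemma EI_ravg_le k (F : 'I_k -> X -> R) (j : 'I_k) (t : R) N : (forall i, bm P (F i)) ->
  (forall i, {ae P, forall x, `|F i x| <= 1}) -> 0 < t ->
  EI P (ravg F N) <= t + t^-1 * EI P (fun x => F j x ^+ 2).
Proof.
move=> bF F1 t0.
have bF2 : bm P (fun x => F j x ^+ 2) by exact: bmX.
have I0 := EI_sqr_ge0 (bF j).
case: N => [|N].
  rewrite (_ : ravg F 0 = fun=> 0); last by apply/funext => x; rewrite /ravg invr0 mul0r.
  by rewrite EI_cst addr_ge0 ?mulr_ge0 ?invr_ge0 ?(ltW t0).
have bp n : bm P (fun x => \prod_(i < k) U (i.+1 * n)%N%:Z (F i) x).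
  by apply: bm_prod => i; exact: bmU.
rewrite EIZ; last exact: bm_sum.
rewrite EI_sum// ler_pdivrMl ?ltr0n//.
have -> : N.+1%:R * (t + t^-1 * EI P (fun x => F j x ^+ 2)) =
    \sum_(1 <= n < N.+2) (t + t^-1 * EI P (fun x => F j x ^+ 2)).
  by rewrite sumr_const_nat subn1 /= mulr_natl.
apply: ler_sum => n _.
rewrite -(EIU (j.+1 * n)%N%:Z bF2) -EIZ; last exact: bmU.
rewrite -{1}(EI_cst P t) -EID; [|exact: bm_cst|by apply: bmZ; exact: bmU].
apply: EI_le => //; first by apply: bmD; [exact: bm_cst|apply: bmZ; exact: bmU].
have U1 : {ae P, forall x, forall i : 'I_k, `|U (i.+1 * n)%N%:Z (F i) x| <= 1}.
  by apply: ae_forall_count => i; exact: (ae_U _ (F1 i)).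
apply: filterS U1 => x h; apply: (le_trans (ler_norm _)).
rewrite (bigD1 j)//= normrM.
set y := U _ (F j) x; set z := \prod_(i < k | _) _.
have z1 : `|z| <= 1 by rewrite normr_prod; apply: prodr_ile1 => i _; rewrite normr_ge0 h.
apply: (@le_trans _ _ `|y|); first by rewrite ler_piMr.
exact: norm_le_amgm.
Qed.

(* The functions F_i, [i] > 0, of the van der Corput differences may be replaced by their
   conditional expectations by induction; F_0 may then be replaced as well, since its cofactor is a
   function of the factor. *)
Lemma characteristic_factor_step (D D' : mfactor X) k :
  induces D (L2_closure P (cond_almost_periodic D')) ->
  characteristic D' k.+1 -> characteristic D k.+2.
Proof.
move=> indD char'; apply: characteristic_scale => f j bf f1 fj.
have corr0 := corr_tends0_of_orth Xerg indD (bf j) (f1 j) fj.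
pose u (n : nat) x := \prod_(i < k.+2) U (i.+1 * n)%N%:Z (f i) x.
have bu n : bm P (u n) by apply: bm_prod => i; exact: bmU.
apply: (@van_der_corput _ _ _ P u) => // [n|e e0].
  by apply: ae_prod_le1 => i; exact: (ae_U _ (f1 i)).
have [t t0 te] : exists2 t : R, 0 < t & e = t + t by exists (e / 2); [rewrite divr_gt0|field].
pose l := j.+1; have l0 : 0 < l%:R :> R by rewrite ltr0n.
pose c := corr D' (f j).
have c0 a b : 0 <= c a b.
  by apply: EI_sqr_ge0; apply: bm_ce; apply: bmM; exact: bmU.
(* Dividing by l^2 offsets the factor in [pform_cavg_multiples], so that the double average of the
   bounds is at most t + t^-1 t^2 = e. The choice [H = N0.+1] is positive and gives
   [N0 <= l * H]. *)
have e1 : 0 < t ^+ 2 / l%:R ^+ 2 by rewrite divr_gt0// exprn_gt0.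
have [N0 HN0] := corr0 _ e1.
exists N0.+1, (fun h h' => t + t^-1 * c (l * h)%N (l * h')%N); split => //.
  have H0 : 0 < N0.+1%:R :> R by rewrite ltr0n.
  set H := N0.+1 in H0 *.
  have -> : \sum_(1 <= h < H.+1) \sum_(1 <= h' < H.+1) (t + t^-1 * c (l * h)%N (l * h')%N) =
      H%:R * (H%:R * t) + t^-1 * \sum_(1 <= h < H.+1) \sum_(1 <= h' < H.+1) c (l * h)%N (l * h')%N.
    rewrite mulr_sumr (mulr_natl (H%:R * t) H).
    rewrite (eq_bigr (fun h => H%:R * t + t^-1 * \sum_(1 <= h' < H.+1) c (l * h)%N (l * h')%N)).
      by rewrite big_split /= sumr_const_nat subn1.
    by move=> h _; rewrite big_split /= sumr_const_nat subn1 -(mulr_natl t H) mulr_sumr.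
  set S := \sum_(_ <= _ < _) _.
  have /HN0/(le_trans (ler_norm _)) : (N0 <= l * H)%N by rewrite (leq_trans (leqnSn _))// leq_pmull.
  rewrite -/c ler_pdivlMr ?exprn_gt0// mulrC => /(le_trans (pform_cavg_multiples _ _ c0)) S_le.
  rewrite [leLHS](_ : _ = t + t^-1 * (H%:R^-1 * (H%:R^-1 * S))); last by field; rewrite !gt_eqF.
  have -> : e = t + t^-1 * t ^+ 2 by rewrite te expr2 mulKf ?gt_eqF.
  by rewrite lerD2l ler_pM2l ?invr_gt0// S_le.
move=> h h'.
(* The products of u at n + h and at n + h' are the terms of [ravg F]. The squared L^2 norm of
   E_Y(F_j) is c(l h, l h') by definition of [corr]. *)
pose F (i : 'I_k.+2) x := U (i.+1 * h)%N%:Z (f i) x * U (i.+1 * h')%N%:Z (f i) x.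
have bF i : bm P (F i) by apply: bmM; exact: bmU.
have F1 i : {ae P, forall x, `|F i x| <= 1}.
  by apply: filterS2 (ae_U (i.+1 * h)%N (f1 i)) (ae_U (i.+1 * h')%N (f1 i)) => x p q; rewrite normrM mulr_ile1.
pose eF (i : 'I_k.+2) := ce D' (F i).
have beF i : bm P (eF i) by exact: bm_ce.
have eF1 i : {ae P, forall x, `|eF i x| <= 1} by exact: ce_bound.
pose F' (i : 'I_k.+1) := F (lift ord0 i); pose eF' (i : 'I_k.+1) := eF (lift ord0 i).
have bF' N : bm P (ravg F' N) by apply: bm_ravg => i; exact: bF.
have beF' N : bm P (ravg eF' N) by apply: bm_ravg => i; exact: beF.
exists (fun N => EI P (fun x => F ord0 x * (ravg F' N x - ravg eF' N x))); split.
  apply: tends0_EI => // [N|]; first exact: bmB.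
  apply: (characteristic_replace char' (fun i => bF _) (fun i => beF _)) => i m hm.
  rewrite (_ : (fun x => _) = (fun x => F' i x * m x - eF' i x * m x)); last first.
    by apply/funext => x; rewrite mulrBl.
  have bm' := Mfun_bm hm; rewrite EIB; [|exact: bmM (bF _) bm'|exact: bmM (beF _) bm'].
  by rewrite (ce_adj (bF _) hm) subrr.
move=> N.
have -> : (fun x => N%:R^-1 * \sum_(1 <= n < N.+1) u (n + h)%N x * u (n + h')%N x) = ravg F N.
  apply/funext => x; congr (_ * _); apply: eq_bigr => n _.
  rewrite /u -big_split; apply: eq_bigr => i _ /=.
  by rewrite /F /U -!mps_iterD -!PoszD !mulnDr ![(i.+1 * n + _)%N]addnC.
rewrite EI_ravg_shift// -/F'.
have -> : EI P (fun x => F ord0 x * ravg F' N x) = EI P (fun x => F ord0 x * ravg eF' N x) +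
    EI P (fun x => F ord0 x * (ravg F' N x - ravg eF' N x)).
  rewrite -EID; [|exact: bmM|by apply: bmM => //; exact: bmB].
  by congr (EI P _); apply/funext => x; ring.
rewrite lerD2r.
have MeF' : Mfun D' (ravg eF' N).
  by apply: MfunZ; apply: Mfun_sum => n; apply: Mfun_prod => i; apply: MfunU; exact: Mfun_ce.
rewrite (ce_adj (bF ord0) MeF') -(EI_ravg_shift N beF).
exact: EI_ravg_le.
Qed.

(** Constants are functions of every factor, so the function has mean zero. *)
Lemma characteristic_single (D : mfactor X) : characteristic D 1.
Proof.
apply: characteristic_scale => f j bf f1 fj.
have f0 : EI P (f j) = 0.
  rewrite -(fj _ (Mfun_cst D 1)); congr (EI P _); apply/funext => x; exact/esym/mulr1.
have := mean_ergodic (bf j) (f1 j) f0.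
apply: l2null_ae => N; [by apply: bmZ; apply: bm_sum => n; exact: bmU|exact: bm_ravg|].
apply: aeW => x; congr (_ * _); apply: eq_bigr => n _.
by rewrite big_ord_recl big_ord0 mulr1 mul1n (ord1 j).
Qed.

Lemma distal_characteristic k (D : mfactor X) : distal_factor k D -> characteristic D k.+1.
Proof.
elim: k D => [|k IH] D /=; first by move=> _; exact: characteristic_single.
by move=> [D' [/IH char' indD]]; exact: characteristic_factor_step indD char'.
Qed.

End MeanErgodic.

(** * Complex functions and the orthogonal projection *)

Section L2Norm.
Context (d : measure_display) (T : measurableType d) (R : realType).
Variable P : probability T R.
Implicit Types f g : T -> R[i].

Lemma cmodD (z w : R[i]) : cmod (z + w) <= cmod z + cmod w.
Proof. by have := ler_normD z w; rewrite lecE => /andP[_]; rewrite raddfD. Qed.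

Lemma cmodM (z w : R[i]) : cmod (z * w) = cmod z * cmod w.
Proof.
rewrite !cmodE -sqrtrM ?addr_ge0 ?sqr_ge0//; congr Num.sqrt.
by case: z w => [a b] [a' b'] /=; ring.
Qed.

Lemma cmodN (z : R[i]) : cmod (- z) = cmod z.
Proof. by rewrite /cmod normrN. Qed.

Lemma cmod_eq0 (z : R[i]) : cmod z = 0 -> z = 0.
Proof.
move=> h; have := cmod_sq z; rewrite h expr0n /= => /esym/eqP.
rewrite paddr_eq0 ?sqr_ge0// !sqrf_eq0 => /andP[/eqP r /eqP i].
by rewrite [z]complexE r i mulr0 addr0.
Qed.

Lemma cmod_sum (I : Type) (s : seq I) (F : I -> R[i]) :
  cmod (\sum_(i <- s) F i) <= \sum_(i <- s) cmod (F i).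
Proof.
elim: s => [|i s IH]; last by rewrite !big_cons (le_trans (cmodD _ _))// lerD2l.
by rewrite !big_nil (_ : 0 = 0%:C%C)// cmod_real normr0.
Qed.

Lemma cLnorm2_le f (t : T -> R) : cmeasurable f -> measurable_fun setT t ->
  {ae P, forall x, cmod (f x) <= t x} -> (cLnorm P 2%:E f <= 'N[P]_2%:E[EFin \o t])%E.
Proof.
move=> mf mt ft; rewrite /cLnorm unlock; apply: gt0_ler_poweR => //.
- by rewrite in_itv /= leey integral_ge0.
- by rewrite in_itv /= leey integral_ge0.
have mp (u : T -> R) : measurable_fun setT u ->
    measurable_fun setT (fun x => (`|(EFin \o u) x| `^ 2)%E).
  move=> /measurable_EFinP mu'; apply: (@measurableT_comp _ _ _ _ _ _ (fun x => x `^ 2)%E).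
    exact: measurable_poweR.
  exact: measurableT_comp.
apply: ae_ge0_le_integral => //; [|exact: mp (cmeasurable_cmod mf)| |exact: mp|].
- by move=> x _; exact: poweR_ge0.
- by move=> x _; exact: poweR_ge0.
apply: filterS ft => x h _ /=; rewrite lee_fin; apply: ge0_ler_powR => //.
rewrite ger0_norm ?cmod_ge0//; exact: le_trans h (ler_norm _).
Qed.

Lemma cLnorm2_triangle f g h : cmeasurable f -> cmeasurable g -> cmeasurable h ->
  (forall x, cmod (h x) <= cmod (f x) + cmod (g x)) ->
  (cLnorm P 2%:E h <= cLnorm P 2%:E f + cLnorm P 2%:E g)%E.
Proof.
move=> mf mg mh H; have mf' := cmeasurable_cmod mf; have mg' := cmeasurable_cmod mg.
have le12 : 1 <= 2 :> R by rewrite ler1n.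
apply: le_trans (minkowski_EFin P mf' mg' le12).
by apply: cLnorm2_le => //; [exact: measurable_funD|apply: aeW].
Qed.

Lemma cLnorm2_cvg0 (u : nat -> T -> R[i]) (t : nat -> T -> R) :
  (forall N, cmeasurable (u N)) -> (forall N, bm P (t N)) ->
  (forall N, {ae P, forall x, cmod (u N x) <= t N x}) -> l2null P t ->
  (fun N => cLnorm P 2%:E (u N)) @ \oo --> 0%E.
Proof.
move=> mu' bt ut t0.
pose a N := Num.sqrt (EI P (fun x => t N x ^+ 2)).
have ua N : (cLnorm P 2%:E (u N) <= (a N)%:E)%E.
  apply: (le_trans (cLnorm2_le (mu' N) (bt N).1 (ut N))).
  rewrite unlock /= /a -powR12_sqrt; last first.
    exact: (EI_sqr_ge0 (bt N)).
  rewrite (_ : (\int[P]_x _)%E = (EI P (fun x => t N x ^+ 2))%:E) ?poweR_EFin//.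
  rewrite /EI /Rintegral fineK; last exact: integrable_fin_num (bm_integrable (bmX 2 (bt N))).
  by apply: eq_integral => x _ /=; rewrite powR_mulrn// real_normK ?num_real.
have a0 : a @ \oo --> (0 : R).
  apply/cvg_tends0 => e e0; have [N0 H] := t0 _ (exprn_gt0 2 e0); exists N0 => N /H h.
  rewrite ger0_norm ?sqrtr_ge0// -[leRHS](ger0_norm (ltW e0)) -sqrtr_sqr ler_wsqrtr//.
  exact: le_trans (ler_norm _) h.
apply: (@squeeze_cvge _ _ _ _ (fun=> 0%E) _ (fun N => (a N)%:E)).
- by apply: nearW => N; rewrite ua Lnorm_ge0.
- exact: cvg_cst.
- by apply: cvg_EFin a0; exact: nearW.
Qed.

Lemma L2_cvg_close (u v : nat -> T -> R[i]) g :
  (forall N, cmeasurable (u N)) -> (forall N, cmeasurable (v N)) ->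
  (fun N => cLnorm P 2%:E (fun x => u N x - v N x)) @ \oo --> 0%E ->
  L2_cvg P u g -> L2_cvg P v g.
Proof.
move=> mu' mv uv [g2 ug]; split => //.
pose A N := cLnorm P 2%:E (fun x => u N x - v N x).
pose B N := cLnorm P 2%:E (fun x => u N x - g x).
apply: (@squeeze_cvge _ _ _ _ (fun=> 0%E) _ (fun N => A N + B N)%E).
- apply: nearW => N; rewrite Lnorm_ge0 /=; apply: cLnorm2_triangle.
  + exact: cmeasurableB.
  + by apply: cmeasurableB => //; case: g2.
  + by apply: cmeasurableB => //; case: g2.
  move=> x; rewrite -(cmodN (u N x - v N x)); apply: le_trans (cmodD _ _).
  by rewrite opprB addrA subrK.
- exact: cvg_cst.
- by rewrite -(adde0 0%E); apply: cvgeD.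
Qed.

Lemma L2_cvg_unique (u : nat -> T -> R[i]) g h : (forall N, cmeasurable (u N)) ->
  L2_cvg P u g -> L2_cvg P u h -> {ae P, forall x, g x = h x}.
Proof.
move=> mu' [[mg _] ug] [[mh _] uh].
have mgh := cmeasurableB mg mh.
have n0 : cLnorm P 2%:E (fun x => g x - h x) = 0%E.
  apply/eqP; rewrite eq_le Lnorm_ge0 andbT.
  pose A N := cLnorm P 2%:E (fun x => u N x - g x).
  pose B N := cLnorm P 2%:E (fun x => u N x - h x).
  have s0 : (fun N => A N + B N)%E @ \oo --> 0%E.
    by rewrite -(adde0 0%E); apply: cvgeD.
  apply: (cvge_ge _ s0) => //; apply: nearW => N; apply: cLnorm2_triangle.
  - exact: cmeasurableB.
  - exact: cmeasurableB.
  - exact: mgh.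
  move=> x; rewrite -(cmodN (u N x - g x)); apply: le_trans (cmodD _ _).
  by rewrite opprB addrA subrK.
have := Lnorm_eq0_eq0 _ _ n0 => /(_ _ _)/=.
have mc : measurable_fun setT (EFin \o (@cmod R \o (fun x => g x - h x))).
  by apply/measurable_EFinP; exact: cmeasurable_cmod.
move=> /(_ mc (ltr0n _ 2)); apply: filterS => x /(_ I) [/cmod_eq0/eqP].
by rewrite subr_eq0 => /eqP.
Qed.

End L2Norm.

Section Projection.
Variables (R : realType) (X : mpsystem R) (D : mfactor X).
Local Notation mu := (mps_prob X).

Lemma inLpB (d : measure_display) (T : measurableType d) (Q : probability T R) (f g : T -> R[i]) :
  inLp Q 2%:E f -> inLp Q 2%:E g -> inLp Q 2%:E (fun x => f x - g x).
Proof.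
move=> [mf hf] [mg hg]; have mfg := cmeasurableB mf mg; split => //.
apply: le_lt_trans (lte_add_pinfty hf hg); apply: cLnorm2_triangle => // x.
by rewrite -(cmodN (g x)) cmodD.
Qed.

Lemma factor_spaceB (f g : X -> R[i]) : factor_space D f -> factor_space D g ->
  factor_space D (fun x => f x - g x).
Proof.
move=> [f2 [f' f'2 ef]] [g2 [g' g'2 eg]]; split; first exact: inLpB.
exists (fun y => f' y - g' y); first exact: inLpB.
have le12 : (1 <= 2%:E :> \bar R)%E by rewrite lee_fin ler1n.
have f'1 := inLp_le (lexx _) le12 le12 f'2; have g'1 := inLp_le (lexx _) le12 le12 g'2.
apply: filterS3 ef eg (mf_linear (-1) g'1 f'1) => x -> ->.
rewrite (_ : (fun y => -1 * _ + _) = (fun y => f' y - g' y)); last first.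
  by apply/funext => y; rewrite mulN1r addrC.
by move=> ->; rewrite mulN1r addrC.
Qed.

(** An essentially bounded representative of the orthogonal projection, by [orth_proj_bounded]. *)
Definition cce (f : X -> R[i]) : X -> R[i] := fun x =>
  Complex (ce D (@complex.Re R \o f) x) (ce D (@complex.Im R \o f) x).

Lemma factor_space_cce f : inLp mu +oo%E f -> factor_space D (cce f).
Proof.
move=> hf; have bR := inLoo_Re hf; have bI := inLoo_Im hf.
have in2 (d : measure_display) (T : measurableType d) (Q : probability T R) (a b : T -> R) :
    bm Q a -> bm Q b -> inLp Q 2%:E (fun x => Complex (a x) (b x)).
  move=> [ma [A hA]] [mb [B hB]]; apply: (@inLp_le _ _ _ _ 2%:E +oo%E).
  - by rewrite lee_fin ler1n.
  - by rewrite leey.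
  - by rewrite leey.
  apply/inLp_ooP; split; first by split.
  exists (A + B); apply: filterS2 hA hB => x p q.
  by apply: (le_trans (cmod_le _)); exact: lerD.
split; first by apply: in2; exact: bm_ce.
exists (fun y => Complex (@cE R X D (@complex.Re R \o f) y) (@cE R X D (@complex.Im R \o f) y)).
  by apply: in2; exact: bm_cE.
have h1 : inLp (mps_prob D) 1%E
    (fun y => Complex (@cE R X D (@complex.Re R \o f) y) (@cE R X D (@complex.Im R \o f) y)).
  apply: (@inLp_le _ _ _ _ 1%E 2%:E) => //; rewrite ?lee_fin ?ler1n//.
  by apply: in2; exact: bm_cE.
by apply: filterS (op_ReIm h1) => x ->.
Qed.

(** The difference r of the two candidates lies in the subspace, and both residuals f - Pr f and f -
    cce f are orthogonal to it; hence r is orthogonal to itself. *)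
Lemma orth_proj_bounded (Pr : (X -> R[i]) -> (X -> R[i])) f :
  is_orth_proj mu (factor_space D) Pr -> inLp mu +oo%E f ->
  {ae mu, forall x, Pr f x = cce f x}.
Proof.
move=> proj hf; have bR := inLoo_Re hf; have bI := inLoo_Im hf.
have le12 : (1 <= 2%:E :> \bar R)%E by rewrite lee_fin ler1n.
have f2 : inLp mu 2%:E f by apply: inLp_le hf; rewrite ?leey.
have [PfD orth] := proj _ f2.
have rD := factor_spaceB PfD (factor_space_cce hf).
set r := (fun x => _) in rD.
have r2 : inLp mu 2%:E r by case: rD.
have r1 := inLp_le (lexx _) le12 le12 r2.
have res (F : X -> R) : bm mu F ->
    EI mu (fun x => (F x - ce D F x) * complex.Re (r x)) = 0 /\
    EI mu (fun x => (F x - ce D F x) * complex.Im (r x)) = 0.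
  move=> bF; apply: (orth_factor_space (bmB bF (bm_ce D bF)) _ rD) => m hm.
  have bm' := Mfun_bm hm.
  rewrite (_ : (fun x => _) = (fun x => F x * m x - ce D F x * m x)); last first.
    by apply/funext => x; rewrite mulrBl.
  by rewrite EIB ?(ce_adj bF hm) ?subrr//; apply: bmM => //; exact: bm_ce.
have [a1 _] := res _ bR; have [_ b1] := res _ bI.
have := orth _ rD => /(congr1 (@complex.Re R)) /=.
(* [S] is |r|^2. With [A + B] the real part of (f - cce f) conj(r), the real part of (f - Pr f)
   conj(r) is A + B - S. *)
pose S x := complex.Re (r x) ^+ 2 + complex.Im (r x) ^+ 2.
have iS : rL1 mu S.
  apply/integrableP; split.
    by apply/measurable_EFinP; case: r2 => -[? ?] _; apply: measurable_funD; exact: measurable_funX.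
  have : (cLnorm mu 2%:E r `^ 2 < +oo)%E by apply: poweR_lty; case: r2.
  rewrite /cLnorm poweR_Lnorm//; apply: le_lt_trans.
  rewrite le_eqVlt; apply/orP; left; apply/eqP; apply: eq_integral => x _ /=.
  congr (_%:E); rewrite powR_mulrn// real_normK ?num_real// cmod_sq ger0_norm//.
  by rewrite addr_ge0// sqr_ge0.
pose A x := (complex.Re (f x) - ce D (@complex.Re R \o f) x) * complex.Re (r x).
pose B x := (complex.Im (f x) - ce D (@complex.Im R \o f) x) * complex.Im (r x).
have iA : rL1 mu A by apply: rL1_bmM (inL1_Re r1); apply: bmB => //; exact: bm_ce.
have iB : rL1 mu B by apply: rL1_bmM (inL1_Im r1); apply: bmB => //; exact: bm_ce.
rewrite -/(EI mu _) (_ : (fun x => _) = (fun x => (A x + B x) - S x)); last first.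
  apply/funext => x; rewrite /A /B /S /r /cce; case: (f x) => p q; case: (Pr f x) => p' q' /=; ring.
rewrite rEIB//; last exact: rL1D.
rewrite rEID// -/A /A /= a1 /B b1 addr0 sub0r => /eqP; rewrite oppr_eq0 => /eqP I0.
have S0 : {ae mu, forall x, 0 <= S x} by apply: aeW => x; rewrite addr_ge0// sqr_ge0.
apply: filterS (rEI_eq0 iS S0 I0) => x /eqP.
rewrite paddr_eq0 ?sqr_ge0// !sqrf_eq0 => /andP[/eqP r0 /eqP i0].
by apply/eqP; rewrite -subr_eq0 -/(r x) [r x]complexE r0 i0 mulr0 addr0.
Qed.

End Projection.

(** * Reduction of complex averages to real ones *)

Section ComplexAverages.
Variables (R : realType) (X : mpsystem R).
Local Notation P := (mps_prob X).
Local Notation RC := (fun x : R => x%:C%C).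

(* The coefficient in the expansion of prod_i (a_i + i b_i) over the choices [s] of real or
   imaginary parts. *)
Definition im_weight (k : nat) (s : {ffun 'I_k -> bool}) : R[i] :=
  \prod_(i < k) (if s i then 'i%C else 1).

Definition re_im_choice (k : nat) (a b : 'I_k -> X -> R) (s : {ffun 'I_k -> bool}) : 'I_k -> X -> R :=
  fun i => if s i then b i else a i.

Lemma cmod_im_weight k (s : {ffun 'I_k -> bool}) : cmod (im_weight s) = 1.
Proof.
have c1 : cmod (1 : R[i]) = 1 by rewrite (_ : 1 = RC 1)// cmod_real normr1.
rewrite /im_weight; elim/big_ind: _ => // [z w hz hw|i _]; first by rewrite cmodM hz hw mulr1.
by case: (s i); rewrite // cmodE /= expr0n add0r expr1n sqrtr1.
Qed.

Lemma multiple_average_expand k (a b : 'I_k -> X -> R) N x :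
  multiple_average (fun i x => Complex (a i x) (b i x)) N x =
  \sum_(s : {ffun 'I_k -> bool}) im_weight s * RC (ravg (re_im_choice a b s) N x).
Proof.
have prodE n : \prod_(i < k) koopman (Posz (i.+1 * n)) (fun x => Complex (a i x) (b i x)) x =
    \sum_(s : {ffun 'I_k -> bool}) im_weight s * RC (\prod_(i < k) U (i.+1 * n)%N%:Z (re_im_choice a b s i) x).
  rewrite (eq_bigr (fun i : 'I_k => \sum_(c : bool) (if c then 'i%C else 1) *
      RC (U (i.+1 * n)%N%:Z (if c then b i else a i) x))); last first.
    by move=> i _; rewrite big_bool /= mul1r /koopman /U addrC [LHS]complexE.
  rewrite bigA_distr_bigA; apply: eq_bigr => s _; rewrite big_split /=; congr (_ * _).
  by rewrite rmorph_prod.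
rewrite /multiple_average; under eq_bigr do rewrite prodE.
rewrite exchange_big mulr_sumr; apply: eq_bigr => s _.
rewrite -mulr_sumr mulrCA; congr (_ * _).
by rewrite /ravg rmorphM rmorph_sum fmorphV rmorph_nat.
Qed.

Lemma cmeasurable_multiple_average k (f : 'I_k -> X -> R[i]) N :
  (forall i, cmeasurable (f i)) -> cmeasurable (multiple_average f N).
Proof.
move=> mf; apply: cmeasurableM; first exact: cmeasurable_cst.
apply: cmeasurable_sum => n; apply: cmeasurable_prod => i; case: (mf i) => mr mi; split.
  exact: (measurableT_comp mr (measurable_mps_iter _)).
exact: (measurableT_comp mi (measurable_mps_iter _)).
Qed.

Lemma multiple_average_ae k (f g : 'I_k -> X -> R[i]) N :
  (forall i, {ae P, forall x, f i x = g i x}) ->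
  {ae P, forall x, multiple_average f N x = multiple_average g N x}.
Proof.
move=> fg; have : {ae P, forall x, forall (i : 'I_k) (n : nat),
    f i (mps_iter (i.+1 * n)%N%:Z x) = g i (mps_iter (i.+1 * n)%N%:Z x)}.
  apply: ae_forall_count => i; apply: ae_foralln => n; exact: (ae_U _ (fg i)).
apply: filterS => x h; congr (_ * _); apply: eq_bigr => n _; apply: eq_bigr => i _.
exact: h.
Qed.

(** Both averages are expanded over the choices of real or imaginary parts. The weights have modulus
    1, so a finite sum of real null sequences dominates the difference. *)
Lemma multiple_average_cce_cvg0 (D : mfactor X) k (f : 'I_k -> X -> R[i]) :
  characteristic D k -> (forall i, inLp P +oo%E (f i)) ->
  (fun N => cLnorm P 2%:E (fun x =>
     multiple_average f N x - multiple_average (fun i => cce D (f i)) N x)) @ \oo --> 0%E.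
Proof.
move=> charD bf.
pose a i := @complex.Re R \o f i; pose b i := @complex.Im R \o f i.
have ba i : bm P (a i) by exact: inLoo_Re.
have bb i : bm P (b i) by exact: inLoo_Im.
pose ea i := ce D (a i); pose eb i := ce D (b i).
pose w s N x := ravg (re_im_choice a b s) N x - ravg (re_im_choice ea eb s) N x.
have bp s i : bm P (re_im_choice a b s i) by rewrite /re_im_choice; case: (s i).
have bep s i : bm P (re_im_choice ea eb s i) by rewrite /re_im_choice; case: (s i); exact: bm_ce.
have bw s N : bm P (w s N) by apply: bmB; exact: bm_ravg.
have w0 s : l2null P (fun N x => `|w s N x|).
  have : l2null P (w s).
    apply: (characteristic_replace charD) => // i m hm; have bm' := Mfun_bm hm.
    have key (F : X -> R) : bm P F -> EI P (fun x => (F x - ce D F x) * m x) = 0.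
      move=> bF; rewrite (_ : (fun x => _) = (fun x => F x * m x - ce D F x * m x)).
        by rewrite EIB ?(ce_adj bF hm) ?subrr//; apply: bmM => //; exact: bm_ce.
      by apply/funext => x; rewrite mulrBl.
    by rewrite /re_im_choice; case: (s i); exact: key.
  by move=> h; apply: tends0_eq h _ => N; congr (EI P _); apply/funext => x;
    rewrite real_normK ?num_real.
apply: (@cLnorm2_cvg0 _ _ _ P _ (fun N x => \sum_(s : {ffun 'I_k -> bool}) `|w s N x|)).
- move=> N; apply: cmeasurableB; apply: cmeasurable_multiple_average => i.
    by case: (bf i).
  by case: (factor_space_cce D (bf i)) => -[].
- by move=> N; apply: bm_sum => s; exact: bm_norm.
- move=> N; apply: aeW => x.
  have -> : multiple_average f N x = multiple_average (fun i x => Complex (a i x) (b i x)) N x.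
    by congr (multiple_average _ N x); apply/funext => i; apply/funext => y;
      rewrite /a /b /=; case: (f i y).
  rewrite (multiple_average_expand a b) (multiple_average_expand ea eb) -sumrB.
  apply: le_trans (cmod_sum _ _) _; apply: ler_sum => s _.
  by rewrite -mulrBr cmodM cmod_im_weight mul1r -rmorphB cmod_real.
- by apply: l2null_sum => // s N; exact: bm_norm.
Qed.

End ComplexAverages.

Theorem mainTheorem3 (R : realType) (X : mpsystem R) (X_ergodic : ergodic X)
    (k : nat) (k_gt0 : (0 < k)%N)
    (D : mfactor X) (D_distal : distal_factor k.-1 D)
    (P : (X -> R[i]) -> (X -> R[i]))
    (P_proj : is_orth_proj (mps_prob X) (factor_space D) P)
    (f : 'I_k -> X -> R[i])
    (f_bounded : forall i, inLp (mps_prob X) +oo%E (f i)) :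
  (L2_converges (mps_prob X) (multiple_average f) <->
   L2_converges (mps_prob X) (multiple_average (fun i => P (f i)))) /\
  (forall g h : X -> R[i],
     L2_cvg (mps_prob X) (multiple_average f) g ->
     L2_cvg (mps_prob X) (multiple_average (fun i => P (f i))) h ->
     {ae mps_prob X, forall x, g x = h x}).
Proof.
have charD : characteristic D k by have := distal_characteristic X_ergodic D_distal; rewrite prednK.
pose u := multiple_average f; pose v := multiple_average (fun i => P (f i)).
(* The projections are known only as elements of L^2; [cce] supplies bounded representatives, to
   which the comparison of averages applies. *)
pose w := multiple_average (fun i => cce D (f i)).
have Pf i : {ae mps_prob X, forall x, P (f i) x = cce D (f i) x} by exact: orth_proj_bounded.
have mu N : cmeasurable (u N).
  by apply: cmeasurable_multiple_average => i; case: (f_bounded i).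
have mv N : cmeasurable (v N).
  apply: cmeasurable_multiple_average => i.
  have f2 : inLp (mps_prob X) 2%:E (f i).
    by apply: inLp_le (f_bounded i); rewrite ?leey ?lee_fin ?ler1n.
  by case: (P_proj _ f2) => -[[]].
have mw N : cmeasurable (w N).
  by apply: cmeasurable_multiple_average => i; case: (factor_space_cce D (f_bounded i)) => -[].
have uw := multiple_average_cce_cvg0 charD f_bounded; rewrite -/u -/w in uw.
have to_w g : L2_cvg (mps_prob X) v g <-> L2_cvg (mps_prob X) w g.
  have cvg0 (p q : nat -> X -> R[i]) : (forall N, cmeasurable (p N)) -> (forall N, cmeasurable (q N)) ->
      (forall N, {ae mps_prob X, forall x, p N x = q N x}) ->
      (fun N => cLnorm (mps_prob X) 2%:E (fun x => p N x - q N x)) @ \oo --> 0%E.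
    move=> mp mq pq; apply: (@cLnorm2_cvg0 _ _ _ _ _ (fun _ _ => 0)) => [N|N|N|].
    - exact: cmeasurableB.
    - exact: bm_cst.
    - apply: filterS (pq N) => x ->; rewrite subrr (_ : 0 = 0%:C%C :> R[i])// cmod_real normr0//.
    - move=> e e0; exists 0%N => N _; rewrite (_ : (fun=> _) = fun=> 0); last first.
        by apply/funext => x; rewrite expr0n.
      by rewrite EI_cst normr0 ltW.
  have vw N : {ae mps_prob X, forall x, v N x = w N x} by exact: multiple_average_ae.
  split; apply: L2_cvg_close => //; apply: cvg0 => // N.
  by apply: filterS (vw N) => x ->.
have wu : (fun N => cLnorm (mps_prob X) 2%:E (fun x => w N x - u N x)) @ \oo --> 0%E.
  apply: cvg_trans uw; apply: near_eq_cvg; apply: nearW => N; apply: eq_Lnorm => x /=.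
  by rewrite -cmodN opprB.
have uv g : L2_cvg (mps_prob X) u g -> L2_cvg (mps_prob X) v g.
  by move=> /(L2_cvg_close mu mw uw)/to_w.
have vu g : L2_cvg (mps_prob X) v g -> L2_cvg (mps_prob X) u g.
  by move=> /to_w; exact: L2_cvg_close.
split; first by split => -[g hg]; exists g; [exact: uv|exact: vu].
by move=> g h /uv hg hh; exact: L2_cvg_unique mv hg hh.
Qed.
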